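(* Let $b,c$ be real numbers with $b\ge \max\{c,2c-1\}>0$, let $n\ge0$ be an integer, let $\lambda\in[\frac12,1)$ and let $f\in\mathcal{S}^{\ast}(\lambda)$. Then $$\frac{z\,\sigma_n^{(b-1,c)}(f/z,z)}{f(z)}\prec (1-z)^{2-2\lambda}\qquad (z\in\mathbb{D}).$$
   Context: $\mathbb{D}=\{z\in\mathbb{C}:|z|<1\}$. $(x)_0=1$, $(x)_k=x(x+1)\cdots(x+k-1)$. Put $B_0=1$ and $B_k=\frac{(b)_k}{(c)_k}\cdot\frac{1+b-c}{b}$ for $k\ge1$. For $h(z)=\sum_{k\ge0}a_kz^k$ analytic in $\mathbb{D}$ with $h(0)=1$, $\sigma_n^{(b-1,c)}(h,z)=\frac1{B_n}\sum_{k=0}^n B_{n-k}a_kz^k$; here it is applied to $h(z)=f(z)/z$. $\mathcal{S}^{\ast}(\lambda)$ is the class of starlike functions of order $\lambda$: analytic $f$ in $\mathbb{D}$ with $f(0)=0$, $f'(0)=1$ and $\mathrm{Re}\frac{zf'(z)}{f(z)}>\lambda$ in $\mathbb{D}$. Powers of $1-z$ are principal branches, and quotients with a removable singularity at $0$ are extended analytically. For analytic $F,G$ in $\mathbb{D}$, $F\prec G$ means there is an analytic $\omega:\mathbb{D}\to\mathbb{D}$ with $|\omega(z)|\le|z|$ and $F(z)=G(\omega(z))$ for all $z\in\mathbb{D}$. *)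

(* Defs.v *)
From Stdlib Require Export Reals.
From Coquelicot Require Export Coquelicot.
Open Scope R_scope.

Definition in_disk (z : C) : Prop := Cmod z < 1.

(* Analyticity is complex differentiability at every point: both the field of
   scalars and the target are C here, so the derivative is the complex one. *)
Definition analytic_on_disk (f : C -> C) : Prop :=
  forall z : C, in_disk z ->
    ex_derive (K := C_AbsRing) (V := C_NormedModule) f z.

(* Extension of [g] across a removable singularity at 0.  [C_lim] is total; it
   is the complex limit at a punctured point whenever that limit exists. *)
Definition extend0 (g : C -> C) (z : C) : C :=
  if Ceq_dec z (RtoC 0) then C_lim g (RtoC 0) else g z.

(* [a] is the sequence of Taylor coefficients at 0 of [h] in the disk. *)
Definition power_series_on_disk (a : nat -> C) (h : C -> C) : Prop :=
  forall z : C, in_disk z ->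
    is_pseries (K := C_AbsRing) (V := C_NormedModule) a z (h z).

(* Principal argument, with values in (-PI, PI]; unspecified at 0. *)
Definition Carg (z : C) : R :=
  if Rle_dec 0 (Im z) then acos (Re z / Cmod z) else - acos (Re z / Cmod z).

Definition Clog (z : C) : C := (ln (Cmod z), Carg z).

Definition Cexp (z : C) : C := (exp (Re z) * cos (Im z), exp (Re z) * sin (Im z)).

(* Principal branch of the real power z^s, for z <> 0. *)
Definition Cpower (z : C) (s : R) : C := Cexp (RtoC s * Clog z)%C.

Fixpoint poch (x : R) (k : nat) : R :=
  match k with
  | O => 1
  | S k' => poch x k' * (x + INR k')
  end.

Definition B (b c : R) (k : nat) : R :=
  match k with
  | O => 1
  | S _ => poch b k / poch c k * ((1 + b - c) / b)
  end.

(* The mean sigma_n^(b-1,c) of the function with Taylor coefficients [a];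
   note the shift: the first argument here is b, not b-1. *)
Definition cesaro (b c : R) (n : nat) (a : nat -> C) (z : C) : C :=
  (RtoC (/ B b c n) *
     sum_n (G := C_AbelianMonoid)
       (fun k : nat => RtoC (B b c (n - k)) * a k * Cpow z k) n)%C.

(* At z = 0 the quotient z f'(z) / f(z) has a removable singularity (its
   extended value is 1).  The nonvanishing clause is what makes it a genuine
   quotient elsewhere, since division by 0 is total. *)
Definition starlike_of_order (lambda : R) (f : C -> C) : Prop :=
  analytic_on_disk f /\
  f (RtoC 0) = RtoC 0 /\
  C_derive f (RtoC 0) = RtoC 1 /\
  (forall z : C, in_disk z -> z <> RtoC 0 -> f z <> RtoC 0) /\
  (forall z : C, in_disk z ->
     Re (extend0 (fun w : C => (w * C_derive f w / f w)%C) z) > lambda).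

Definition subordinate (F G : C -> C) : Prop :=
  analytic_on_disk F /\ analytic_on_disk G /\
  exists omega : C -> C,
    analytic_on_disk omega /\
    (forall z : C, in_disk z -> in_disk (omega z)) /\
    (forall z : C, in_disk z -> Cmod (omega z) <= Cmod z) /\
    (forall z : C, in_disk z -> F z = G (omega z)).

(* Main.v *)
Require Import Defs.
From Stdlib Require Import Reals Ranalysis5 Lra Lia Psatz.
From Coquelicot Require Import Coquelicot.

(** Why the theorem holds.

    Put [mu = 2 - 2 lambda], so [0 < mu <= 1], and [h = f/z], so that
    [Re (z h'/h) > - mu/2].  It has to be shown that [sigma_n(h)/h] takes the
    form [(1 - omega)^mu] with [|omega(z)| <= |z|].

    The model case is [h = (1-w)^(-mu)].  If [S] is a partial sum of this
    binomial series and [F = (1-w)^mu S], then [F'] is a monomial times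
    [(1-w)^(mu-1)], hence the derivative of [v = 1 - F^(1/mu)] is a positive
    multiple of [w^n S^(1/mu-1)].  On a circle the modulus of the latter is
    largest at the positive point, so that [|v(w)| <= v(|w|) <= |w|]
    ([root_binom_ratio_bound]).

    The general case is an average of model cases.  By Herglotz, [h] is a limit
    of products of [(1 - x_i z)^(- mu m_i)], where the weights [m_i] are
    positive with sum one and the [x_i] lie on a circle.  Fix [z], and let [A]
    be the random mean of the numbers [1/(1 - x_i z)] for Dirichlet weights with
    parameters [mu m_i].  The Dirichlet integral
    [E (A (1-y) + y)^(-mu) = h(yz)/h(z)], read coefficient by coefficient in
    [y], says that [a_k z^k / h(z)] is the expectation of the [kernel], which is
    [A^(-mu) (1 - 1/A)^k] times [binom_coef mu k].  With [w = 1 - 1/A] the kernels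
    are the terms of the model case, so that [sigma_n(h)/h] at [z] is a limit of
    averages of model values at points [w] with [|w| <= r], for each [r > |z|].

    No integral over a simplex is computed.  The law of [A] is characterised as
    the stationary law of a chain in which [A] drifts towards a point [X] that
    is redrawn from time to time ([chain_step]); the averages of its laws over a long
    time are nearly stationary ([dirichlet_mean]).  Stationarity, tested on suitable
    functions, is the same first order recursion as the one that [h' = (h'/h) h]
    gives for the terms [a_k z^k], and so identifies the averages
    ([c_proportional], [c_0_limit]).  The measure enters through its moments
    only, and these are circle means of [1 + 2/mu Re (z h'/h)]
    ([moment_recursion], [herglotz_mean]).

    Averages of [(1 - v)^mu] over [|v| <= r] are again of this form because the
    image of the disk is convex ([power_disk_convex]); the same convexity turns
    the result for partial sums into the one for [sigma_n], whose weights are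
    monotone ([weighted_sum_convex], [B_mono]).  Letting [r] decrease to [|z|]
    gives [|omega(z)| <= |z|]. *)

Open Scope R_scope.

(** * Moduli and real quotients *)

Lemma im_le_Cmod (z : C) : Rabs (Im z) <= Cmod z.
Proof.
  apply Rle_trans with (2 := Rmax_Cmod z). apply Rmax_r.
Qed.

Lemma Cmod_sub_sym (z w : C) : Cmod (z - w) = Cmod (w - z).
Proof. rewrite <- Cmod_opp. f_equal. ring. Qed.

Lemma Cmod_sub_le (z w : C) : Cmod (z - w) <= Cmod z + Cmod w.
Proof.
  unfold Cminus. eapply Rle_trans; [ apply Cmod_triangle |].
  rewrite Cmod_opp. lra.
Qed.

Lemma Cmod_triangle_sub (z w : C) : Cmod z - Cmod w <= Cmod (z - w).
Proof.
  assert (H := Cmod_triangle (z - w) w).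
  replace (z - w + w)%C with z in H by ring. lra.
Qed.

Lemma Cmod_triangle_plus (z w : C) : Cmod z - Cmod w <= Cmod (z + w).
Proof.
  assert (H := Cmod_triangle_sub z (- w)).
  rewrite Cmod_opp in H. replace (z - - w)%C with (z + w)%C in H by ring. lra.
Qed.

Lemma C_ext (z w : C) : Re z = Re w -> Im z = Im w -> z = w.
Proof. destruct z, w; simpl; intros; subst; reflexivity. Qed.

Lemma Cmod_le_abs (z : C) : Cmod z <= Rabs (Re z) + Rabs (Im z).
Proof.
  apply Rsqr_incr_0_var.
  - unfold Rsqr. replace (Cmod z * Cmod z) with (Cmod z ^ 2) by ring.
    rewrite Cmod2_alt, <- (pow2_abs (Re z)), <- (pow2_abs (Im z)).
    assert (H1 := Rabs_pos (Re z)). assert (H2 := Rabs_pos (Im z)). nra.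
  - assert (H1 := Rabs_pos (Re z)). assert (H2 := Rabs_pos (Im z)). lra.
Qed.

Lemma RtoC_neq_0 (x : R) : x <> 0 -> RtoC x <> 0.
Proof. intros H E. apply RtoC_inj in E. auto. Qed.

Lemma pow_le_1 (x : R) (k : nat) : 0 <= x <= 1 -> x ^ k <= 1.
Proof. intros H. rewrite <- (pow1 k). apply pow_incr, H. Qed.

Lemma Rdiv_between_0_1 (x y : R) : 0 <= x <= y -> 0 < y -> 0 <= x / y <= 1.
Proof.
  intros Hx Hy. split.
  - apply Rmult_le_pos; [ lra | left; apply Rinv_0_lt_compat, Hy ].
  - apply Rmult_le_reg_r with y; auto. unfold Rdiv. rewrite Rmult_assoc, Rinv_l; lra.
Qed.

Lemma Cmod_R_pos (x : R) : 0 <= x -> Cmod (RtoC x) = x.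
Proof. intros; rewrite Cmod_R, Rabs_pos_eq; auto. Qed.

(** * Complex differentiability *)

Definition cderiv (f : C -> C) (z l : C) : Prop :=
  forall eps : R, 0 < eps -> exists del : R, 0 < del /\
    forall w : C, Cmod (w - z) < del ->
      Cmod (f w - f z - l * (w - z)) <= eps * Cmod (w - z).

Definition ccont (f : C -> C) (z : C) : Prop :=
  forall eps : R, 0 < eps -> exists del : R, 0 < del /\
    forall w : C, Cmod (w - z) < del -> Cmod (f w - f z) < eps.

Lemma cderiv_lip (f : C -> C) (z l : C) : cderiv f z l ->
  exists del, 0 < del /\ forall w, Cmod (w - z) < del ->
    Cmod (f w - f z) <= (Cmod l + 1) * Cmod (w - z).
Proof.
  intros H. destruct (H 1 Rlt_0_1) as [d [Hd Hw]]. exists d; split; auto.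
  intros w Hwz. specialize (Hw w Hwz).
  assert (H1 := Cmod_triangle_sub (f w - f z) (l * (w - z))).
  rewrite Cmod_mult in H1. lra.
Qed.

Lemma cderiv_cont (f : C -> C) (z l : C) : cderiv f z l -> ccont f z.
Proof.
  intros H eps He. destruct (cderiv_lip _ _ _ H) as [d [Hd Hw]].
  assert (Hl := Cmod_ge_0 l).
  exists (Rmin d (eps / (Cmod l + 2))). split.
  - apply Rmin_glb_lt; auto. apply Rdiv_lt_0_compat; lra.
  - intros w Hwz. eapply Rle_lt_trans; [ apply Hw |].
    + eapply Rlt_le_trans; [ apply Hwz | apply Rmin_l ].
    + apply Rle_lt_trans with ((Cmod l + 2) * Cmod (w - z)).
      * assert (H0 := Cmod_ge_0 (w - z)). nra.
      * apply Rlt_le_trans with ((Cmod l + 2) * (eps / (Cmod l + 2))).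
        -- apply Rmult_lt_compat_l; [lra |].
           eapply Rlt_le_trans; [ apply Hwz | apply Rmin_r ].
        -- right. field. lra.
Qed.

Lemma cderiv_ext_loc (f g : C -> C) (z l : C) (d : R) : 0 < d ->
  (forall w, Cmod (w - z) < d -> f w = g w) -> cderiv f z l -> cderiv g z l.
Proof.
  intros Hd Hfg H eps He. destruct (H eps He) as [d1 [Hd1 H1]].
  exists (Rmin d d1). split; [ apply Rmin_glb_lt; auto |].
  intros w Hw.
  assert (Hw1 : Cmod (w - z) < d) by (eapply Rlt_le_trans; [ apply Hw | apply Rmin_l ]).
  rewrite <- (Hfg w Hw1), <- (Hfg z).
  - apply H1. eapply Rlt_le_trans; [ apply Hw | apply Rmin_r ].
  - replace (z - z)%C with (RtoC 0) by ring. rewrite Cmod_0. auto.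
Qed.

Lemma cderiv_ext (f g : C -> C) (z l : C) :
  (forall w, f w = g w) -> cderiv f z l -> cderiv g z l.
Proof. intros H; apply cderiv_ext_loc with 1; [ lra | auto ]. Qed.

Lemma cderiv_eq (f : C -> C) (z l l' : C) : l = l' -> cderiv f z l -> cderiv f z l'.
Proof. intros; subst; auto. Qed.

Lemma cderiv_const (c z : C) : cderiv (fun _ => c) z 0.
Proof.
  intros eps He. exists 1. split; [ lra |]. intros w _.
  replace (c - c - 0 * (w - z))%C with (RtoC 0) by ring. rewrite Cmod_0.
  assert (H := Cmod_ge_0 (w - z)). nra.
Qed.

Lemma cderiv_id (z : C) : cderiv (fun w => w) z 1.
Proof.
  intros eps He. exists 1. split; [ lra |]. intros w _.
  replace (w - z - 1 * (w - z))%C with (RtoC 0) by ring. rewrite Cmod_0.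
  assert (H := Cmod_ge_0 (w - z)). nra.
Qed.

Lemma cderiv_plus (f g : C -> C) (z l m : C) :
  cderiv f z l -> cderiv g z m -> cderiv (fun w => f w + g w)%C z (l + m).
Proof.
  intros Hf Hg eps He.
  destruct (Hf (eps / 2)) as [d1 [Hd1 H1]]; [ lra |].
  destruct (Hg (eps / 2)) as [d2 [Hd2 H2]]; [ lra |].
  exists (Rmin d1 d2). split; [ apply Rmin_glb_lt; auto |]. intros w Hw.
  specialize (H1 w (Rlt_le_trans _ _ _ Hw (Rmin_l _ _))).
  specialize (H2 w (Rlt_le_trans _ _ _ Hw (Rmin_r _ _))).
  replace (f w + g w - (f z + g z) - (l + m) * (w - z))%C
    with ((f w - f z - l * (w - z)) + (g w - g z - m * (w - z)))%C by ring.
  eapply Rle_trans; [ apply Cmod_triangle |]. lra.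
Qed.

Lemma cderiv_comp (f g : C -> C) (z l m : C) :
  cderiv g z m -> cderiv f (g z) l -> cderiv (fun w => f (g w)) z (l * m).
Proof.
  intros Hg Hf eps He.
  destruct (cderiv_lip _ _ _ Hg) as [d0 [Hd0 H0]].
  assert (Hm := Cmod_ge_0 m). assert (Hl := Cmod_ge_0 l).
  destruct (Hf (eps / (2 * (Cmod m + 1)))) as [d1 [Hd1 H1]].
  { apply Rdiv_lt_0_compat; lra. }
  destruct (Hg (eps / (2 * (Cmod l + 1)))) as [d2 [Hd2 H2]].
  { apply Rdiv_lt_0_compat; lra. }
  exists (Rmin (Rmin d0 d2) (d1 / (Cmod m + 1))). split.
  { repeat apply Rmin_glb_lt; auto. apply Rdiv_lt_0_compat; lra. }
  intros w Hw.
  assert (Hw0 : Cmod (w - z) < d0).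
  { eapply Rlt_le_trans; [ apply Hw | eapply Rle_trans; apply Rmin_l ]. }
  assert (Hw2 : Cmod (w - z) < d2).
  { eapply Rlt_le_trans; [ apply Hw | eapply Rle_trans; [ apply Rmin_l | apply Rmin_r ] ]. }
  assert (Hw1 : Cmod (w - z) < d1 / (Cmod m + 1)).
  { eapply Rlt_le_trans; [ apply Hw | apply Rmin_r ]. }
  specialize (H0 w Hw0). specialize (H2 w Hw2).
  assert (Hp := Cmod_ge_0 (w - z)).
  assert (Hg1 : Cmod (g w - g z) < d1).
  { eapply Rle_lt_trans; [ apply H0 |].
    apply Rlt_le_trans with ((Cmod m + 1) * (d1 / (Cmod m + 1))).
    - apply Rmult_lt_compat_l; lra.
    - right; field; lra. }
  specialize (H1 _ Hg1).
  replace (f (g w) - f (g z) - l * m * (w - z))%C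
    with ((f (g w) - f (g z) - l * (g w - g z)) + l * (g w - g z - m * (w - z)))%C by ring.
  eapply Rle_trans; [ apply Cmod_triangle |]. rewrite Cmod_mult.
  apply Rle_trans with (eps / (2 * (Cmod m + 1)) * ((Cmod m + 1) * Cmod (w - z))
     + (Cmod l + 1) * (eps / (2 * (Cmod l + 1)) * Cmod (w - z))).
  - apply Rplus_le_compat.
    + eapply Rle_trans; [ apply H1 |]. apply Rmult_le_compat_l; [| auto].
      apply Rlt_le, Rdiv_lt_0_compat; lra.
    + apply Rmult_le_compat; try apply Cmod_ge_0; try lra.
  - right. field. lra.
Qed.

(** The inverse, the exponential, the logarithm and power series are all differentiated
    through quadratic remainders. *)
Lemma cderiv_quad (f : C -> C) (z l : C) (d K : R) : 0 < d ->
  (forall w, Cmod (w - z) < d -> Cmod (f w - f z - l * (w - z)) <= K * Cmod (w - z) ^ 2) ->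
  cderiv f z l.
Proof.
  intros Hd H eps He.
  exists (Rmin d (eps / (Rabs K + 1))).
  assert (HK := Rabs_pos K). split.
  { apply Rmin_glb_lt; auto. apply Rdiv_lt_0_compat; lra. }
  intros w Hw.
  specialize (H w (Rlt_le_trans _ _ _ Hw (Rmin_l _ _))).
  assert (H1 := Rlt_le_trans _ _ _ Hw (Rmin_r _ _)).
  assert (Hp := Cmod_ge_0 (w - z)).
  eapply Rle_trans; [ apply H |].
  assert (H2 : (Rabs K + 1) * Cmod (w - z) <= eps).
  { apply Rle_trans with ((Rabs K + 1) * (eps / (Rabs K + 1))).
    - apply Rmult_le_compat_l; lra.
    - right; field; lra. }
  assert (H3 := Rle_abs K). nra.
Qed.

(** By polarisation the product rule follows from the chain rule for the square. *)
Lemma cderiv_mult (f g : C -> C) (z l m : C) :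
  cderiv f z l -> cderiv g z m ->
  cderiv (fun w => f w * g w)%C z (l * g z + f z * m)%C.
Proof.
  intros Hf Hg.
  assert (Hsq : forall (k : C -> C) (n : C), cderiv k z n ->
            cderiv (fun w => k w * k w)%C z (2 * k z * n)).
  { intros k n Hk. apply (cderiv_comp (fun u => u * u)%C k); auto.
    apply cderiv_quad with 1 1; [ lra |]. intros w _.
    replace (w * w - k z * k z - 2 * k z * (w - k z))%C
      with ((w - k z) * (w - k z))%C by ring.
    rewrite Cmod_mult. right; ring. }
  assert (Hsc : forall (c : C) (k : C -> C) (n : C), cderiv k z n ->
            cderiv (fun w => c * k w)%C z (c * n)).
  { intros c k n Hk. apply (cderiv_comp (fun u => c * u)%C k); auto.
    apply cderiv_quad with 1 0; [ lra |]. intros w _.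
    replace (c * w - c * k z - c * (w - k z))%C with (RtoC 0) by ring.
    rewrite Cmod_0. lra. }
  assert (H := cderiv_plus _ _ _ _ _ (Hsc (/ 4)%C _ _ (Hsq _ _ (cderiv_plus _ _ _ _ _ Hf Hg)))
     (Hsc (- / 4)%C _ _ (Hsq _ _ (cderiv_plus _ _ _ _ _ Hf (Hsc (- (1))%C _ _ Hg))))).
  eapply cderiv_eq; [| eapply cderiv_ext; [| exact H ] ].
  - cbv beta. field.
  - intros w. cbv beta. field.
Qed.

Lemma cderiv_scal (c : C) (f : C -> C) (z l : C) :
  cderiv f z l -> cderiv (fun w => c * f w)%C z (c * l).
Proof.
  intros H. eapply cderiv_eq; [| apply (cderiv_mult (fun _ => c) f _ _ _ (cderiv_const c z) H) ].
  cbv beta; ring.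
Qed.

Lemma cderiv_opp (f : C -> C) (z l : C) :
  cderiv f z l -> cderiv (fun w => - f w)%C z (- l).
Proof.
  intros H. eapply cderiv_eq; [| eapply cderiv_ext;
   [| apply (cderiv_scal (- (1))%C _ _ _ H)]].
  - ring.
  - intros w. cbv beta. ring.
Qed.

Lemma cderiv_minus (f g : C -> C) (z l m : C) :
  cderiv f z l -> cderiv g z m -> cderiv (fun w => f w - g w)%C z (l - m).
Proof.
  intros Hf Hg. apply (cderiv_plus f (fun w => - g w)%C); auto. apply cderiv_opp; auto.
Qed.

Lemma cderiv_inv (z : C) : z <> RtoC 0 -> cderiv (fun w => / w)%C z (- (/ (z * z))).
Proof.
  intros Hz. assert (Hm : 0 < Cmod z) by (apply Cmod_gt_0; auto).
  apply cderiv_quad with (Cmod z / 2) (2 / (Cmod z * Cmod z * Cmod z)); [ lra |].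
  intros w Hw.
  assert (Hw2 : Cmod z / 2 <= Cmod w).
  { assert (H := Cmod_triangle_sub z (z - w)).
    replace (z - (z - w))%C with w in H by ring.
    rewrite Cmod_sub_sym in Hw. lra. }
  assert (Hw0 : w <> RtoC 0). { intros E. rewrite E, Cmod_0 in Hw2. lra. }
  replace (/ w - / z - - (/ (z * z)) * (w - z))%C
    with ((w - z) * (w - z) / (z * z * w))%C by (field; auto).
  rewrite Cmod_div, !Cmod_mult by (repeat apply Cmult_neq_0; auto).
  assert (Hp := Cmod_ge_0 (w - z)).
  unfold Rdiv. apply Rle_trans with ((Cmod (w - z) * Cmod (w - z)) * (2 * / (Cmod z * Cmod z * Cmod z))).
  - apply Rmult_le_compat_l; [ nra |].
    apply Rle_trans with (/ (Cmod z * Cmod z * (Cmod z / 2))).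
    + apply Rinv_le_contravar.
      * assert (0 < Cmod z * Cmod z) by nra. apply Rmult_lt_0_compat; lra.
      * apply Rmult_le_compat_l; nra.
    + right. field. lra.
  - right. ring.
Qed.

Lemma cderiv_div (f g : C -> C) (z l m : C) : g z <> RtoC 0 ->
  cderiv f z l -> cderiv g z m ->
  cderiv (fun w => f w / g w)%C z ((l * g z - f z * m) / (g z * g z))%C.
Proof.
  intros H0 Hf Hg.
  eapply cderiv_eq; [| apply (cderiv_mult f (fun w => / g w)%C _ _ _ Hf
    (cderiv_comp (fun u => / u)%C g _ _ _ Hg (cderiv_inv _ H0))) ].
  field. auto.
Qed.

Lemma cderiv_pow (n : nat) (z : C) :
  cderiv (fun w => w ^ n)%C z (INR n * z ^ (pred n))%C.
Proof.
  induction n as [|n IH].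
  - simpl. eapply cderiv_eq; [| apply cderiv_const ]. ring.
  - eapply cderiv_eq; [| apply (cderiv_mult (fun w => w) (fun w => w ^ n)%C _ _ _ (cderiv_id z) IH) ].
    cbv beta. rewrite S_INR, RtoC_plus. destruct n; simpl; ring.
Qed.

Lemma cderiv_is_derive (f : C -> C) (z l : C) : cderiv f z l ->
  is_derive (K := C_AbsRing) (V := C_NormedModule) f z l.
Proof.
  intros H. split.
  - apply is_linear_scal_l.
  - intros x Hx.
    assert (E : z = x).
    { apply (is_filter_lim_locally_unique (V := AbsRing_NormedModule C_AbsRing)). exact Hx. }
    subst x. intros eps. destruct (H eps (cond_pos eps)) as [d [Hd Hw]].
    exists (mkposreal d Hd). intros w Hb. specialize (Hw w Hb).
    change (Cmod (f w - f z - (w - z) * l)%C <= eps * Cmod (w - z)).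
    replace ((w - z) * l)%C with (l * (w - z))%C by ring. exact Hw.
Qed.

Lemma cderiv_C_derive (f : C -> C) (z l : C) : cderiv f z l -> C_derive f z = l.
Proof. intros H. apply is_C_derive_unique, cderiv_is_derive, H. Qed.

(** Evaluates the analytic extension across a removable singularity. *)
Lemma C_lim_cont (f g : C -> C) (z : C) (d : R) : 0 < d ->
  (forall w, w <> z -> Cmod (w - z) < d -> f w = g w) ->
  ccont g z -> C_lim f z = g z.
Proof.
  intros Hd Hfg Hg. apply is_C_lim_unique. intros P [eps HP].
  destruct (Hg eps (cond_pos eps)) as [d1 [Hd1 H1]].
  apply (proj2 (locally_C z (fun x => x <> z -> P (f x)))).
  assert (Hm : 0 < Rmin d d1) by (apply Rmin_glb_lt; auto).
  exists (mkposreal _ Hm). intros w Hw Hwz.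
  assert (Hw' : Cmod (w - z) < Rmin d d1) by exact Hw.
  apply HP. rewrite Hfg; auto.
  - apply C_NormedModule_mixin_compat1.
    apply (H1 w). eapply Rlt_le_trans; [ apply Hw' | apply Rmin_r ].
  - eapply Rlt_le_trans; [ apply Hw' | apply Rmin_l ].
Qed.

Lemma cderiv_line (f : C -> C) (A d l : C) (t : R) (u : C) :
  cderiv f (A + RtoC t * d)%C l ->
  is_derive (fun s : R => Re (u * f (A + RtoC s * d))%C) t (Re (u * (l * d))%C).
Proof.
  intros H. apply is_derive_Reals. intros eps He.
  assert (Hd := Cmod_ge_0 d). assert (Hu := Cmod_ge_0 u).
  destruct (H (eps / (2 * ((Cmod u + 1) * (Cmod d + 1))))) as [del [Hdel Hw]].
  { apply Rdiv_lt_0_compat; nra. }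
  assert (Hdd : 0 < del / (Cmod d + 1)) by (apply Rdiv_lt_0_compat; lra).
  exists (mkposreal _ Hdd). intros s Hs Hsd. simpl in Hsd.
  set (z := (A + RtoC t * d)%C) in *.
  set (w := (A + RtoC (t + s) * d)%C).
  assert (Ewz : (w - z)%C = (RtoC s * d)%C) by (unfold w, z; rewrite RtoC_plus; ring).
  assert (Hm : Cmod (w - z) = Rabs s * Cmod d) by (rewrite Ewz, Cmod_mult, Cmod_R; auto).
  assert (Hs0 : 0 < Rabs s) by (apply Rabs_pos_lt; auto).
  assert (Hwd : Cmod (w - z) < del).
  { rewrite Hm. apply Rlt_le_trans with (Rabs s * (Cmod d + 1)); [ nra |].
    apply Rle_trans with (del / (Cmod d + 1) * (Cmod d + 1)).
    - apply Rmult_le_compat_r; lra.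
    - right; field; lra. }
  specialize (Hw w Hwd).
  replace ((Re (u * f w) - Re (u * f z)) / s - Re (u * (l * d)))
    with (Re (u * (f w - f z - l * (w - z))) / s).
  2:{ rewrite Ewz. unfold Rdiv. destruct u, (f w), (f z), l, d. simpl. field. auto. }
  unfold Rdiv at 1. rewrite Rabs_mult.
  rewrite Rabs_inv. apply Rle_lt_trans with (Cmod u * (eps / (2 * ((Cmod u + 1) * (Cmod d + 1))) * (Rabs s * Cmod d)) * / Rabs s).
  - apply Rmult_le_compat_r; [ left; apply Rinv_0_lt_compat; auto |].
    eapply Rle_trans; [ apply re_le_Cmod |]. rewrite Cmod_mult.
    apply Rmult_le_compat_l; auto. rewrite <- Hm. exact Hw.
  - apply Rle_lt_trans with (eps / 2 * ((Cmod u / (Cmod u + 1)) * (Cmod d / (Cmod d + 1)))).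
    + right. field. repeat split; try lra.
    + assert (H1 := Rdiv_between_0_1 (Cmod u) (Cmod u + 1) ltac:(lra) ltac:(lra)).
      assert (H2 := Rdiv_between_0_1 (Cmod d) (Cmod d + 1) ltac:(lra) ltac:(lra)).
      assert (H3 : Cmod u / (Cmod u + 1) * (Cmod d / (Cmod d + 1)) <= 1 * 1)
        by (apply Rmult_le_compat; tauto).
      nra.
Qed.

Lemma is_derive_continuity_pt (f : R -> R) (x l : R) : is_derive f x l -> continuity_pt f x.
Proof.
  intros H. apply derivable_continuous_pt. exists l. apply is_derive_Reals, H.
Qed.

(** Rotate the increment so that it becomes positive; the real mean value theorem
    then applies to the majorant minus the real part of the rotated curve. *)
Lemma majorant_bound (f : C -> C) (A d : C) (f' : C -> C) (Phi Phi' : R -> R) :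
  (forall t, 0 <= t <= 1 -> cderiv f (A + RtoC t * d)%C (f' (A + RtoC t * d)%C)) ->
  (forall t, 0 <= t <= 1 -> is_derive Phi t (Phi' t)) ->
  (forall t, 0 <= t <= 1 -> Cmod (f' (A + RtoC t * d)%C * d) <= Phi' t) ->
  Cmod (f (A + d)%C - f A) <= Phi 1 - Phi 0.
Proof.
  intros Hf HPhi Hle.
  set (D := (f (A + d)%C - f A)%C).
  assert (Hu : exists u : C, Cmod u <= 1 /\ Re (u * D)%C = Cmod D).
  { destruct (Ceq_dec D 0) as [E|E].
    - exists (RtoC 0). rewrite E, !Cmod_0. split; [ lra |]. simpl. ring.
    - assert (HD : 0 < Cmod D) by (apply Cmod_gt_0; auto).
      exists (Cconj D / Cmod D)%C.
      assert (HD' : RtoC (Cmod D) <> 0). { intros E'. apply RtoC_inj in E'. lra. }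
      split.
      + rewrite Cmod_div, Cmod_conj, Cmod_R, Rabs_pos_eq; auto; [| lra].
        right; field; lra.
      + replace (Cconj D / Cmod D * D)%C with (RtoC (Cmod D)).
        * reflexivity.
        * transitivity ((D * Cconj D) / Cmod D)%C; [| field; auto ].
          rewrite <- Cmod2_conj. rewrite <- RtoC_div by lra. f_equal. field. lra. }
  destruct Hu as [u [Hu1 Hu2]].
  assert (Hder : forall t, 0 <= t <= 1 ->
     is_derive (fun s : R => Phi s - Re (u * f (A + RtoC s * d))%C) t
       (Phi' t - Re (u * (f' (A + RtoC t * d) * d))%C)).
  { intros t Ht. apply (is_derive_minus (V := R_NormedModule)); auto. apply cderiv_line. auto. }
  destruct (MVT_gen (fun s : R => Phi s - Re (u * f (A + RtoC s * d))%C) 0 1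
     (fun t => Phi' t - Re (u * (f' (A + RtoC t * d) * d))%C)) as [t [Ht1 Ht2]].
  - rewrite Rmin_left, Rmax_right by lra. intros x Hx. apply Hder. lra.
  - rewrite Rmin_left, Rmax_right by lra. intros x Hx.
    eapply is_derive_continuity_pt; apply Hder; lra.
  - rewrite Rmin_left, Rmax_right in Ht1 by lra.
    assert (H1 := Hle t Ht1).
    assert (H2 : Re (u * (f' (A + RtoC t * d) * d))%C <= Cmod (f' (A + RtoC t * d)%C * d)).
    { eapply Rle_trans; [ apply Rle_abs |]. eapply Rle_trans; [ apply re_le_Cmod |].
      rewrite Cmod_mult. assert (H3 := Cmod_ge_0 (f' (A + RtoC t * d)%C * d)). nra. }
    cbv beta in Ht2.
    replace (A + RtoC 1 * d)%C with (A + d)%C in Ht2 by ring.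
    replace (A + RtoC 0 * d)%C with A in Ht2 by ring.
    assert (H4 : Re (u * D)%C = Re (u * f (A + d))%C - Re (u * f A)%C).
    { unfold D. destruct u, (f (A + d)%C), (f A). simpl. ring. }
    nra.
Qed.

(** * Exponential, logarithm and real powers *)

Lemma Cexp_plus (z w : C) : Cexp (z + w) = (Cexp z * Cexp w)%C.
Proof.
  destruct z as [x y], w as [u v]. unfold Cexp. simpl. rewrite exp_plus, cos_plus, sin_plus.
  unfold Cmult; simpl. f_equal; ring.
Qed.

Lemma Cexp_0 : Cexp 0 = RtoC 1.
Proof. unfold Cexp. simpl. rewrite exp_0, cos_0, sin_0. apply C_ext; simpl; ring. Qed.

Lemma Cmod_Cexp (z : C) : Cmod (Cexp z) = exp (Re z).
Proof.
  assert (H : Cmod (Cexp z) ^ 2 = exp (Re z) ^ 2).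
  { rewrite Cmod2_alt. unfold Cexp; simpl.
    assert (E := sin2_cos2 (Im z)). unfold Rsqr in E. nra. }
  assert (H1 := exp_pos (Re z)). assert (H2 := Cmod_ge_0 (Cexp z)). nra.
Qed.

Lemma Cexp_neq_0 (z : C) : Cexp z <> 0.
Proof. apply Cmod_gt_0. rewrite Cmod_Cexp. apply exp_pos. Qed.

Lemma Cexp_opp (z : C) : Cexp (- z) = (/ Cexp z)%C.
Proof.
  assert (H : (Cexp z * Cexp (- z) = 1)%C).
  { rewrite <- Cexp_plus. replace (z + - z)%C with (RtoC 0) by ring. apply Cexp_0. }
  assert (H0 := Cexp_neq_0 z).
  replace (Cexp (- z)) with (/ Cexp z * (Cexp z * Cexp (- z)))%C by (field; auto).
  rewrite H. ring.
Qed.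

Lemma Cexp_minus (z w : C) : Cexp (z - w) = (Cexp z / Cexp w)%C.
Proof. unfold Cminus, Cdiv. rewrite Cexp_plus, Cexp_opp. reflexivity. Qed.

Lemma Re_Cexp (z : C) : Re (Cexp z) = exp (Re z) * cos (Im z).
Proof. reflexivity. Qed.

Lemma Im_Cexp (z : C) : Im (Cexp z) = exp (Re z) * sin (Im z).
Proof. reflexivity. Qed.

Lemma exp_quad (x : R) : Rabs x <= 1 / 2 -> 0 <= exp x - 1 - x <= 2 * x ^ 2.
Proof.
  intros H. apply Rabs_le_between in H.
  assert (H1 := exp_ineq1_le x). assert (H2 := exp_ineq1_le (- x)).
  assert (H3 : exp x * exp (- x) = 1) by (rewrite <- exp_plus, Rplus_opp_r; apply exp_0).
  assert (H4 := exp_pos x). split; [ lra |]. nra.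
Qed.

Lemma sin_abs_le (y : R) : Rabs (sin y) <= Rabs y.
Proof.
  destruct (Rle_dec 0 y) as [H|H].
  - rewrite (Rabs_pos_eq y) by auto. apply Rabs_le. split.
    + destruct (Req_dec y 0) as [->|E]; [ rewrite sin_0; lra |].
      destruct (Rle_dec y PI).
      * assert (H0 := sin_ge_0 y H ltac:(lra)). lra.
      * assert (H1 := SIN_bound y). assert (H2 := PI2_1). lra.
    + destruct (Req_dec y 0) as [->|E]; [ rewrite sin_0; lra |].
      assert (H0 := sin_lt_x y ltac:(lra)). lra.
  - rewrite <- Rabs_Ropp, <- sin_neg, <- (Rabs_Ropp y).
    assert (Hy : 0 < - y) by lra. rewrite (Rabs_pos_eq (- y)) by lra.
    apply Rabs_le. split.
    + destruct (Rle_dec (- y) PI).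
      * assert (H0 := sin_ge_0 (- y) ltac:(lra) ltac:(lra)). lra.
      * assert (H1 := SIN_bound (- y)). assert (H2 := PI2_1). lra.
    + assert (H0 := sin_lt_x (- y) Hy). lra.
Qed.

Lemma cos_quad (y : R) : 0 <= 1 - cos y <= y ^ 2 / 2.
Proof.
  split; [ assert (H := COS_bound y); lra |].
  replace y with (2 * (y / 2)) at 1 by field. rewrite cos_2a_sin.
  assert (H := sin_abs_le (y / 2)).
  assert (H1 : sin (y / 2) ^ 2 <= (y / 2) ^ 2).
  { rewrite <- (pow2_abs (sin _)), <- (pow2_abs (y / 2)).
    apply pow_incr. split; auto. apply Rabs_pos. }
  lra.
Qed.

Lemma sin_quad (y : R) : Rabs y <= 1 -> Rabs (sin y - y) <= y ^ 2.
Proof.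
  intros Hy.
  destruct (MVT_gen (fun t => sin t - t) 0 y (fun t => cos t - 1)) as [c [Hc1 Hc2]].
  - intros x _. auto_derive; auto. ring.
  - intros x _. apply continuity_pt_minus; [ apply continuity_sin | apply continuity_pt_id ].
  - cbv beta in Hc2. rewrite sin_0, !Rminus_0_r in Hc2. rewrite Hc2, Rabs_mult.
    assert (Hcy : Rabs c <= Rabs y).
    { unfold Rmin, Rmax in Hc1. destruct (Rle_dec 0 y).
      - rewrite !Rabs_pos_eq; lra.
      - rewrite <- (Rabs_Ropp c), <- (Rabs_Ropp y), !Rabs_pos_eq; lra. }
    assert (H := cos_quad c).
    rewrite <- Rabs_Ropp. rewrite Rabs_pos_eq by lra.
    rewrite <- (pow2_abs y). rewrite <- (pow2_abs c) in H.
    assert (H0 := Rabs_pos c). nra.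
Qed.

Lemma Cexp_quad (z : C) : Cmod z <= 1 / 2 -> Cmod (Cexp z - 1 - z) <= 10 * Cmod z ^ 2.
Proof.
  intros Hz.
  assert (Hx := Rle_trans _ _ _ (re_le_Cmod z) Hz).
  assert (Hy := Rle_trans _ _ _ (im_le_Cmod z) Hz).
  assert (E := Cmod2_alt z).
  assert (H1 := exp_quad _ Hx). assert (H2 := cos_quad (Im z)).
  assert (H3 := sin_quad (Im z) ltac:(lra)). assert (H4 := sin_abs_le (Im z)).
  set (x := Re z) in *. set (y := Im z) in *.
  assert (Hb := Rabs_le_between x (1/2)). apply Hb in Hx. clear Hb.
  assert (He : exp x <= 2) by nra. assert (He0 := exp_pos x).
  eapply Rle_trans; [ apply Cmod_le_abs |].
  assert (HA : Rabs (Re (Cexp z - 1 - z)) <= 2 * x ^ 2 + y ^ 2).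
  { replace (Re (Cexp z - 1 - z)) with ((exp x - 1 - x) - exp x * (1 - cos y))
      by (unfold x, y; destruct z; simpl; ring).
    apply Rabs_le. split; nra. }
  assert (HB : Rabs (Im (Cexp z - 1 - z)) <= 2 * (x ^ 2 + y ^ 2) + y ^ 2).
  { replace (Im (Cexp z - 1 - z)) with ((exp x - 1) * sin y + (sin y - y))
      by (unfold x, y; destruct z; simpl; ring).
    eapply Rle_trans; [ apply Rabs_triang |]. apply Rplus_le_compat; auto.
    rewrite Rabs_mult.
    apply Rle_trans with (2 * Rabs x * Rabs y).
    - apply Rmult_le_compat; try apply Rabs_pos; auto.
      apply Rle_trans with (Rabs x + Rabs (exp x - 1 - x)).
      + generalize (Rabs_triang x (exp x - 1 - x)).
        replace (x + (exp x - 1 - x)) with (exp x - 1) by ring. auto.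
      + rewrite (Rabs_pos_eq (exp x - 1 - x)) by lra.
        assert (x ^ 2 = Rabs x ^ 2) by (rewrite pow2_abs; auto).
        assert (Hx' : Rabs x <= 1 / 2) by (apply Rabs_le; lra).
        assert (H6 := Rabs_pos x). nra.
    - rewrite <- (pow2_abs x), <- (pow2_abs y). assert (H5 := pow2_ge_0 (Rabs x - Rabs y)). nra. }
  nra.
Qed.

Lemma cderiv_Cexp (z : C) : cderiv Cexp z (Cexp z).
Proof.
  apply cderiv_quad with (1 / 2) (Cmod (Cexp z) * 10); [ lra |]. intros w Hw.
  replace (Cexp w - Cexp z - Cexp z * (w - z))%C with (Cexp z * (Cexp (w - z) - 1 - (w - z)))%C.
  - rewrite Cmod_mult, Rmult_assoc. apply Rmult_le_compat_l; [ apply Cmod_ge_0 |].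
    apply Cexp_quad. lra.
  - rewrite Cexp_minus. field. apply Cexp_neq_0.
Qed.

Lemma Re_div_Cmod_bound (z : C) : z <> 0 -> -1 <= Re z / Cmod z <= 1.
Proof.
  intros H. assert (Hm : 0 < Cmod z) by (apply Cmod_gt_0; auto).
  assert (H1 := re_le_Cmod z). apply Rabs_le_between in H1.
  assert (E : Re z / Cmod z * Cmod z = Re z) by (field; lra). nra.
Qed.

Lemma cos_Carg (z : C) : z <> 0 -> Cmod z * cos (Carg z) = Re z.
Proof.
  intros H. assert (Hm : 0 < Cmod z) by (apply Cmod_gt_0; auto).
  assert (Hb := Re_div_Cmod_bound z H). unfold Carg.
  destruct (Rle_dec 0 (Im z)); [| rewrite cos_neg]; rewrite cos_acos by auto; field; lra.
Qed.

Lemma sin_Carg (z : C) : z <> 0 -> Cmod z * sin (Carg z) = Im z.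
Proof.
  intros H. assert (Hm : 0 < Cmod z) by (apply Cmod_gt_0; auto).
  assert (Hb := Re_div_Cmod_bound z H).
  assert (E : Cmod z * sqrt (1 - (Re z / Cmod z)²) = Rabs (Im z)).
  { rewrite <- (sqrt_Rsqr (Cmod z)) at 1 by lra. rewrite <- sqrt_mult_alt by apply Rle_0_sqr.
    rewrite <- sqrt_Rsqr_abs. f_equal. assert (E := Cmod2_alt z).
    unfold Rsqr. field_simplify; [| lra]. simpl in *. lra. }
  unfold Carg. destruct (Rle_dec 0 (Im z)) as [Hi|Hi].
  - rewrite sin_acos by auto. rewrite E, Rabs_pos_eq; auto.
  - rewrite sin_neg, sin_acos by auto.
    rewrite Ropp_mult_distr_r_reverse, E, <- Rabs_Ropp, Rabs_pos_eq by lra. ring.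
Qed.

Lemma Cexp_Clog (z : C) : z <> 0 -> Cexp (Clog z) = z.
Proof.
  intros H. assert (Hm : 0 < Cmod z) by (apply Cmod_gt_0; auto).
  apply C_ext.
  - rewrite Re_Cexp. simpl. rewrite exp_ln by auto. apply cos_Carg; auto.
  - rewrite Im_Cexp. simpl. rewrite exp_ln by auto. apply sin_Carg; auto.
Qed.

Lemma Re_pos_neq_0 (z : C) : 0 < Re z -> z <> 0.
Proof. intros H E. rewrite E in H. simpl in H. lra. Qed.

Lemma Carg_bound (z : C) : -PI <= Carg z <= PI.
Proof.
  unfold Carg. assert (H := acos_bound (Re z / Cmod z)).
  destruct (Rle_dec 0 (Im z)); lra.
Qed.

Lemma cos_nonneg_bound (a : R) : - (3 * (PI / 2)) < a < 3 * (PI / 2) -> 0 <= cos a ->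
  - (PI / 2) <= a <= PI / 2.
Proof.
  intros Ha Hc. split.
  - destruct (Rle_dec (- (PI / 2)) a); auto. exfalso.
    assert (H := cos_lt_0 (- a) ltac:(lra) ltac:(lra)). rewrite cos_neg in H. lra.
  - destruct (Rle_dec a (PI / 2)); auto. exfalso.
    assert (H := cos_lt_0 a ltac:(lra) ltac:(lra)). lra.
Qed.

Lemma cos_pos_bound (a : R) : - (3 * (PI / 2)) < a < 3 * (PI / 2) -> 0 < cos a ->
  - (PI / 2) < a < PI / 2.
Proof.
  intros Ha Hc. destruct (cos_nonneg_bound a Ha ltac:(lra)) as [H1 H2]. split.
  - destruct H1 as [H1|H1]; auto. rewrite <- H1, cos_neg, cos_PI2 in Hc. lra.
  - destruct H2 as [H2|H2]; auto. rewrite H2, cos_PI2 in Hc. lra.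
Qed.

Lemma Carg_nonneg (z : C) : z <> 0 -> 0 <= Re z -> - (PI / 2) <= Carg z <= PI / 2.
Proof.
  intros Hz H. assert (Hp := PI_RGT_0). assert (Hb := Carg_bound z).
  apply cos_nonneg_bound; [ lra |].
  assert (Hm : 0 < Cmod z) by (apply Cmod_gt_0; auto).
  assert (E := cos_Carg z Hz). nra.
Qed.

Lemma Carg_pos (z : C) : 0 < Re z -> - (PI / 2) < Carg z < PI / 2.
Proof.
  intros H. assert (Hz := Re_pos_neq_0 z H).
  assert (Hp := PI_RGT_0). assert (Hb := Carg_bound z).
  apply cos_pos_bound; [ lra |].
  assert (Hm : 0 < Cmod z) by (apply Cmod_gt_0; auto).
  assert (E := cos_Carg z Hz). nra.
Qed.

Lemma Clog_Cexp (z : C) : - PI < Im z <= PI -> Clog (Cexp z) = z.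
Proof.
  intros H. apply C_ext.
  - simpl. rewrite Cmod_Cexp, ln_exp. reflexivity.
  - simpl. unfold Carg. rewrite Cmod_Cexp. rewrite Re_Cexp, Im_Cexp.
    assert (He := exp_pos (Re z)).
    replace (exp (Re z) * cos (Im z) / exp (Re z)) with (cos (Im z)) by (field; lra).
    destruct (Rle_dec 0 (exp (Re z) * sin (Im z))) as [Hs|Hs].
    + apply acos_cos. split; [| lra]. destruct (Rle_dec 0 (Im z)); auto. exfalso.
      assert (Hn := sin_gt_0 (- Im z) ltac:(lra) ltac:(lra)). rewrite sin_neg in Hn. nra.
    + rewrite <- (cos_neg (Im z)), acos_cos; [ ring |]. split; [| lra].
      destruct (Rle_dec 0 (- Im z)); auto. exfalso.
      assert (Hn := sin_ge_0 (Im z) ltac:(lra) ltac:(lra)). nra.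
Qed.

Lemma Clog_div (z w : C) : 0 < Re z -> 0 < Re w -> Clog (w / z) = (Clog w - Clog z)%C.
Proof.
  intros Hz Hw. assert (H1 := Carg_pos z Hz). assert (H2 := Carg_pos w Hw).
  rewrite <- (Clog_Cexp (Clog w - Clog z)).
  - rewrite Cexp_minus, !Cexp_Clog by (apply Re_pos_neq_0; auto). reflexivity.
  - simpl. assert (Hp := PI_RGT_0). lra.
Qed.

(** The modulus is controlled through [exp], the argument through its sine: on the
    relevant arc the cosine stays above [1/2]. *)
Lemma Clog_small (d : C) : Cmod d <= 1 / 4 -> Cmod (Clog (1 + d)) <= 5 * Cmod d.
Proof.
  intros Hd. assert (Hd0 := Cmod_ge_0 d).
  assert (Hr := re_le_Cmod d). apply Rabs_le_between in Hr.
  assert (Hi := im_le_Cmod d).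
  assert (HRe : 3 / 4 <= Re (1 + d)) by (change (3 / 4 <= 1 + Re d); lra).
  assert (Hz := Re_pos_neq_0 (1 + d) ltac:(lra)).
  assert (Hm1 : Cmod (1 + d) <= 1 + Cmod d).
  { eapply Rle_trans; [ apply Cmod_triangle |]. rewrite Cmod_1. lra. }
  assert (Hm2 : 1 - Cmod d <= Cmod (1 + d)).
  { assert (H := Cmod_triangle_plus 1 d). rewrite Cmod_1 in H. lra. }
  eapply Rle_trans; [ apply Cmod_le_abs |].
  assert (HA : Rabs (Re (Clog (1 + d))) <= 2 * Cmod d).
  { simpl. apply Rabs_le. split.
    - rewrite <- (ln_exp (- (2 * Cmod d))). apply ln_le; [ apply exp_pos |].
      rewrite exp_Ropp. eapply Rle_trans; [| apply Hm2 ].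
      assert (H := exp_ineq1_le (2 * Cmod d)).
      apply Rle_trans with (/ (1 + 2 * Cmod d)).
      + apply Rinv_le_contravar; lra.
      + apply Rmult_le_reg_l with (1 + 2 * Cmod d); [ lra |]. rewrite Rinv_r by lra. nra.
    - rewrite <- (ln_exp (2 * Cmod d)). apply ln_le; [ lra |].
      assert (H := exp_ineq1_le (2 * Cmod d)). lra. }
  assert (HB : Rabs (Im (Clog (1 + d))) <= 3 * Cmod d).
  { simpl. assert (Hs := sin_Carg _ Hz). assert (Hc := cos_Carg _ Hz).
    assert (Hb := Carg_pos (1 + d) ltac:(lra)).
    set (a := Carg (1 + d)) in *. assert (Him : Im (1 + d) = Im d) by (destruct d; simpl; ring).
    rewrite Him in Hs.
    assert (Hsin : Rabs (sin a) <= 4 / 3 * Cmod d).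
    { assert (E : Cmod (1 + d) * Rabs (sin a) = Rabs (Im d)).
      { rewrite <- Hs, Rabs_mult, (Rabs_pos_eq (Cmod _)); auto. apply Cmod_ge_0. }
      assert (H0 := Rabs_pos (sin a)). nra. }
    assert (Hcos : 1 / 2 <= cos a).
    { assert (Hcp : 0 < cos a) by (apply cos_gt_0; lra).
      assert (E := sin2_cos2 a). unfold Rsqr in E.
      assert (E2 : sin a * sin a = Rabs (sin a) * Rabs (sin a)).
      { unfold Rabs; destruct (Rcase_abs (sin a)); ring. }
      assert (H0 := Rabs_pos (sin a)). nra. }
    destruct (MVT_gen sin 0 a cos) as [c [Hc1 Hc2]].
    - intros x _. auto_derive; auto. ring.
    - intros x _. apply continuity_sin.
    - rewrite sin_0, !Rminus_0_r in Hc2.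
      assert (Hcc : 1 / 2 <= cos c).
      { eapply Rle_trans; [ apply Hcos |]. assert (Hp := PI_RGT_0).
        unfold Rmin, Rmax in Hc1. destruct (Rle_dec 0 a).
        - apply cos_decr_1; lra.
        - rewrite <- (cos_neg a), <- (cos_neg c). apply cos_decr_1; lra. }
      rewrite Hc2, Rabs_mult, (Rabs_pos_eq (cos c)) in Hsin by lra.
      assert (H0 := Rabs_pos a). nra. }
  lra.
Qed.

(** [Cexp] has a quadratic remainder and [Clog] is its Lipschitz inverse near [1];
    [Clog_div] moves the base point to [1]. *)
Lemma cderiv_Clog (z : C) : 0 < Re z -> cderiv Clog z (/ z).
Proof.
  intros Hz. assert (Hz0 := Re_pos_neq_0 z Hz).
  assert (Hm : 0 < Cmod z) by (apply Cmod_gt_0; auto).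
  apply cderiv_quad with (Rmin (Re z) (Cmod z / 16)) (250 / (Cmod z ^ 2)).
  { apply Rmin_glb_lt; lra. }
  intros w Hw.
  assert (Hw1 := Rlt_le_trans _ _ _ Hw (Rmin_l _ _)).
  assert (Hw2 := Rlt_le_trans _ _ _ Hw (Rmin_r _ _)).
  assert (HRw : 0 < Re w).
  { assert (H := re_le_Cmod (w - z)). apply Rabs_le_between in H.
    assert (E : Re (w - z) = Re w - Re z) by (destruct w, z; simpl; ring). lra. }
  set (d := ((w - z) / z)%C).
  assert (Ed : (w / z)%C = (1 + d)%C) by (unfold d; field; auto).
  assert (Emd : Cmod d = Cmod (w - z) / Cmod z) by (unfold d; apply Cmod_div; auto).
  assert (Hd : Cmod d < 1 / 16).
  { rewrite Emd. apply Rmult_lt_reg_r with (Cmod z); auto.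
    replace (Cmod (w - z) / Cmod z * Cmod z) with (Cmod (w - z)) by (field; lra). lra. }
  replace (Clog w - Clog z - / z * (w - z))%C with (Clog (w / z) - d)%C.
  2:{ rewrite Clog_div by auto. unfold d. field. auto. }
  rewrite Ed. assert (Hs := Clog_small d ltac:(lra)).
  set (eta := Clog (1 + d)) in *.
  assert (He : Cexp eta = (1 + d)%C).
  { apply Cexp_Clog. rewrite <- Ed. apply Cmult_neq_0; [ apply Re_pos_neq_0; auto |].
    intros E. apply (f_equal Cmod) in E. rewrite Cmod_inv, Cmod_0 in E by auto.
    assert (H := Rinv_0_lt_compat _ Hm). lra. }
  assert (Hq := Cexp_quad eta ltac:(lra)). rewrite He in Hq.
  replace (eta - d)%C with (- (1 + d - 1 - eta))%C by ring. rewrite Cmod_opp.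
  assert (H0 := Cmod_ge_0 eta).
  replace (250 / Cmod z ^ 2 * Cmod (w - z) ^ 2) with (250 * (Cmod (w - z) / Cmod z) ^ 2) by (field; lra).
  rewrite <- Emd. nra.
Qed.

Lemma Cpower_plus (z : C) (s t : R) : Cpower z (s + t) = (Cpower z s * Cpower z t)%C.
Proof.
  unfold Cpower. rewrite <- Cexp_plus, RtoC_plus. f_equal. ring.
Qed.

Lemma Cpower_opp (z : C) (s : R) : Cpower z (- s) = (/ Cpower z s)%C.
Proof.
  unfold Cpower. rewrite <- Cexp_opp, RtoC_opp. f_equal. ring.
Qed.

Lemma Cpower_1 (z : C) : z <> 0 -> Cpower z 1 = z.
Proof. intros H. unfold Cpower. rewrite Cmult_1_l. apply Cexp_Clog; auto. Qed.

Lemma Cmod_Cpower (z : C) (s : R) : Cmod (Cpower z s) = Rpower (Cmod z) s.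
Proof. unfold Cpower. rewrite Cmod_Cexp, re_scal_l. reflexivity. Qed.

Lemma Cpower_one_base (s : R) : Cpower 1 s = RtoC 1.
Proof.
  unfold Cpower. replace (Clog 1) with (RtoC 0); [ rewrite Cmult_0_r; apply Cexp_0 |].
  rewrite <- Cexp_0, Clog_Cexp; auto. simpl. assert (H := PI_RGT_0). lra.
Qed.

Lemma cderiv_Cpower (z : C) (s : R) : 0 < Re z ->
  cderiv (fun w => Cpower w s) z (s * Cpower z (s - 1)).
Proof.
  intros Hz. assert (Hz0 := Re_pos_neq_0 z Hz).
  eapply cderiv_eq; [| apply (cderiv_comp Cexp (fun w => RtoC s * Clog w)%C);
    [ apply cderiv_scal, cderiv_Clog; auto | apply cderiv_Cexp ] ].
  replace (s - 1) with (s + - (1)) by ring.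
  rewrite Cpower_plus, Cpower_opp, Cpower_1 by auto.
  unfold Cpower. field. auto.
Qed.

(** * Convexity of power images of disks *)

(** Where the cosine is positive, [exp (k t) * cos (al + be t)] is log-concave, so it
    has no interior minimum.  Comparing the logarithmic derivatives on both sides
    of [tb] leaves the sine of an angle of known sign. *)
Lemma no_valley (k al be ta tb tc : R) :
  let f := fun t => exp (k * t) * cos (al + be * t) in
  ta < tb < tc ->
  - (PI / 2) <= al + be * ta <= PI / 2 -> - (PI / 2) <= al + be * tc <= PI / 2 ->
  f tb <= f ta -> f tb <= f tc -> f tb < f ta \/ f tb < f tc -> False.
Proof.
  intros f Ht Ha Hc Hfa Hfc Hs.
  set (D := fun t => k * cos (al + be * t) - be * sin (al + be * t)).
  assert (Hder : forall t, derivable_pt_lim f t (exp (k * t) * D t)).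
  { intros t. apply is_derive_Reals. unfold f, D. auto_derive; auto. ring. }
  assert (Hin : forall t, ta <= t <= tc -> - (PI / 2) <= al + be * t <= PI / 2).
  { intros t Htt.
    assert (E : (tc - t) * (al + be * ta) + (t - ta) * (al + be * tc) = (tc - ta) * (al + be * t)) by ring.
    split; apply Rmult_le_reg_l with (tc - ta); try lra; nra. }
  assert (Hcos0 : forall t, ta <= t <= tc -> 0 <= cos (al + be * t)).
  { intros t Htt. apply cos_ge_0; apply Hin; auto. }
  assert (Hb0 : 0 <= f tb).
  { apply Rmult_le_pos; [ left; apply exp_pos | apply Hcos0; lra ]. }
  assert (Hcos : forall t, ta < t < tc -> 0 < cos (al + be * t)).
  { intros t Htt. assert (Hp := PI_RGT_0).
    assert (E : (tc - t) * (al + be * ta) + (t - ta) * (al + be * tc) = (tc - ta) * (al + be * t)) by ring.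
    assert (Hstr : forall t0, ta <= t0 <= tc -> f tb < f t0 -> - (PI / 2) < al + be * t0 < PI / 2).
    { intros t0 H0 Hlt. apply cos_pos_bound.
      - specialize (Hin t0 H0). lra.
      - assert (0 < f t0) by lra. unfold f in H. assert (H1 := exp_pos (k * t0)).
        specialize (Hcos0 t0 H0). nra. }
    apply cos_gt_0; apply Rmult_lt_reg_l with (tc - ta); try lra;
      destruct Hs as [Hs|Hs]; apply Hstr in Hs; try lra; nra. }
  destruct (MVT_cor2 f _ ta tb ltac:(lra) (fun c _ => Hder c)) as [t1 [E1 H1]].
  destruct (MVT_cor2 f _ tb tc ltac:(lra) (fun c _ => Hder c)) as [t2 [E2 H2]].
  assert (P1 := Hcos t1 ltac:(lra)). assert (P2 := Hcos t2 ltac:(lra)).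
  assert (X1 := exp_pos (k * t1)). assert (X2 := exp_pos (k * t2)).
  assert (D1 : D t1 <= 0) by (apply Rnot_lt_le; intros HD; assert (0 < exp (k * t1) * D t1 * (tb - ta)) by (repeat apply Rmult_lt_0_compat; lra); lra).
  assert (D2 : 0 <= D t2) by (apply Rnot_lt_le; intros HD; assert (0 < exp (k * t2) * - D t2 * (tc - tb)) by (repeat apply Rmult_lt_0_compat; lra); lra).
  assert (DD : D t1 < 0 \/ 0 < D t2).
  { destruct Hs as [Hs|Hs]; [left|right].
    - destruct D1 as [D1|D1]; auto. rewrite D1 in E1. lra.
    - destruct D2 as [D2|D2]; auto. rewrite <- D2 in E2. lra. }
  assert (Hlt : 0 < D t2 * cos (al + be * t1) - D t1 * cos (al + be * t2)) by (destruct DD; nra).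
  assert (E : D t2 * cos (al + be * t1) - D t1 * cos (al + be * t2)
     = - (be * sin (be * (t2 - t1)))).
  { replace (be * (t2 - t1)) with ((al + be * t2) - (al + be * t1)) by ring.
    rewrite sin_minus. unfold D. ring. }
  assert (H3 := Hin t1 ltac:(lra)). assert (H4 := Hin t2 ltac:(lra)).
  assert (H5 : - PI <= be * (t2 - t1) <= PI) by lra.
  assert (H6 : 0 <= be * sin (be * (t2 - t1))).
  { destruct (Rle_dec 0 be) as [Hbe|Hbe].
    - apply Rmult_le_pos; auto. apply sin_ge_0; nra.
    - assert (H7 : 0 <= sin (- (be * (t2 - t1)))) by (apply sin_ge_0; nra).
      rewrite sin_neg in H7. nra. }
  lra.
Qed.

Lemma Re_mult_Cexp (V z : C) (t : R) : V <> 0 ->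
  Re (V * Cexp (RtoC t * z)) = Cmod V * (exp (Re z * t) * cos (Carg V + Im z * t)).
Proof.
  intros HV. rewrite re_mult, Re_Cexp, Im_Cexp, re_scal_l, im_scal_l.
  rewrite <- (cos_Carg V HV) at 1. rewrite <- (sin_Carg V HV) at 1.
  rewrite cos_plus. rewrite !(Rmult_comm _ t). ring.
Qed.

(** [Re (V q^t)] is log-concave in [t]: being larger at [1] than at [0], it is larger
    at every intermediate exponent. *)
Lemma power_side (V z : C) (mu : R) : 0 < mu <= 1 -> V <> 0 -> 0 <= Re V ->
  - PI < Im z < PI -> Re V < Re (V * Cexp z) -> Re V < Re (V * Cexp (RtoC mu * z)).
Proof.
  intros Hmu HV HR Hz Hlt.
  destruct (Req_dec mu 1) as [->|Hne]; [ rewrite Cmult_1_l; auto |].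
  apply Rnot_le_lt. intros Hle.
  assert (Hm : 0 < Cmod V) by (apply Cmod_gt_0; auto).
  assert (Ha := Carg_nonneg V HV HR).
  assert (F0 : Re V = Cmod V * (exp (Re z * 0) * cos (Carg V + Im z * 0))).
  { rewrite <- Re_mult_Cexp by auto. rewrite Cmult_0_l, Cexp_0, Cmult_1_r. auto. }
  assert (F1 : Re (V * Cexp z) = Cmod V * (exp (Re z * 1) * cos (Carg V + Im z * 1))).
  { rewrite <- Re_mult_Cexp by auto. rewrite Cmult_1_l. auto. }
  rewrite Re_mult_Cexp in Hle by auto.
  assert (Hp := PI_RGT_0).
  assert (Hb : - (PI / 2) < Carg V + Im z * 1 < PI / 2).
  { apply cos_pos_bound; [ lra |]. rewrite F1 in Hlt.
    assert (H := exp_pos (Re z * 1)). assert (0 < Cmod V * exp (Re z * 1)) by nra. nra. }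
  apply (no_valley (Re z) (Carg V) (Im z) 0 mu 1); try lra.
  - apply Rmult_le_reg_l with (Cmod V); lra.
  - apply Rmult_le_reg_l with (Cmod V); lra.
  - right. apply Rmult_lt_reg_l with (Cmod V); lra.
Qed.

(** The same log-concavity, used on the other side of [0]. *)
Lemma power_side_inv (V z : C) (mu : R) : 0 < mu <= 1 -> V <> 0 -> 0 <= Re V ->
  - PI < Im z < PI -> Re V < Re (V * Cexp (- z)) -> Re (V * Cexp (RtoC mu * z)) < Re V.
Proof.
  intros Hmu HV HR Hz Hlt.
  apply Rnot_le_lt. intros Hle.
  assert (Hm : 0 < Cmod V) by (apply Cmod_gt_0; auto).
  assert (Ha := Carg_nonneg V HV HR).
  assert (F0 : Re V = Cmod V * (exp (Re z * 0) * cos (Carg V + Im z * 0))).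
  { rewrite <- Re_mult_Cexp by auto. rewrite Cmult_0_l, Cexp_0, Cmult_1_r. auto. }
  assert (F1 : Re (V * Cexp (- z)) = Cmod V * (exp (Re z * - (1)) * cos (Carg V + Im z * - (1)))).
  { rewrite <- Re_mult_Cexp by auto. do 3 f_equal. rewrite RtoC_opp. ring. }
  rewrite Re_mult_Cexp in Hle by auto.
  assert (Hp := PI_RGT_0).
  assert (Hb : - (PI / 2) < Carg V + Im z * - (1) < PI / 2).
  { apply cos_pos_bound; [ lra |]. rewrite F1 in Hlt.
    assert (H := exp_pos (Re z * - (1))). assert (0 < Cmod V * exp (Re z * - (1))) by nra. nra. }
  assert (Hb2 : - (PI / 2) <= Carg V + Im z * mu <= PI / 2).
  { apply cos_nonneg_bound; [ nra |].
    assert (H := exp_pos (Re z * mu)). assert (0 < Cmod V * exp (Re z * mu)) by nra. nra. }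
  apply (no_valley (Re z) (Carg V) (Im z) (- (1)) 0 mu); try lra.
  - apply Rmult_le_reg_l with (Cmod V); lra.
  - apply Rmult_le_reg_l with (Cmod V); lra.
  - left. apply Rmult_lt_reg_l with (Cmod V); lra.
Qed.

Definition power_disk (mu r : R) (w : C) : Prop :=
  exists u : C, Cmod (1 - u) <= r /\ w = Cpower u mu.

Lemma disk_Re_pos (u : C) (r : R) : r < 1 -> Cmod (1 - u) <= r -> 0 < Re u.
Proof.
  intros Hr H. assert (H1 := re_le_Cmod (1 - u)). apply Rabs_le_between in H1.
  assert (E : Re (1 - u) = 1 - Re u) by (destruct u; simpl; ring). lra.
Qed.

Lemma Re_Cexp_pos (z : C) : - (PI / 2) < Im z < PI / 2 -> 0 < Re (Cexp z).
Proof.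
  intros H. rewrite Re_Cexp. apply Rmult_lt_0_compat; [ apply exp_pos | apply cos_gt_0; lra ].
Qed.

Lemma Re_inv (u : C) : u <> 0 -> Re (/ u) * Cmod u ^ 2 = Re u.
Proof.
  intros H. assert (Hm : 0 < Cmod u) by (apply Cmod_gt_0; auto).
  assert (E := Cmod2_alt u). destruct u as [x y]. simpl in E |- *.
  replace (Cmod (x, y) * (Cmod (x, y) * 1)) with (x * x + y * y) by lra.
  replace (x * (x * 1) + y * (y * 1)) with (x * x + y * y) by ring. field.
  assert (0 < Cmod (x, y) * (Cmod (x, y) * 1)) by nra. nra.
Qed.

Lemma Cmod_1_minus (u : C) : Cmod (1 - u) ^ 2 = 1 - 2 * Re u + Cmod u ^ 2.
Proof. rewrite !Cmod2_alt. destruct u; simpl. ring. Qed.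

(** Up to sign and scale, [V] is the normal at [u0^mu], rotated back to [1], of the image
    of the circle about [1] through [u0].  When that circle reaches the origin it is
    replaced by the circle through [0] and [u0] on which [Re (1/u)] is constant. *)
Lemma power_separate (u0 : C) (mu r : R) : 0 < mu <= 1 -> 0 <= r < 1 ->
  r < Cmod (1 - u0) -> 0 < Re u0 ->
  exists V : C,
    (forall u, Cmod (1 - u) <= r -> Re V < Re (V * Cexp (RtoC mu * (Clog u - Clog u0)))) \/
    (forall u, Cmod (1 - u) <= r -> Re (V * Cexp (RtoC mu * (Clog u - Clog u0))) < Re V).
Proof.
  intros Hmu Hr Hu0 HR0.
  assert (Hz0 := Re_pos_neq_0 u0 HR0).
  assert (Hm0 : 0 < Cmod u0) by (apply Cmod_gt_0; auto).
  assert (Hpos : forall u, Cmod (1 - u) <= r -> 0 < Re u).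
  { intros v Hv. apply (disk_Re_pos v r); lra. }
  assert (Him : forall u, Cmod (1 - u) <= r -> - PI < Im (Clog u - Clog u0) < PI).
  { intros v Hv. assert (H1 := Carg_pos v (Hpos v Hv)).
    assert (H2 := Carg_pos u0 HR0). simpl. lra. }
  assert (Hq : forall u, Cmod (1 - u) <= r -> Cexp (Clog u - Clog u0) = (u / u0)%C).
  { intros v Hv. rewrite Cexp_minus, !Cexp_Clog; auto. apply Re_pos_neq_0, Hpos, Hv. }
  assert (Hne : (1 - u0)%C <> 0).
  { intros E. rewrite E, Cmod_0 in Hu0. lra. }
  assert (Hm1 : 0 < Cmod (1 - u0)) by (apply Cmod_gt_0; auto).
  destruct (Rle_dec 1 (Cmod (1 - u0))) as [Hbig|Hsm].
  - assert (Hv0 : (/ u0)%C <> 0).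
    { intros E. apply (f_equal Cmod) in E. rewrite Cmod_inv, Cmod_0 in E by auto.
      assert (H := Rinv_0_lt_compat _ Hm0). lra. }
    assert (HV := Re_inv u0 Hz0). assert (E0 := Cmod_1_minus u0).
    assert (Hu2 : 0 < Cmod u0 ^ 2) by nra.
    exists (/ u0)%C. right. intros u Hu. specialize (Hpos u Hu).
    assert (Hun := Re_pos_neq_0 u Hpos). assert (Hum : 0 < Cmod u) by (apply Cmod_gt_0; auto).
    apply power_side_inv; auto.
    + nra.
    + rewrite Cexp_opp, Hq by auto.
      replace (/ u0 * / (u / u0))%C with (/ u)%C by (field; auto).
      assert (HU := Re_inv u Hun). assert (E1 := Cmod_1_minus u).
      assert (Hu3 : 0 < Cmod u ^ 2) by nra. assert (Hc := Cmod_ge_0 (1 - u)).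
      apply Rle_lt_trans with (1 / 2); nra.
  (* [X] is the normal at [u0]: the disk of radius [|1 - u0|] is [|1 - X (u/u0 - 1)| <= 1]. *)
  - set (X := (u0 / (1 - u0))%C).
    assert (HX : X <> 0).
    { intros E. apply Hz0. replace u0 with (X * (1 - u0))%C by (unfold X; field; auto).
      rewrite E. ring. }
    assert (Hd : forall u, Cmod (1 - u) <= r ->
        Cmod (X * (u / u0 - 1)) ^ 2 < 2 * Re (X * (u / u0 - 1))).
    { intros u Hu. assert (E := Cmod_1_minus (X * (u / u0 - 1))).
      replace (1 - X * (u / u0 - 1))%C with ((1 - u) / (1 - u0))%C in E
        by (unfold X; field; auto).
      rewrite Cmod_div in E by auto.
      assert (Hlt : Cmod (1 - u) / Cmod (1 - u0) < 1).
      { apply Rmult_lt_reg_r with (Cmod (1 - u0)); auto. unfold Rdiv.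
        rewrite Rmult_assoc, Rinv_l by lra. lra. }
      assert (H0 : 0 <= Cmod (1 - u) / Cmod (1 - u0)).
      { apply Rmult_le_pos; [ apply Cmod_ge_0 | left; apply Rinv_0_lt_compat; auto ]. }
      nra. }
    destruct (Rle_dec 0 (Re X)) as [HRX|HRX].
    + exists X. left. intros u Hu. apply power_side; auto.
      rewrite Hq by auto. specialize (Hd u Hu).
      assert (E : Re (X * (u / u0)) = Re X + Re (X * (u / u0 - 1))).
      { rewrite <- re_plus. f_equal. ring. }
      assert (H := pow2_ge_0 (Cmod (X * (u / u0 - 1)))). lra.
    + exists (- X)%C. right. intros u Hu. specialize (Hpos u Hu).
      assert (Hun := Re_pos_neq_0 u Hpos).
      apply power_side_inv; auto.
      * intros E. apply HX. replace X with (- - X)%C by ring. rewrite E. ring.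
      * rewrite re_opp. lra.
      * rewrite Cexp_opp, Hq by auto.
        specialize (Hd u Hu).
        set (q := (u / u0)%C) in *.
        assert (Hqn : q <> 0).
        { intros E. apply Hun. replace u with (q * u0)%C by (unfold q; field; auto).
          rewrite E. ring. }
        assert (HX1 : 0 < Cmod X ^ 2 + 2 * Re X).
        { assert (E := Cmod_1_minus (- X)). rewrite re_opp, Cmod_opp in E.
          replace (1 - - X)%C with (/ (1 - u0))%C in E by (unfold X; field; auto).
          rewrite Cmod_inv in E by auto.
          assert (H : 1 < / Cmod (1 - u0)).
          { apply Rmult_lt_reg_r with (Cmod (1 - u0)); auto. rewrite Rinv_l; lra. }
          nra. }
        assert (Hqm : 0 < Cmod q) by (apply Cmod_gt_0; auto).
        assert (E : (Re (- X * / q) - Re (- X)) * Cmod q ^ 2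
            = Re (X * (q - 1)) + Re X * Cmod (q - 1) ^ 2).
        { assert (Eq : (- X * / q)%C = (- X + X * (q - 1) * / q)%C) by (field; auto).
          rewrite Eq, re_plus.
          assert (Ei : (/ q)%C = (Cconj q * / RtoC (Cmod q ^ 2))%C).
          { rewrite Cmod2_conj. field. split; auto.
            intros E. apply Hqn. rewrite <- (Cconj_conj q), E. apply C_ext; simpl; ring. }
          rewrite Ei, <- RtoC_inv by nra.
          rewrite Cmult_assoc, re_scal_r.
          rewrite (Cmod2_alt (q - 1)). assert (Hq2 : 0 < Cmod q ^ 2) by nra.
          replace ((Re (- X) + Re (X * (q - 1) * Cconj q) * / Cmod q ^ 2 - Re (- X)) * Cmod q ^ 2)
            with (Re (X * (q - 1) * Cconj q)) by (field; lra).
          destruct X, q; simpl; ring. }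
        rewrite Cmod_mult in Hd. assert (H0 := pow2_ge_0 (Cmod (q - 1))).
        assert (Hp : 0 < (Re (- X * / q) - Re (- X)) * Cmod q ^ 2) by nra.
        assert (Hq2 : 0 < Cmod q ^ 2) by nra. nra.
Qed.

Definition convex (Om : C -> Prop) : Prop :=
  forall (u v : C) (t : R), Om u -> Om v -> 0 <= t <= 1 ->
    Om (RtoC t * u + RtoC (1 - t) * v)%C.

Lemma Re_convex (u v : C) (t : R) :
  Re (RtoC t * u + RtoC (1 - t) * v) = t * Re u + (1 - t) * Re v.
Proof. rewrite re_plus, !re_scal_l. reflexivity. Qed.

Lemma mu_arg_bound (mu : R) (u : C) : 0 < mu <= 1 -> 0 < Re u ->
  - (mu * (PI / 2)) < Im (RtoC mu * Clog u) < mu * (PI / 2).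
Proof.
  intros Hmu Hu. assert (H := Carg_pos u Hu). rewrite im_scal_l. simpl. nra.
Qed.

Lemma sin_neg_side (a : R) : - PI < a < 0 -> sin a < 0.
Proof.
  intros H. assert (H1 := sin_gt_0 (- a) ltac:(lra) ltac:(lra)). rewrite sin_neg in H1. lra.
Qed.

Lemma Im_rotate (z : C) (a : R) :
  Im (Cexp z) * cos a - Re (Cexp z) * sin a = exp (Re z) * sin (Im z - a).
Proof. rewrite Re_Cexp, Im_Cexp, sin_minus. ring. Qed.

Lemma average_pos (t a b : R) : 0 <= t <= 1 -> 0 < a -> 0 < b -> 0 < t * a + (1 - t) * b.
Proof. intros Ht Ha Hb. destruct (Req_dec t 0) as [->|]; [ lra |]. assert (0 < t * a) by nra. nra. Qed.

(** If a segment between two points of the image left it at [u0^mu], the supporting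
    line at that point would have both ends strictly on one side. *)
Lemma power_disk_convex (mu r : R) : 0 < mu <= 1 -> 0 <= r < 1 -> convex (power_disk mu r).
Proof.
  intros Hmu Hr w1 w2 t [u1 [Hu1 E1]] [u2 [Hu2 E2]] Ht.
  assert (Hp := PI_RGT_0).
  assert (P1 := disk_Re_pos u1 r ltac:(lra) Hu1). assert (P2 := disk_Re_pos u2 r ltac:(lra) Hu2).
  assert (A1 := mu_arg_bound mu u1 Hmu P1). assert (A2 := mu_arg_bound mu u2 Hmu P2).
  assert (R1 : 0 < Re w1) by (rewrite E1; apply Re_Cexp_pos; nra).
  assert (R2 : 0 < Re w2) by (rewrite E2; apply Re_Cexp_pos; nra).
  set (w := (RtoC t * w1 + RtoC (1 - t) * w2)%C).
  assert (Rw : 0 < Re w).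
  { unfold w. rewrite Re_convex.
    destruct (Req_dec t 0) as [->|]; [ lra |]. assert (0 < t * Re w1) by nra. nra. }
  assert (Hw := Re_pos_neq_0 w Rw).
  assert (Aw := Carg_pos w Rw).
  assert (Hsec : - (mu * (PI / 2)) < Carg w < mu * (PI / 2)).
  { assert (Hrot : forall a, Im w * cos a - Re w * sin a =
       t * (exp (Re (RtoC mu * Clog u1)) * sin (Im (RtoC mu * Clog u1) - a)) +
       (1 - t) * (exp (Re (RtoC mu * Clog u2)) * sin (Im (RtoC mu * Clog u2) - a))).
    { intros a. rewrite <- !Im_rotate. fold (Cpower u1 mu) (Cpower u2 mu). rewrite <- E1, <- E2.
      unfold w. rewrite re_plus, im_plus, !re_scal_l, !im_scal_l. ring. }
    assert (Hrw : forall a, Im w * cos a - Re w * sin a = exp (Re (Clog w)) * sin (Carg w - a)).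
    { intros a. rewrite <- (Cexp_Clog w Hw) at 1 2. apply (Im_rotate (Clog w)). }
    assert (X0 := exp_pos (Re (Clog w))).
    assert (X1 := exp_pos (Re (RtoC mu * Clog u1))). assert (X2 := exp_pos (Re (RtoC mu * Clog u2))).
    split; apply Rnot_le_lt; intros Hbad.
    - assert (Hs := Hrot (- (mu * (PI / 2)))). rewrite Hrw in Hs.
      assert (S1 := sin_gt_0 (Im (RtoC mu * Clog u1) - - (mu * (PI / 2))) ltac:(nra) ltac:(nra)).
      assert (S2 := sin_gt_0 (Im (RtoC mu * Clog u2) - - (mu * (PI / 2))) ltac:(nra) ltac:(nra)).
      assert (S0 := sin_ge_0 (- (Carg w - - (mu * (PI / 2)))) ltac:(nra) ltac:(nra)).
      rewrite sin_neg in S0.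
      assert (Y := average_pos t _ _ Ht (Rmult_lt_0_compat _ _ X1 S1) (Rmult_lt_0_compat _ _ X2 S2)).
      assert (Y0 := Rmult_le_pos _ _ (Rlt_le _ _ X0) S0). lra.
    - assert (Hs := Hrot (mu * (PI / 2))). rewrite Hrw in Hs.
      assert (S1 := sin_neg_side (Im (RtoC mu * Clog u1) - mu * (PI / 2)) ltac:(nra)).
      assert (S2 := sin_neg_side (Im (RtoC mu * Clog u2) - mu * (PI / 2)) ltac:(nra)).
      assert (S0 := sin_ge_0 (Carg w - mu * (PI / 2)) ltac:(nra) ltac:(nra)).
      assert (Y := average_pos t _ _ Ht (Rmult_lt_0_compat _ _ X1 (Ropp_0_gt_lt_contravar _ S1))
        (Rmult_lt_0_compat _ _ X2 (Ropp_0_gt_lt_contravar _ S2))).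
      assert (Y0 := Rmult_le_pos _ _ (Rlt_le _ _ X0) S0). lra. }
  (* The sector bound makes [u0] the principal root of the convex combination. *)
  set (l0 := (RtoC (/ mu) * Clog w)%C).
  assert (A0 : - (PI / 2) < Im l0 < PI / 2).
  { unfold l0. rewrite im_scal_l. change (Im (Clog w)) with (Carg w).
    split; apply Rmult_lt_reg_l with mu; try lra;
    rewrite <- Rmult_assoc, Rinv_r, Rmult_1_l by lra; lra. }
  set (u0 := Cexp l0).
  assert (L0 : Clog u0 = l0) by (apply Clog_Cexp; lra).
  assert (RU : 0 < Re u0) by (apply Re_Cexp_pos; auto).
  assert (Emu : (RtoC mu * RtoC (/ mu))%C = 1) by (rewrite <- RtoC_mult, Rinv_r by lra; reflexivity).
  assert (Ew : w = Cpower u0 mu).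
  { unfold Cpower. rewrite L0. unfold l0.
    rewrite Cmult_assoc, Emu, Cmult_1_l. symmetry. apply Cexp_Clog; auto. }
  exists u0. split; auto. apply Rnot_lt_le. intros Hbad.
  destruct (power_separate u0 mu r Hmu Hr Hbad RU) as [V HV].
  assert (Eavg : Re (RtoC t * (V * Cexp (RtoC mu * (Clog u1 - Clog u0)))
       + RtoC (1 - t) * (V * Cexp (RtoC mu * (Clog u2 - Clog u0)))) = Re V).
  { f_equal.
    assert (Hi : forall u, Cexp (RtoC mu * (Clog u - Clog u0)) = (Cpower u mu / w)%C).
    { intros u. rewrite Ew. unfold Cpower. rewrite <- Cexp_minus. f_equal. ring. }
    rewrite !Hi, <- E1, <- E2.
    transitivity (V * (w / w))%C; [ unfold w at 3; field; auto |]. field. auto. }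
  rewrite Re_convex in Eavg.
  destruct HV as [HV|HV]; assert (V1 := HV u1 Hu1); assert (V2 := HV u2 Hu2);
  destruct (Req_dec t 0) as [->|]; [ lra | nra | lra | nra ].
Qed.

(** * Partial sums of the binomial series *)

Fixpoint Csum (u : nat -> C) (n : nat) : C :=
  match n with O => RtoC 0 | S m => (Csum u m + u m)%C end.

Fixpoint Rsum (u : nat -> R) (n : nat) : R :=
  match n with O => 0 | S m => Rsum u m + u m end.

Lemma Csum_ext (u v : nat -> C) (n : nat) :
  (forall k, (k < n)%nat -> u k = v k) -> Csum u n = Csum v n.
Proof.
  induction n as [|n IH]; intros H; [ reflexivity |]. simpl. rewrite IH, H; auto.
Qed.

Lemma Csum_plus (u v : nat -> C) (n : nat) :
  Csum (fun k => u k + v k)%C n = (Csum u n + Csum v n)%C.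
Proof. induction n as [|n IH]; simpl; [ ring | rewrite IH; ring ]. Qed.

Lemma Csum_scal (c : C) (u : nat -> C) (n : nat) :
  Csum (fun k => c * u k)%C n = (c * Csum u n)%C.
Proof. induction n as [|n IH]; simpl; [ ring | rewrite IH; ring ]. Qed.

Lemma Cmod_Csum_le (u : nat -> C) (v : nat -> R) (n : nat) :
  (forall k, (k < n)%nat -> Cmod (u k) <= v k) -> Cmod (Csum u n) <= Rsum v n.
Proof.
  induction n as [|n IH]; intros H; simpl; [ rewrite Cmod_0; lra |].
  eapply Rle_trans; [ apply Cmod_triangle |]. apply Rplus_le_compat; auto.
Qed.

Lemma cderiv_Csum (u u' : nat -> C -> C) (z : C) (n : nat) :
  (forall k, cderiv (u k) z (u' k z)) ->
  cderiv (fun w => Csum (fun k => u k w) n) z (Csum (fun k => u' k z) n).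
Proof.
  intros H. induction n as [|n IH]; simpl; [ apply cderiv_const |].
  apply cderiv_plus; auto.
Qed.

Fixpoint binom_coef (mu : R) (k : nat) : R :=
  match k with O => 1 | S j => binom_coef mu j * (mu + INR j) / INR (S j) end.

Lemma binom_coef_S (mu : R) (k : nat) :
  INR (S k) * binom_coef mu (S k) = (mu + INR k) * binom_coef mu k.
Proof. change (INR (S k) * (binom_coef mu k * (mu + INR k) / INR (S k)) = (mu + INR k) * binom_coef mu k). field. apply not_0_INR. lia. Qed.

Lemma binom_coef_bound (mu : R) (k : nat) : 0 < mu <= 1 -> 0 < binom_coef mu k <= 1.
Proof.
  intros Hmu. induction k as [|k IH]; [ simpl; lra |].
  assert (E := binom_coef_S mu k). rewrite S_INR in E. assert (H := pos_INR k).
  split.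
  - apply Rmult_lt_reg_l with (INR k + 1); [ lra |]. rewrite E, Rmult_0_r.
    apply Rmult_lt_0_compat; lra.
  - apply Rmult_le_reg_l with (INR k + 1); [ lra |]. rewrite E. nra.
Qed.

Definition binom_sum (mu : R) (N : nat) (w : C) : C :=
  Csum (fun k => RtoC (binom_coef mu k) * w ^ k)%C N.

Definition binom_sum' (mu : R) (N : nat) (w : C) : C :=
  Csum (fun k => RtoC (binom_coef mu k) * (INR k * w ^ pred k))%C N.

Definition rbinom_sum (mu : R) (N : nat) (x : R) : R :=
  Rsum (fun k => binom_coef mu k * x ^ k) N.

Definition rbinom_sum' (mu : R) (N : nat) (x : R) : R :=
  Rsum (fun k => binom_coef mu k * (INR k * x ^ pred k)) N.

Lemma cderiv_binom_sum (mu : R) (N : nat) (w : C) :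
  cderiv (binom_sum mu N) w (binom_sum' mu N w).
Proof.
  apply (cderiv_Csum (fun k w => RtoC (binom_coef mu k) * w ^ k)%C
    (fun k w => RtoC (binom_coef mu k) * (INR k * w ^ pred k))%C).
  intros k. apply cderiv_scal, cderiv_pow.
Qed.

Lemma is_derive_rbinom_sum (mu : R) (N : nat) (x : R) :
  is_derive (rbinom_sum mu N) x (rbinom_sum' mu N x).
Proof.
  unfold rbinom_sum, rbinom_sum'. induction N as [|N IH]; simpl.
  - apply (is_derive_const (V := R_NormedModule)).
  - apply (is_derive_plus (V := R_NormedModule)); auto.
    apply is_derive_scal. auto_derive; auto. ring.
Qed.

(** The full series solves [(1-w) S' = mu S]; truncation only leaves the last
    coefficient behind. *)
Lemma binom_sum_ode (mu : R) (N : nat) (w : C) :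
  ((1 - w) * binom_sum' mu N w - mu * binom_sum mu N w
     = - (RtoC (INR N * binom_coef mu N) * w ^ pred N))%C.
Proof.
  unfold binom_sum, binom_sum'. induction N as [|N IH].
  - simpl. rewrite Rmult_0_l. ring.
  - rewrite binom_coef_S. simpl Csum.
    replace ((1 - w) * (Csum (fun k => RtoC (binom_coef mu k) * (INR k * w ^ pred k)) N
       + RtoC (binom_coef mu N) * (INR N * w ^ pred N))
       - mu * (Csum (fun k => RtoC (binom_coef mu k) * w ^ k) N + RtoC (binom_coef mu N) * w ^ N))%C
     with (- (RtoC (INR N * binom_coef mu N) * w ^ pred N)
       + (1 - w) * (RtoC (binom_coef mu N) * (INR N * w ^ pred N))
       - mu * (RtoC (binom_coef mu N) * w ^ N))%C by (rewrite <- IH; ring).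
    rewrite !RtoC_mult, RtoC_plus. simpl pred.
    destruct N; simpl; ring.
Qed.

Lemma rbinom_sum_ode (mu : R) (N : nat) (x : R) :
  (1 - x) * rbinom_sum' mu N x - mu * rbinom_sum mu N x
     = - (INR N * binom_coef mu N * x ^ pred N).
Proof.
  unfold rbinom_sum, rbinom_sum'. induction N as [|N IH].
  - simpl. ring.
  - rewrite binom_coef_S. cbn [Rsum].
    replace (pred (S N)) with N by reflexivity.
    match goal with |- (1 - x) * (?A + ?B) - mu * (?D + ?E) = _ =>
      replace ((1 - x) * (A + B) - mu * (D + E)) with (((1 - x) * A - mu * D) + (1 - x) * B - mu * E)
        by ring end.
    rewrite IH. destruct N; simpl; ring.
Qed.

Lemma rbinom_sum_ge_1 (mu : R) (N : nat) (x : R) : 0 < mu <= 1 -> 0 <= x ->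
  1 <= rbinom_sum mu (S N) x.
Proof.
  intros Hmu Hx. induction N as [|N IH].
  - unfold rbinom_sum; simpl. lra.
  - unfold rbinom_sum in *. cbn [Rsum] in *.
    assert (H := binom_coef_bound mu (S N) Hmu). assert (H1 := pow_le x (S N) Hx). nra.
Qed.

Lemma Cmod_binom_sum_le (mu : R) (N : nat) (w : C) : 0 < mu <= 1 ->
  Cmod (binom_sum mu N w) <= rbinom_sum mu N (Cmod w).
Proof.
  intros Hmu. apply Cmod_Csum_le. intros k _.
  rewrite Cmod_mult, Cmod_pow, Cmod_R_pos; [ lra |].
  apply Rlt_le, binom_coef_bound; auto.
Qed.

Definition binom_ratio (mu : R) (N : nat) (w : C) : C :=
  (Cpower (1 - w) mu * binom_sum mu N w)%C.

Definition binom_ratio' (mu : R) (N : nat) (w : C) : C :=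
  (- (RtoC (INR N * binom_coef mu N) * w ^ pred N * Cpower (1 - w) (mu - 1)))%C.

Lemma Re_1_minus_pos (w : C) : Cmod w < 1 -> 0 < Re (1 - w).
Proof.
  intros H. assert (H1 := re_le_Cmod w). apply Rabs_le_between in H1.
  replace (Re (1 - w)) with (1 - Re w) by (destruct w; simpl; ring). lra.
Qed.

Lemma cderiv_power_1_minus (s : R) (w : C) : Cmod w < 1 ->
  cderiv (fun w => Cpower (1 - w) s) w (- (s * Cpower (1 - w) (s - 1)))%C.
Proof.
  intros H.
  eapply cderiv_eq; [| apply (cderiv_comp (fun u => Cpower u s) (fun w => 1 - w)%C);
    [ apply cderiv_minus; [ apply cderiv_const | apply cderiv_id ]
    | apply cderiv_Cpower, Re_1_minus_pos; auto ] ].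
  ring.
Qed.

(** The truncation error is a monomial, and so is this derivative up to the factor
    [(1-w)^(mu-1)]. *)
Lemma cderiv_binom_ratio (mu : R) (N : nat) (w : C) : Cmod w < 1 ->
  cderiv (binom_ratio mu N) w (binom_ratio' mu N w).
Proof.
  intros H.
  eapply cderiv_eq; [| apply (cderiv_mult (fun w => Cpower (1 - w) mu) (binom_sum mu N));
    [ apply cderiv_power_1_minus; auto | apply cderiv_binom_sum ] ].
  assert (E := binom_sum_ode mu N w). unfold binom_ratio'.
  assert (Ep : Cpower (1 - w) mu = (Cpower (1 - w) (mu - 1) * (1 - w))%C).
  { rewrite <- (Cpower_1 (1 - w)) at 3 by (apply Re_pos_neq_0, Re_1_minus_pos; auto).
    rewrite <- Cpower_plus. f_equal. ring. }
  rewrite Ep.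
  transitivity (Cpower (1 - w) (mu - 1) * ((1 - w) * binom_sum' mu N w - mu * binom_sum mu N w))%C; [ ring |].
  rewrite E. ring.
Qed.

Lemma Rpower_pos (x y : R) : 0 < Rpower x y.
Proof. apply exp_pos. Qed.

Lemma Rpower_decr (x y s : R) : 0 < x <= y -> s <= 0 -> Rpower y s <= Rpower x s.
Proof.
  intros H Hs. unfold Rpower.
  assert (Hl : ln x <= ln y) by (apply ln_le; lra).
  destruct (Rle_lt_or_eq_dec (s * ln y) (s * ln x) ltac:(nra)) as [Hlt|E].
  - left. apply exp_increasing; auto.
  - rewrite E. lra.
Qed.

Lemma Rpower_incr (x y s : R) : 0 < x <= y -> 0 <= s -> Rpower x s <= Rpower y s.
Proof.
  intros H Hs. unfold Rpower.
  assert (Hl : ln x <= ln y) by (apply ln_le; lra).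
  destruct (Rle_lt_or_eq_dec (s * ln x) (s * ln y) ltac:(nra)) as [Hlt|E].
  - left. apply exp_increasing; auto.
  - rewrite E. lra.
Qed.

Lemma Cmod_1_minus_ge (w : C) : 1 - Cmod w <= Cmod (1 - w).
Proof. assert (H := Cmod_triangle_sub 1 w). rewrite Cmod_1 in H. lra. Qed.

Lemma Cmod_binom_ratio' (mu : R) (N : nat) (w : C) : 0 < mu <= 1 ->
  Cmod (binom_ratio' mu N w)
    = INR N * binom_coef mu N * Cmod w ^ pred N * Rpower (Cmod (1 - w)) (mu - 1).
Proof.
  intros Hmu. unfold binom_ratio'.
  rewrite Cmod_opp, !Cmod_mult, Cmod_pow, Cmod_Cpower, Cmod_R_pos; auto.
  apply Rmult_le_pos; [ apply pos_INR | apply Rlt_le, binom_coef_bound; auto ].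
Qed.

Lemma Cmod_scaled (t : R) (w : C) : 0 <= t -> Cmod (0 + RtoC t * w) = t * Cmod w.
Proof. intros H. rewrite Cplus_0_l, Cmod_mult, Cmod_R_pos; auto. Qed.

Lemma scaled_in_disk (t r : R) : 0 <= t <= 1 -> 0 <= r < 1 -> 0 <= t * r < 1 /\ t * r <= r.
Proof. intros; nra. Qed.

Lemma binom_ratio_0 (mu : R) (N : nat) : binom_ratio mu (S N) 0 = RtoC 1.
Proof.
  unfold binom_ratio. replace (1 - 0)%C with (RtoC 1) by ring. rewrite Cpower_one_base.
  unfold binom_sum. induction N as [|N IH]; [ simpl; ring |].
  cbn [Csum] in *. rewrite Cmult_plus_distr_l, IH. simpl. ring.
Qed.

(** This normalises the averages built later: the kernels sum to one up to an error
    that is uniform on smaller disks. *)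
Lemma binom_ratio_near_1 (mu : R) (N : nat) (w : C) (r : R) : 0 < mu <= 1 ->
  Cmod w <= r < 1 ->
  Cmod (binom_ratio mu (S N) w - 1) <= INR (S N) * r ^ N / (1 - r).
Proof.
  intros Hmu Hw. assert (Hw0 := Cmod_ge_0 w).
  set (K := INR (S N) * r ^ N / (1 - r)).
  rewrite <- (binom_ratio_0 mu N).
  replace w with (0 + w)%C at 1 by ring.
  replace K with (K * 1 - K * 0) by ring.
  apply (majorant_bound (binom_ratio mu (S N)) 0 w (binom_ratio' mu (S N)) (fun t => K * t) (fun _ => K)).
  - intros t Ht. apply cderiv_binom_ratio. rewrite Cmod_scaled by lra. nra.
  - intros t Ht. auto_derive; auto. ring.
  - intros t Ht. rewrite Cmod_mult, Cmod_binom_ratio', Cmod_scaled by lra.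
    assert (Hb := binom_coef_bound mu (S N) Hmu).
    assert (HP : Rpower (Cmod (1 - (0 + t * w))) (mu - 1) <= / (1 - r)).
    { apply Rle_trans with (Rpower (1 - r) (mu - 1)).
      - apply Rpower_decr; [| lra]. split; [ lra |].
        eapply Rle_trans; [| apply Cmod_1_minus_ge ]. rewrite Cmod_scaled by lra. nra.
      - rewrite <- (Rpower_1 (1 - r)) at 2 by lra. rewrite <- Rpower_Ropp.
        unfold Rpower. assert (Hl : ln (1 - r) <= 0).
        { rewrite <- ln_1. apply ln_le; lra. }
        destruct (Rle_lt_or_eq_dec ((mu - 1) * ln (1 - r)) (- (1) * ln (1 - r)) ltac:(assert (0 <= mu * - ln (1 - r)) by (apply Rmult_le_pos; lra); lra)) as [Hlt|E].
        + left. apply exp_increasing; auto.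
        + rewrite E. lra. }
    assert (Hpw : (t * Cmod w) ^ pred (S N) <= r ^ N) by (apply pow_incr; nra).
    assert (H0 := pow_le (t * Cmod w) (pred (S N)) ltac:(nra)).
    assert (HN := pos_INR (S N)).
    assert (Hr0 : 0 < / (1 - r)) by (apply Rinv_0_lt_compat; lra).
    assert (HPp := Rpower_pos (Cmod (1 - (0 + t * w))) (mu - 1)).
    unfold K, Rdiv.
    apply Rle_trans with (INR (S N) * 1 * r ^ N * / (1 - r) * 1); [| right; ring ].
    set (bc := binom_coef mu (S N)) in *. clearbody bc.
    repeat apply Rmult_le_compat; try lra; repeat apply Rmult_le_pos; lra.
Qed.

Definition rbinom_ratio (mu : R) (N : nat) (x : R) : R :=
  Rpower (1 - x) mu * rbinom_sum mu N x.

Lemma is_derive_rbinom_ratio (mu : R) (N : nat) (x : R) : x < 1 ->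
  is_derive (rbinom_ratio mu N) x
    (- (INR N * binom_coef mu N * x ^ pred N * Rpower (1 - x) (mu - 1))).
Proof.
  intros Hx.
  assert (H1 : is_derive (fun x => Rpower (1 - x) mu) x (- (mu * Rpower (1 - x) (mu - 1)))).
  { unfold Rpower. auto_derive; [ lra |].
    replace ((mu - 1) * ln (1 - x)) with (mu * ln (1 - x) + - ln (1 - x)) by ring.
    rewrite (exp_plus (mu * ln (1 - x))), exp_Ropp, exp_ln by lra.
    replace (1 + - x) with (1 - x) by ring. field. lra. }
  assert (H := is_derive_mult (K := R_AbsRing) _ _ _ _ _ H1 (is_derive_rbinom_sum mu N x) Rmult_comm).
  evar_last; [ exact H |]. cbn.
  assert (E := rbinom_sum_ode mu N x).
  assert (Ep : Rpower (1 - x) mu = Rpower (1 - x) (mu - 1) * (1 - x)).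
  { rewrite <- (Rpower_1 (1 - x)) at 3 by lra. rewrite <- Rpower_plus. f_equal. ring. }
  rewrite Ep.
  replace (- (INR N * binom_coef mu N * x ^ pred N * Rpower (1 - x) (mu - 1)))
    with (Rpower (1 - x) (mu - 1) * - (INR N * binom_coef mu N * x ^ pred N)) by ring.
  rewrite <- E. unfold plus, mult; simpl. ring.
Qed.

Lemma rbinom_sum_0 (mu : R) (N : nat) : rbinom_sum mu (S N) 0 = 1.
Proof.
  unfold rbinom_sum. induction N as [|N IH]; [ simpl; ring |].
  cbn [Rsum] in *. rewrite IH. simpl. ring.
Qed.

Lemma is_derive_scaled (f : R -> R) (r t l : R) : is_derive f (t * r) l ->
  is_derive (fun s => f (s * r)) t (l * r).
Proof.
  intros H. evar_last.
  - apply (is_derive_comp (V := R_NormedModule) f (fun s => s * r) t l r); auto.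
    auto_derive; auto. ring.
  - unfold scal; simpl. unfold mult; simpl. ring.
Qed.

(** As [mu - 1 <= 0] and [1 - |w| <= |1 - w|], the derivative of the ratio is dominated by
    its value at the positive point of the same circle. *)
Lemma binom_ratio_majorant (mu : R) (N : nat) (w : C) : 0 < mu <= 1 -> Cmod w < 1 ->
  Cmod (binom_ratio mu (S N) w - 1) <= 1 - rbinom_ratio mu (S N) (Cmod w).
Proof.
  intros Hmu Hw. assert (Hw0 := Cmod_ge_0 w). set (r := Cmod w) in *.
  rewrite <- (binom_ratio_0 mu N).
  replace w with (0 + w)%C at 1 by ring.
  assert (E0 : rbinom_ratio mu (S N) 0 = 1).
  { unfold rbinom_ratio. rewrite rbinom_sum_0, Rminus_0_r. unfold Rpower.
    rewrite ln_1, Rmult_0_r, exp_0. ring. }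
  replace (1 - rbinom_ratio mu (S N) r)
    with (- rbinom_ratio mu (S N) (1 * r) - - rbinom_ratio mu (S N) (0 * r))
    by (rewrite Rmult_0_l, Rmult_1_l, E0; ring).
  apply (majorant_bound (binom_ratio mu (S N)) 0 w (binom_ratio' mu (S N))
    (fun t => - rbinom_ratio mu (S N) (t * r))
    (fun t => INR (S N) * binom_coef mu (S N) * (t * r) ^ N * Rpower (1 - t * r) (mu - 1) * r)).
  - intros t Ht. apply cderiv_binom_ratio. rewrite Cmod_scaled by lra. apply scaled_in_disk; auto.
  - intros t Ht.
    assert (H := is_derive_opp (V := R_NormedModule) _ _ _ (is_derive_scaled _ r t _
       (is_derive_rbinom_ratio mu (S N) (t * r) ltac:(apply scaled_in_disk; auto)))).
    evar_last; [ exact H |]. unfold opp; simpl pred; simpl opp. cbn. ring.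
  - intros t Ht. rewrite Cmod_mult, Cmod_binom_ratio', Cmod_scaled by lra. fold r.
    destruct (scaled_in_disk t r Ht (conj Hw0 Hw)) as [[Ha Hb] Hc].
    assert (Hbc := binom_coef_bound mu (S N) Hmu).
    apply Rmult_le_compat_r; auto. simpl pred.
    apply Rmult_le_compat_l.
    + apply Rmult_le_pos; [ apply Rmult_le_pos; [ apply pos_INR | lra ] | apply pow_le; auto ].
    + apply Rpower_decr; [| lra]. split; [ lra |].
      eapply Rle_trans; [| apply Cmod_1_minus_ge ]. rewrite Cmod_scaled by lra. fold r. lra.
Qed.

Lemma Re_binom_ratio_pos (mu : R) (N : nat) (w : C) : 0 < mu <= 1 -> Cmod w < 1 ->
  0 < Re (binom_ratio mu (S N) w).
Proof.
  intros Hmu Hw. assert (H := binom_ratio_majorant mu N w Hmu Hw).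
  assert (H1 : 0 < rbinom_ratio mu (S N) (Cmod w)).
  { apply Rmult_lt_0_compat; [ apply Rpower_pos |].
    assert (H1 := rbinom_sum_ge_1 mu N (Cmod w) Hmu (Cmod_ge_0 w)). lra. }
  rewrite Cmod_sub_sym in H. apply (disk_Re_pos _ (1 - rbinom_ratio mu (S N) (Cmod w))); lra.
Qed.

(** In the derivative of [F^(1/mu)] the powers of [1 - w] cancel, as
    [mu (1/mu - 1) + (mu - 1) = 0].  What remains is a power of the partial sum, which
    is dominated by its value at [|w|]; there the partial sum is at least [1]. *)
Lemma root_binom_ratio_bound (mu : R) (N : nat) (w : C) : 0 < mu <= 1 -> Cmod w < 1 ->
  Cmod (Cpower (binom_ratio mu (S N) w) (/ mu) - 1) <= Cmod w.
Proof.
  intros Hmu Hw. assert (Hw0 := Cmod_ge_0 w). set (r := Cmod w) in *.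
  set (p := / mu). assert (Hp : 1 <= p).
  { unfold p. apply Rmult_le_reg_l with mu; [ lra |]. rewrite Rinv_r; lra. }
  assert (Hmp : mu * p = 1) by (unfold p; field; lra).
  set (s := rbinom_sum mu (S N)).
  assert (Hs : forall x, 0 <= x -> 1 <= s x) by (intros; apply rbinom_sum_ge_1; auto).
  apply Rle_trans with (- ((1 - 1 * r) * Rpower (s (1 * r)) p) - - ((1 - 0 * r) * Rpower (s (0 * r)) p)).
  2:{ rewrite Rmult_0_l, Rmult_1_l. unfold s at 2. rewrite rbinom_sum_0.
      assert (H1 : Rpower 1 p = 1) by (unfold Rpower; rewrite ln_1, Rmult_0_r, exp_0; auto).
      rewrite H1. assert (H2 := Rpower_incr 1 (s r) p ltac:(split; [ lra | auto ]) ltac:(lra)).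
      rewrite H1 in H2. nra. }
  rewrite <- (Cpower_one_base p). rewrite <- (binom_ratio_0 mu N).
  replace w with (0 + w)%C at 1 by ring.
  apply (majorant_bound (fun w => Cpower (binom_ratio mu (S N) w) p) 0 w
    (fun w => p * Cpower (binom_ratio mu (S N) w) (p - 1) * binom_ratio' mu (S N) w)%C
    (fun t => - ((1 - t * r) * Rpower (s (t * r)) p))
    (fun t => p * (INR (S N) * binom_coef mu (S N) * (t * r) ^ N) * Rpower (s (t * r)) (p - 1) * r)).
  - intros t Ht.
    assert (Hd : Cmod (0 + t * w) < 1) by (rewrite Cmod_scaled by lra; apply scaled_in_disk; auto).
    apply (cderiv_comp (fun u => Cpower u p) (binom_ratio mu (S N))).
    + apply cderiv_binom_ratio; auto.
    + apply cderiv_Cpower, Re_binom_ratio_pos; auto.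
  - intros t Ht.
    destruct (scaled_in_disk t r Ht (conj Hw0 Hw)) as [[Ha Hb] Hc].
    assert (Hd : is_derive (fun x => - ((1 - x) * Rpower (s x) p)) (t * r)
       (p * (INR (S N) * binom_coef mu (S N) * (t * r) ^ N) * Rpower (s (t * r)) (p - 1))).
    { set (x := t * r) in *. specialize (Hs x Ha).
      assert (H1 := is_derive_rbinom_sum mu (S N) x).
      assert (E := rbinom_sum_ode mu (S N) x). fold s in H1, E. simpl pred in E.
      assert (H2 : is_derive (fun x => Rpower (s x) p) x (p * Rpower (s x) (p - 1) * rbinom_sum' mu (S N) x)).
      { evar_last.
        - apply (is_derive_comp (V := R_NormedModule) (fun y => Rpower y p) s x (p * Rpower (s x) (p - 1)));
            [| exact H1 ].
          apply is_derive_Reals. apply derivable_pt_lim_power. lra.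
        - unfold scal; simpl. unfold mult; simpl. ring. }
      assert (H3 : is_derive (fun x => 1 - x) x (- (1))) by (auto_derive; auto; ring).
      assert (H := is_derive_opp (V := R_NormedModule) _ _ _ (is_derive_mult (K := R_AbsRing) _ _ _ _ _ H3 H2 Rmult_comm)).
      evar_last; [ exact H |].
      assert (Ep : Rpower (s x) p = Rpower (s x) (p - 1) * s x).
      { rewrite <- (Rpower_1 (s x)) at 3 by lra. rewrite <- Rpower_plus. f_equal. ring. }
      change (- (- (1) * Rpower (s x) p + (1 - x) * (p * Rpower (s x) (p - 1) * rbinom_sum' mu (S N) x)) =
        p * (INR (S N) * binom_coef mu (S N) * x ^ N) * Rpower (s x) (p - 1)).
      rewrite Ep.
      replace (p * (INR (S N) * binom_coef mu (S N) * x ^ N) * Rpower (s x) (p - 1))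
        with (- p * Rpower (s x) (p - 1) * - (INR (S N) * binom_coef mu (S N) * x ^ N)) by ring.
      rewrite <- E.
      replace (Rpower (s x) (p - 1) * s x) with (mu * p * (Rpower (s x) (p - 1) * s x))
        by (rewrite Hmp; ring). ring. }
    apply (is_derive_scaled (fun x => - ((1 - x) * Rpower (s x) p)) r t). exact Hd.
  - intros t Ht.
    destruct (scaled_in_disk t r Ht (conj Hw0 Hw)) as [[Ha Hb] Hc].
    assert (Ez : Cmod (0 + t * w) = t * r) by (apply Cmod_scaled; lra).
    set (z := (0 + t * w)%C) in *.
    assert (HRe : 0 < Re (1 - z)) by (apply Re_1_minus_pos; lra).
    assert (Hm1 : 0 < Cmod (1 - z)) by (apply Cmod_gt_0, Re_pos_neq_0; auto).
    assert (HF : 0 < Re (binom_ratio mu (S N) z)) by (apply Re_binom_ratio_pos; auto; lra).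
    assert (HS : 0 < Cmod (binom_sum mu (S N) z)).
    { apply Cmod_gt_0. intros E. unfold binom_ratio in HF. rewrite E, Cmult_0_r in HF. simpl in HF. lra. }
    rewrite !Cmod_mult, Cmod_Cpower, Cmod_binom_ratio', Ez by auto. fold r.
    rewrite Cmod_R_pos by lra. simpl pred.
    unfold binom_ratio. rewrite Cmod_mult, Cmod_Cpower.
    rewrite <- Rpower_mult_distr by (auto; apply Rpower_pos).
    rewrite Rpower_mult.
    assert (Hpw : Rpower (Cmod (1 - z)) (mu * (p - 1)) * Rpower (Cmod (1 - z)) (mu - 1) = 1).
    { rewrite <- Rpower_plus. replace (mu * (p - 1) + (mu - 1)) with 0 by lra. apply Rpower_O; auto. }
    apply Rmult_le_compat_r; auto.
    replace (p * (Rpower (Cmod (1 - z)) (mu * (p - 1)) * Rpower (Cmod (binom_sum mu (S N) z)) (p - 1)) *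
      (INR (S N) * binom_coef mu (S N) * (t * r) ^ N * Rpower (Cmod (1 - z)) (mu - 1)))
     with (p * (INR (S N) * binom_coef mu (S N) * (t * r) ^ N) *
       (Rpower (Cmod (1 - z)) (mu * (p - 1)) * Rpower (Cmod (1 - z)) (mu - 1))
       * Rpower (Cmod (binom_sum mu (S N) z)) (p - 1)) by ring.
    rewrite Hpw, Rmult_1_r. apply Rmult_le_compat_l.
    + assert (Hbc := binom_coef_bound mu (S N) Hmu).
      set (bc := binom_coef mu (S N)) in *. clearbody bc.
      repeat apply Rmult_le_pos; try lra; [ apply pos_INR | apply pow_le; auto ].
    + apply Rpower_incr; [| lra]. split; auto. rewrite <- Ez.
      apply Cmod_binom_sum_le; auto.
Qed.

(** The principal root of [F] is the continuous one: along the ray from [0] its real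
    part never vanishes, so its argument cannot leave [(-pi/2, pi/2)]. *)
Lemma binom_ratio_in_power_disk (mu : R) (N : nat) (w : C) (r : R) : 0 < mu <= 1 ->
  Cmod w <= r < 1 -> power_disk mu r (binom_ratio mu (S N) w).
Proof.
  intros Hmu Hr. assert (Hw : Cmod w < 1) by lra. assert (Hpi := PI_RGT_0).
  set (F := binom_ratio mu (S N)).
  exists (Cpower (F w) (/ mu)). split.
  { rewrite Cmod_sub_sym. eapply Rle_trans; [ apply root_binom_ratio_bound; auto | lra ]. }
  set (g := fun t : R => Im (Clog (F (0 + RtoC t * w)%C))).
  assert (Hd : forall t, 0 <= t <= 1 -> Cmod (0 + RtoC t * w) < 1).
  { intros t Ht. rewrite Cmod_scaled by lra. apply scaled_in_disk; auto.
    split; auto; apply Cmod_ge_0. }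
  assert (Hc : forall t, 0 <= t <= 1 -> continuity_pt g t).
  { intros t Ht.
    assert (HF := cderiv_comp Clog F _ _ _ (cderiv_binom_ratio mu (S N) _ (Hd t Ht))
      (cderiv_Clog _ (Re_binom_ratio_pos mu N _ Hmu (Hd t Ht)))).
    assert (H := cderiv_line (fun z => Clog (F z)) 0 w _ t (- Ci)%C HF).
    eapply is_derive_continuity_pt. eapply is_derive_ext; [| exact H ].
    intros s. unfold g. simpl. ring. }
  assert (Hcos : forall t, 0 <= t <= 1 -> 0 < cos (/ mu * g t)).
  { intros t Ht. assert (H := root_binom_ratio_bound mu N _ Hmu (Hd t Ht)).
    rewrite Cmod_sub_sym in H.
    assert (H1 := disk_Re_pos _ (Cmod (0 + t * w)) (Hd t Ht) H).
    unfold Cpower in H1. rewrite Re_Cexp, im_scal_l in H1.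
    assert (H2 := exp_pos (Re (RtoC (/ mu) * Clog (F (0 + t * w)%C)))).
    change (0 < exp (Re (RtoC (/ mu) * Clog (F (0 + t * w)%C))) * cos (/ mu * g t)) in H1.
    apply Rmult_lt_reg_l with (1 := H2). lra. }
  assert (Hg0 : g 0 = 0).
  { unfold g. replace (0 + 0 * w)%C with (RtoC 0) by ring. unfold F. rewrite binom_ratio_0.
    replace (Clog 1) with (RtoC 0); auto. rewrite <- Cexp_0, Clog_Cexp; auto. simpl. lra. }
  assert (Hmi : 0 < / mu) by (apply Rinv_0_lt_compat; lra).
  assert (Hg1 : - (PI / 2) < / mu * g 1 < PI / 2).
  { split; apply Rnot_le_lt; intros Hbad.
    - assert (Hne : - (PI / 2) <> / mu * g 1).
      { intros E. assert (H := Hcos 1 ltac:(lra)). rewrite <- E, cos_neg, cos_PI2 in H. lra. }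
      destruct (IVT_interv (fun t => - (/ mu * g t) - PI / 2) 0 1) as [t [Ht1 Ht2]].
      + intros a Ha. apply continuity_pt_minus; [| apply continuity_pt_const; intros ? ?; auto ].
        apply continuity_pt_opp, continuity_pt_scal, Hc; auto.
      + lra.
      + rewrite Hg0. lra.
      + lra.
      + assert (H := Hcos t Ht1). replace (/ mu * g t) with (- (PI / 2)) in H by lra.
        rewrite cos_neg, cos_PI2 in H. lra.
    - assert (Hne : PI / 2 <> / mu * g 1).
      { intros E. assert (H := Hcos 1 ltac:(lra)). rewrite <- E, cos_PI2 in H. lra. }
      destruct (IVT_interv (fun t => / mu * g t - PI / 2) 0 1) as [t [Ht1 Ht2]].
      + intros a Ha. apply continuity_pt_minus; [| apply continuity_pt_const; intros ? ?; auto ].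
        apply continuity_pt_scal, Hc; auto.
      + lra.
      + rewrite Hg0. lra.
      + lra.
      + assert (H := Hcos t Ht1). replace (/ mu * g t) with (PI / 2) in H by lra.
        rewrite cos_PI2 in H. lra. }
  assert (Eg : g 1 = Im (Clog (F w))).
  { unfold g. do 3 f_equal. ring. }
  unfold Cpower at 1. unfold Cpower.
  rewrite Clog_Cexp.
  - rewrite Cmult_assoc, <- RtoC_mult, Rinv_r, Cmult_1_l by lra. symmetry. apply Cexp_Clog.
    apply Re_pos_neq_0, Re_binom_ratio_pos; auto.
  - rewrite im_scal_l, <- Eg. lra.
Qed.

(** * Averaging functionals *)

(** Abstract averages over [K], linear on all functions: finite positive combinations of
    point values qualify, and no measurability or continuity has to be checked. *)
Record is_mean {S : Type} (K : S -> Prop) (E : (S -> C) -> C) : Prop := {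
  mean_plus : forall g h, E (fun s => g s + h s)%C = (E g + E h)%C;
  mean_scal : forall c g, E (fun s => c * g s)%C = (c * E g)%C;
  mean_convex : forall Om g, convex Om -> (forall s, K s -> Om (g s)) -> Om (E g) }.

Lemma ball_convex (c : C) (M : R) : convex (fun z => Cmod (z - c) <= M).
Proof.
  intros u v t Hu Hv Ht.
  replace (t * u + RtoC (1 - t) * v - c)%C with (t * (u - c) + RtoC (1 - t) * (v - c))%C
    by (rewrite RtoC_minus; ring).
  eapply Rle_trans; [ apply Cmod_triangle |].
  rewrite !Cmod_mult, !Cmod_R_pos by lra. nra.
Qed.

Section MeanTheory.
Context {S : Type} (K : S -> Prop) (E : (S -> C) -> C) (HE : is_mean K E).

Lemma mean_near (g : S -> C) (c : C) (M : R) :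
  (forall s, K s -> Cmod (g s - c) <= M) -> Cmod (E g - c) <= M.
Proof. intros H. apply (mean_convex K E HE (fun z => Cmod (z - c) <= M)); auto. apply ball_convex. Qed.

Lemma mean_bound (g : S -> C) (M : R) :
  (forall s, K s -> Cmod (g s) <= M) -> Cmod (E g) <= M.
Proof.
  intros H. replace (E g) with (E g - 0)%C by ring. apply mean_near.
  intros s Hs. replace (g s - 0)%C with (g s) by ring. auto.
Qed.

Lemma mean_dist (g h : S -> C) (M : R) :
  (forall s, K s -> Cmod (g s - h s) <= M) -> Cmod (E g - E h) <= M.
Proof.
  intros H. replace (E g - E h)%C with (E (fun s => g s + - (1) * h s)%C).
  - apply mean_bound. intros s Hs. replace (g s + - (1) * h s)%C with (g s - h s)%C by ring. auto.
  - rewrite (mean_plus K E HE), (mean_scal K E HE). ring.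
Qed.

Lemma mean_ext (g h : S -> C) : (forall s, K s -> g s = h s) -> E g = E h.
Proof.
  intros H. apply Ceq_minus. apply Cmod_eq_0. apply Rle_antisym; [| apply Cmod_ge_0 ].
  apply mean_dist. intros s Hs. rewrite H by auto.
  replace (h s - h s)%C with (RtoC 0) by ring. rewrite Cmod_0. lra.
Qed.

Lemma mean_scal_r (g : S -> C) (c : C) : E (fun s => g s * c)%C = (E g * c)%C.
Proof.
  rewrite Cmult_comm, <- (mean_scal K E HE). apply mean_ext. intros; ring.
Qed.

Lemma mean_const (c : C) : E (fun _ => c) = c.
Proof.
  apply Ceq_minus. apply Cmod_eq_0. apply Rle_antisym; [| apply Cmod_ge_0 ].
  apply mean_near. intros s Hs. replace (c - c)%C with (RtoC 0) by ring. rewrite Cmod_0. lra.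
Qed.

Lemma mean_Csum (u : nat -> S -> C) (n : nat) :
  E (fun s => Csum (fun k => u k s) n) = Csum (fun k => E (u k)) n.
Proof.
  induction n as [|n IH]; simpl; [ apply mean_const |].
  rewrite (mean_plus K E HE (fun s => Csum (fun k => u k s) n) (u n)), IH. reflexivity.
Qed.

End MeanTheory.

Lemma mean_pt {S : Type} (K : S -> Prop) (s : S) : K s -> is_mean K (fun g => g s).
Proof. intros H. split; auto. Qed.

Lemma mean_mix {S : Type} (K : S -> Prop) (E1 E2 : (S -> C) -> C) (t : R) :
  0 <= t <= 1 -> is_mean K E1 -> is_mean K E2 ->
  is_mean K (fun g => RtoC t * E1 g + RtoC (1 - t) * E2 g)%C.
Proof.
  intros Ht H1 H2. split.
  - intros g h. rewrite (mean_plus K E1 H1), (mean_plus K E2 H2). ring.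
  - intros c g. rewrite (mean_scal K E1 H1), (mean_scal K E2 H2). ring.
  - intros Om g HO Hg. apply HO; auto; [ apply (mean_convex K E1 H1) | apply (mean_convex K E2 H2) ]; auto.
Qed.

Lemma mean_comp {S T : Type} (K : S -> Prop) (L : T -> Prop) (E : (S -> C) -> C)
  (F : S -> (T -> C) -> C) :
  is_mean K E -> (forall s, K s -> is_mean L (F s)) -> is_mean L (fun g => E (fun s => F s g)).
Proof.
  intros HE HF. split.
  - intros g h. rewrite <- (mean_plus K E HE). apply (mean_ext K E HE).
    intros s Hs. apply (mean_plus L (F s) (HF s Hs)).
  - intros c g. rewrite <- (mean_scal K E HE). apply (mean_ext K E HE).
    intros s Hs. apply (mean_scal L (F s) (HF s Hs)).
  - intros Om g HO Hg. apply (mean_convex K E HE); auto.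
    intros s Hs. apply (mean_convex L (F s) (HF s Hs)); auto.
Qed.

(** * The disk of the numbers [1 / (1 - w)] *)

(** Dirichlet means average the numbers [1/(1-w)], and convexity is needed in this
    variable; in the variable [w] it is the disk [|w| <= r]. *)
Definition inv_disk (r : R) (A : C) : Prop := Cmod (A - 1) <= r * Cmod A.

Lemma inv_disk_sq (r : R) (A : C) : 0 <= r ->
  inv_disk r A <-> 1 - 2 * Re A + (1 - r ^ 2) * Cmod A ^ 2 <= 0.
Proof.
  intros HR. unfold inv_disk. rewrite Cmod_sub_sym.
  assert (E := Cmod_1_minus A). assert (H1 := Cmod_ge_0 (1 - A)). assert (H2 := Cmod_ge_0 A).
  split; intros H.
  - assert (Cmod (1 - A) ^ 2 <= (r * Cmod A) ^ 2) by (apply pow_incr; auto). nra.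
  - apply Rsqr_incr_0_var; [ unfold Rsqr; nra | nra ].
Qed.

Section InvDisk.
Context (r : R) (HR : 0 <= r < 1).

Lemma inv_disk_Re (A : C) : inv_disk r A -> 1 / 2 <= Re A.
Proof. intros H. apply inv_disk_sq in H; [| lra].
  assert (0 <= (1 - r ^ 2) * Cmod A ^ 2) by (apply Rmult_le_pos; [ nra | apply pow2_ge_0 ]). lra. Qed.

Lemma inv_disk_neq_0 (A : C) : inv_disk r A -> A <> 0.
Proof. intros H. apply Re_pos_neq_0. assert (H1 := inv_disk_Re A H). lra. Qed.

Lemma inv_disk_Cmod_ge (A : C) : inv_disk r A -> 1 / 2 <= Cmod A.
Proof.
  intros H. assert (H1 := inv_disk_Re A H). assert (H2 := re_le_Cmod A).
  assert (H3 := Rle_abs (Re A)). lra.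
Qed.

Lemma inv_disk_Cmod_le (A : C) : inv_disk r A -> Cmod A <= / (1 - r).
Proof.
  intros H. unfold inv_disk in H. assert (H1 := Cmod_triangle_sub A 1). rewrite Cmod_1 in H1.
  apply Rmult_le_reg_r with (1 - r); [ lra |]. rewrite Rinv_l; lra.
Qed.

Lemma inv_disk_convex : convex (inv_disk r).
Proof.
  intros u v t Hu Hv Ht.
  apply inv_disk_sq in Hu; [| lra]. apply inv_disk_sq in Hv; [| lra]. apply inv_disk_sq; [ lra |].
  rewrite Re_convex. rewrite Cmod2_alt in *. rewrite Re_convex, im_plus, !im_scal_l.
  set (a := Re u) in *. set (b := Im u) in *. set (c := Re v) in *. set (d := Im v) in *.
  assert (HQ : 0 <= 1 - r ^ 2) by nra.
  assert (E : (t * a + (1 - t) * c) ^ 2 + (t * b + (1 - t) * d) ^ 2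
    = t * (a ^ 2 + b ^ 2) + (1 - t) * (c ^ 2 + d ^ 2) - t * (1 - t) * ((a - c) ^ 2 + (b - d) ^ 2)) by ring.
  rewrite E. assert (0 <= t * (1 - t) * ((a - c) ^ 2 + (b - d) ^ 2)).
  { apply Rmult_le_pos; [ nra |]. assert (H1 := pow2_ge_0 (a - c)). assert (H2 := pow2_ge_0 (b - d)). lra. }
  assert (0 <= (1 - r ^ 2) * (t * (1 - t) * ((a - c) ^ 2 + (b - d) ^ 2))) by (apply Rmult_le_pos; auto).
  nra.
Qed.

Lemma inv_disk_segment (A X : C) (c : R) : inv_disk r A -> inv_disk r X -> 0 <= c <= 1 ->
  inv_disk r (A + RtoC c * (X - A))%C.
Proof.
  intros HA HX Hc. replace (A + c * (X - A))%C with (RtoC c * X + RtoC (1 - c) * A)%C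
    by (rewrite RtoC_minus; ring).
  apply inv_disk_convex; auto.
Qed.

Lemma inv_disk_param (A : C) : inv_disk r A -> Cmod (1 - / A) <= r.
Proof.
  intros H. assert (H0 := inv_disk_neq_0 A H).
  replace (1 - / A)%C with ((A - 1) / A)%C by (field; auto).
  rewrite Cmod_div by auto. assert (Hm : 0 < Cmod A) by (apply Cmod_gt_0; auto).
  apply Rmult_le_reg_r with (Cmod A); auto. unfold Rdiv. rewrite Rmult_assoc, Rinv_l by lra.
  rewrite Rmult_1_r. exact H.
Qed.

Lemma inv_disk_inv (w : C) : Cmod w <= r -> inv_disk r (/ (1 - w)).
Proof.
  intros H. assert (H0 : (1 - w)%C <> 0) by (apply Re_pos_neq_0, Re_1_minus_pos; lra).
  unfold inv_disk. replace (/ (1 - w) - 1)%C with (w * / (1 - w))%C by (field; auto).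
  rewrite Cmod_mult. apply Rmult_le_compat_r; [ apply Cmod_ge_0 | auto ].
Qed.

(** The remainder is uniform in [X] because the chain moves [X] as well as [A]. *)
Definition utaylor (f f' : C -> C -> C) : Prop :=
  exists M, 0 <= M /\ forall X A A', inv_disk r X -> inv_disk r A -> inv_disk r A' ->
    Cmod (f X A) <= M /\ Cmod (f' X A) <= M /\
    Cmod (f X A' - f X A - (A' - A) * f' X A) <= M * Cmod (A' - A) ^ 2.

Lemma inv_disk_diam (A A' : C) : inv_disk r A -> inv_disk r A' -> Cmod (A' - A) <= 2 / (1 - r).
Proof.
  intros H H'. eapply Rle_trans; [ apply Cmod_sub_le |].
  apply inv_disk_Cmod_le in H. apply inv_disk_Cmod_le in H'. unfold Rdiv. lra.
Qed.

Lemma utaylor_plus (f f' g g' : C -> C -> C) : utaylor f f' -> utaylor g g' ->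
  utaylor (fun X A => f X A + g X A)%C (fun X A => f' X A + g' X A)%C.
Proof.
  intros [M [HM HF]] [N [HN HG]]. exists (M + N). split; [ lra |].
  intros X A A' HX HA HA'. destruct (HF X A A' HX HA HA') as [F1 [F2 F3]].
  destruct (HG X A A' HX HA HA') as [G1 [G2 G3]].
  repeat split; try (eapply Rle_trans; [ apply Cmod_triangle |]; lra).
  replace (f X A' + g X A' - (f X A + g X A) - (A' - A) * (f' X A + g' X A))%C
    with ((f X A' - f X A - (A' - A) * f' X A) + (g X A' - g X A - (A' - A) * g' X A))%C by ring.
  eapply Rle_trans; [ apply Cmod_triangle |]. lra.
Qed.

Lemma utaylor_mult (f f' g g' : C -> C -> C) : utaylor f f' -> utaylor g g' ->
  utaylor (fun X A => f X A * g X A)%C (fun X A => f' X A * g X A + f X A * g' X A)%C.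
Proof.
  intros [M [HM HF]] [N [HN HG]].
  set (D := 2 / (1 - r)). assert (HD : 0 < D) by (apply Rdiv_lt_0_compat; lra).
  exists (2 * M * N + (M + D * M) * N + M * N).
  assert (HMN : 0 <= M * N) by (apply Rmult_le_pos; auto).
  assert (HDMN : 0 <= D * M * N) by (apply Rmult_le_pos; auto; apply Rmult_le_pos; lra).
  split; [ lra |].
  intros X A A' HX HA HA'. destruct (HF X A A' HX HA HA') as [F1 [F2 F3]].
  destruct (HG X A A' HX HA HA') as [G1 [G2 G3]].
  destruct (HG X A' A' HX HA' HA') as [G4 _].
  assert (Hd := inv_disk_diam A A' HA HA'). fold D in Hd.
  assert (Hd0 := Cmod_ge_0 (A' - A)).
  repeat split.
  - rewrite Cmod_mult. assert (H := Rmult_le_compat _ _ _ _ (Cmod_ge_0 _) (Cmod_ge_0 _) F1 G1). lra.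
  - eapply Rle_trans; [ apply Cmod_triangle |]. rewrite !Cmod_mult.
    assert (H := Rmult_le_compat _ _ _ _ (Cmod_ge_0 _) (Cmod_ge_0 _) F1 G2).
    assert (H1 := Rmult_le_compat _ _ _ _ (Cmod_ge_0 _) (Cmod_ge_0 _) F2 G1). lra.
  - set (d := (A' - A)%C) in *.
    replace (f X A' * g X A' - f X A * g X A - d * (f' X A * g X A + f X A * g' X A))%C
      with ((f X A' - f X A - d * f' X A) * g X A'
         + (f X A + d * f' X A) * (g X A' - g X A - d * g' X A)
         + d * d * (f' X A * g' X A))%C by ring.
    eapply Rle_trans; [ apply Cmod_triangle |].
    eapply Rle_trans; [ apply Rplus_le_compat_r, Cmod_triangle |]. rewrite !Cmod_mult.
    assert (B1 : Cmod (f X A' - f X A - d * f' X A) * Cmod (g X A') <= M * Cmod d ^ 2 * N)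
      by (apply Rmult_le_compat; auto using Cmod_ge_0).
    assert (B2 : Cmod (f X A + d * f' X A) * Cmod (g X A' - g X A - d * g' X A)
       <= (M + D * M) * (N * Cmod d ^ 2)).
    { apply Rmult_le_compat; auto using Cmod_ge_0. eapply Rle_trans; [ apply Cmod_triangle |].
      rewrite Cmod_mult. apply Rplus_le_compat; auto. apply Rmult_le_compat; auto using Cmod_ge_0. }
    assert (B3 : Cmod d * Cmod d * (Cmod (f' X A) * Cmod (g' X A)) <= Cmod d ^ 2 * (M * N)).
    { apply Rle_trans with (Cmod d ^ 2 * (Cmod (f' X A) * Cmod (g' X A))); [ right; ring |].
      apply Rmult_le_compat_l; [ apply pow2_ge_0 |]. apply Rmult_le_compat; auto using Cmod_ge_0. }
    assert (H2 := pow2_ge_0 (Cmod d)). nra.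
Qed.

Lemma utaylor_param (phi : C -> C) (B : R) : (forall X, inv_disk r X -> Cmod (phi X) <= B) ->
  utaylor (fun X _ => phi X) (fun _ _ => 0).
Proof.
  intros H. exists (Rmax B 0). split; [ apply Rmax_r |]. intros X A A' HX _ _.
  replace (phi X - phi X - (A' - A) * 0)%C with (RtoC 0) by ring. rewrite Cmod_0.
  assert (H1 := Rmax_l B 0). assert (H2 := Rmax_r B 0). specialize (H X HX).
  assert (H3 := pow2_ge_0 (Cmod (A' - A))). repeat split; try nra.
Qed.

Lemma utaylor_ext (f f' g g' : C -> C -> C) :
  (forall X A, f X A = g X A) -> (forall X A, f' X A = g' X A) -> utaylor f f' -> utaylor g g'.
Proof.
  intros Hf Hf' [M [HM H]]. exists M. split; auto. intros X A A' HX HA HA'.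
  rewrite <- !Hf, <- !Hf'. auto.
Qed.

Lemma utaylor_inv : utaylor (fun _ A => / A)%C (fun _ A => - (/ A * / A))%C.
Proof.
  exists 8. split; [ lra |]. intros X A A' _ HA HA'.
  assert (Hi : forall B, inv_disk r B -> Cmod (/ B) <= 2).
  { intros B HB. assert (H0 := inv_disk_neq_0 B HB). assert (H1 := inv_disk_Cmod_ge B HB).
    rewrite Cmod_inv by auto. apply Rle_trans with (/ (1 / 2)); [ apply Rinv_le_contravar; lra | lra ]. }
  assert (H1 := Hi A HA). assert (H2 := Hi A' HA').
  assert (H3 := Cmod_ge_0 (/ A)). assert (H4 := Cmod_ge_0 (/ A')).
  repeat split.
  - lra.
  - rewrite Cmod_opp, Cmod_mult. nra.
  - replace (/ A' - / A - (A' - A) * - (/ A * / A))%C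
      with ((A' - A) * (A' - A) * ((/ A * / A) * / A'))%C
      by (field; split; apply inv_disk_neq_0; auto).
    rewrite !Cmod_mult.
    assert (H5 : Cmod (/ A) * Cmod (/ A) <= 4) by nra.
    assert (H6 : Cmod (/ A) * Cmod (/ A) * Cmod (/ A') <= 8) by nra.
    assert (H7 := Cmod_ge_0 (A' - A)). nra.
Qed.

Lemma utaylor_one_minus_inv_pow (k : nat) :
  utaylor (fun _ A => (1 - / A) ^ k)%C (fun _ A => INR k * (1 - / A) ^ pred k * (/ A * / A))%C.
Proof.
  assert (H1 : utaylor (fun _ A => 1 - / A)%C (fun _ A => / A * / A)%C).
  { eapply utaylor_ext; [| | apply (utaylor_plus _ _ _ _ (utaylor_param (fun _ => 1) 1 ltac:(intros; cbv beta; rewrite Cmod_1; lra))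
      (utaylor_mult _ _ _ _ (utaylor_param (fun _ => - (1))%C 1 ltac:(intros; cbv beta; rewrite Cmod_opp, Cmod_1; lra)) utaylor_inv)) ];
    intros X A; cbv beta; ring. }
  induction k as [|k IH].
  - eapply utaylor_ext; [| | apply (utaylor_param (fun _ => 1) 1) ].
    + intros; reflexivity.
    + intros; simpl; ring.
    + intros; cbv beta; rewrite Cmod_1; lra.
  - eapply utaylor_ext; [| | apply (utaylor_mult _ _ _ _ H1 IH) ].
    + intros; reflexivity.
    + intros X A. cbv beta. rewrite S_INR, RtoC_plus. destruct k; simpl; ring.
Qed.

Lemma Cmod_power_bound (A : C) (s : R) : 0 <= s -> inv_disk r A ->
  Cmod (Cpower A (- s)) <= Rpower (1 / 2) (- s).
Proof.
  intros Hs HA. rewrite Cmod_Cpower. apply Rpower_decr; [| lra].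
  split; [ lra | apply inv_disk_Cmod_ge; auto ].
Qed.

Lemma utaylor_power (s : R) : 0 <= s ->
  utaylor (fun _ A => Cpower A (- s)) (fun _ A => - s * Cpower A (- s - 1))%C.
Proof.
  intros Hs.
  set (M0 := Rpower (1 / 2) (- s)). set (M1 := Rpower (1 / 2) (- (s + 1))).
  set (M2 := Rpower (1 / 2) (- (s + 2))).
  assert (P0 : 0 < M0) by apply Rpower_pos. assert (P1 : 0 < M1) by apply Rpower_pos.
  assert (P2 : 0 < M2) by apply Rpower_pos.
  assert (HA1 : 0 <= s * M1) by nra.
  assert (HA2 : 0 <= s * (s + 1) * M2) by (apply Rmult_le_pos; nra).
  assert (Hder : forall (B : C) (x : R), inv_disk r B -> cderiv (fun w => Cpower w x) B (x * Cpower B (x - 1))).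
  { intros B x HB. apply cderiv_Cpower. assert (H := inv_disk_Re B HB). lra. }
  assert (Hf1 : forall B, inv_disk r B -> Cmod (- s * Cpower B (- s - 1)) <= s * M1).
  { intros B HB. rewrite Cmod_mult, Cmod_opp, Cmod_R_pos by auto.
    apply Rmult_le_compat_l; auto. replace (- s - 1) with (- (s + 1)) by ring.
    apply Cmod_power_bound; auto. lra. }
  exists (M0 + s * M1 + s * (s + 1) * M2). split; [ lra |]. intros _ A A' _ HA HA'. repeat split.
  - assert (H := Cmod_power_bound A s Hs HA). fold M0 in H. lra.
  - assert (H := Hf1 A HA). lra.
  - set (d := (A' - A)%C).
    assert (HL : forall t, 0 <= t <= 1 ->
        Cmod (- s * Cpower (A + t * d) (- s - 1) - - s * Cpower A (- s - 1)) <= s * (s + 1) * M2 * Cmod d).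
    { intros t Ht.
      replace (s * (s + 1) * M2 * Cmod d) with (s * (s + 1) * M2 * Cmod d * 1 - s * (s + 1) * M2 * Cmod d * 0) by ring.
      apply (majorant_bound (fun B => - s * Cpower B (- s - 1))%C A (t * d)
        (fun B => - s * (RtoC (- s - 1) * Cpower B (- s - 1 - 1)))%C
        (fun x => s * (s + 1) * M2 * Cmod d * x) (fun _ => s * (s + 1) * M2 * Cmod d)).
      - intros x Hx. apply cderiv_scal, Hder.
        replace (A + x * (t * d))%C with (A + RtoC (x * t) * (A' - A))%C by (unfold d; rewrite RtoC_mult; ring).
        apply inv_disk_segment; auto. nra.
      - intros x Hx. auto_derive; auto. ring.
      - intros x Hx.
        set (B := (A + x * (t * d))%C).
        assert (HB : inv_disk r B).
        { unfold B. replace (A + x * (t * d))%C with (A + RtoC (x * t) * (A' - A))%C by (unfold d; rewrite RtoC_mult; ring).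
          apply inv_disk_segment; auto. nra. }
        rewrite !Cmod_mult, Cmod_opp, (Cmod_R_pos s), (Cmod_R_pos t), Cmod_R by lra.
        replace (- s - 1 - 1) with (- (s + 2)) by ring.
        assert (H := Cmod_power_bound B (s + 2) ltac:(lra) HB). fold M2 in H.
        replace (Rabs (- s - 1)) with (s + 1) by (rewrite <- Rabs_Ropp, Rabs_pos_eq; lra).
        assert (Hd := Cmod_ge_0 d). assert (Hc := Cmod_ge_0 (Cpower B (- (s + 2)))).
        assert (X1 : 0 <= (s + 1) * Cmod (Cpower B (- (s + 2)))) by (apply Rmult_le_pos; lra).
        assert (X2 : (s + 1) * Cmod (Cpower B (- (s + 2))) <= (s + 1) * M2) by (apply Rmult_le_compat_l; lra).
        assert (X3 : t * Cmod d <= Cmod d) by nra.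
        assert (X4 : 0 <= t * Cmod d) by nra.
        assert (X5 := Rmult_le_compat _ _ _ _ X1 X4 X2 X3).
        assert (X6 := Rmult_le_compat_l s _ _ Hs X5). lra. }
    assert (E : (Cpower A' (- s) - Cpower A (- s) - d * (- s * Cpower A (- s - 1)))%C
      = ((Cpower (A + d) (- s) - (A + d) * (- s * Cpower A (- s - 1))) -
         (Cpower A (- s) - A * (- s * Cpower A (- s - 1))))%C).
    { replace (A + d)%C with A' by (unfold d; ring). unfold d. ring. }
    rewrite E.
    apply Rle_trans with (s * (s + 1) * M2 * Cmod d * Cmod d * 1 - s * (s + 1) * M2 * Cmod d * Cmod d * 0).
    + apply (majorant_bound (fun B => Cpower B (- s) - B * (- s * Cpower A (- s - 1)))%C A d
        (fun B => RtoC (- s) * Cpower B (- s - 1) - 1 * (- s * Cpower A (- s - 1)))%C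
        (fun x => s * (s + 1) * M2 * Cmod d * Cmod d * x) (fun _ => s * (s + 1) * M2 * Cmod d * Cmod d)).
      * intros t Ht. apply cderiv_minus.
        -- apply Hder. apply inv_disk_segment; auto.
        -- eapply cderiv_eq; [| apply cderiv_mult; [ apply cderiv_id | apply cderiv_const ]]. cbv beta; ring.
      * intros t Ht. auto_derive; auto. ring.
      * intros t Ht. rewrite Cmod_mult. apply Rmult_le_compat_r; [ apply Cmod_ge_0 |].
        rewrite RtoC_opp, Cmult_1_l. apply HL; auto.
    + assert (H := pow2_ge_0 (Cmod d)).
      assert (0 <= M0 * Cmod d ^ 2) by nra. assert (0 <= s * M1 * Cmod d ^ 2) by nra. nra.
Qed.

End InvDisk.

(** * A Markov chain whose stationary law is a Dirichlet mean *)

Lemma Csum_shift (u : nat -> C) (n : nat) :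
  Csum u (S n) = (u O + Csum (fun k => u (S k)) n)%C.
Proof. induction n as [|n IH]; [ simpl; ring |]. cbn [Csum] in *. rewrite IH. ring. Qed.

Section Kernels.
Context (mu : R) (Hmu : 0 < mu <= 1).

Definition kernel (k : nat) (A : C) : C :=
  (RtoC (binom_coef mu k) * (Cpower A (- mu) * (1 - / A) ^ k))%C.

Definition kernel' (k : nat) (A : C) : C :=
  (RtoC (binom_coef mu k) * (- mu * Cpower A (- mu - 1) * (1 - / A) ^ k +
     Cpower A (- mu) * (INR k * (1 - / A) ^ pred k * (/ A * / A))))%C.

(** The kernel for the exponent [mu + 1]: the one with which stationarity of the
    Dirichlet mean takes a closed form. *)
Definition kernel_up (k : nat) (A : C) : C :=
  (RtoC ((INR k + mu) * binom_coef mu k) * (Cpower A (- mu) * / A * (1 - / A) ^ k))%C.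

Lemma kernel_up_diff (k : nat) (A : C) : A <> 0 ->
  kernel_up k A = (RtoC (INR k + mu) * kernel k A - RtoC (INR (S k)) * kernel (S k) A)%C.
Proof.
  intros HA. unfold kernel_up, kernel.
  replace (RtoC (INR (S k)) * (RtoC (binom_coef mu (S k)) * (Cpower A (- mu) * (1 - / A) ^ S k)))%C
    with (RtoC (INR (S k) * binom_coef mu (S k)) * (Cpower A (- mu) * (1 - / A) ^ S k))%C
    by (rewrite RtoC_mult; ring).
  rewrite binom_coef_S, Cpow_S. rewrite (Rplus_comm mu), !RtoC_mult. ring.
Qed.

Lemma Cpower_minus_1 (A : C) (s : R) : A <> 0 -> Cpower A (s - 1) = (Cpower A s * / A)%C.
Proof.
  intros HA. unfold Rminus. rewrite Cpower_plus, Cpower_opp, Cpower_1; auto.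
Qed.

Lemma kernel_ode_0 (A X : C) : A <> 0 ->
  (mu * kernel 0 A + (A - X) * kernel' 0 A = X * kernel_up 0 A)%C.
Proof.
  intros HA. unfold kernel, kernel', kernel_up. rewrite Cpower_minus_1 by auto.
  simpl. rewrite Rplus_0_l, Rmult_1_r. field. auto.
Qed.

(** Differentiating along the line from [A] to [X] raises the exponent from [mu] to
    [mu + 1]; this is the coefficient form of
    [mu u^(-mu) + (A - X) d(u^(-mu))/dA = mu u_X u^(-mu-1)] with [u = A (1-y) + y] and
    [u_X = X (1-y) + y]. *)
Lemma kernel_ode_S (k : nat) (A X : C) : A <> 0 ->
  (mu * kernel (S k) A + (A - X) * kernel' (S k) A
    = X * kernel_up (S k) A - (X - 1) * kernel_up k A)%C.
Proof.
  intros HA. unfold kernel, kernel', kernel_up. rewrite Cpower_minus_1 by auto.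
  assert (E := binom_coef_S mu k). rewrite (Rplus_comm mu) in E. rewrite <- E.
  simpl pred. rewrite !Cpow_S, !RtoC_mult, RtoC_plus. field. auto.
Qed.

Lemma Csum_kernel (N : nat) (A : C) : 0 < Re A ->
  Csum (fun k => kernel k A) N = binom_ratio mu N (1 - / A).
Proof.
  intros HA. assert (HA0 := Re_pos_neq_0 A HA). unfold binom_ratio, binom_sum, kernel.
  assert (Hb := Carg_pos A HA). assert (Hp := PI_RGT_0).
  replace (1 - (1 - / A))%C with (/ A)%C by ring.
  assert (E : Cpower (/ A) mu = Cpower A (- mu)).
  { unfold Cpower. f_equal. rewrite <- (Cexp_Clog A HA0) at 1. rewrite <- Cexp_opp, Clog_Cexp.
    - rewrite RtoC_opp. ring.
    - simpl. lra. }
  rewrite E, <- Csum_scal. apply Csum_ext. intros; ring.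
Qed.

(** The coefficients of [1/(X (1-y) + y)]. *)
Definition weight (j : nat) (X : C) : C := (/ X * (1 - / X) ^ j)%C.

(** Multiplying by [1/(X (1-y) + y)] cancels the factor [u_X] of [kernel_ode_S], so
    that the drift of these functions no longer involves [X]. *)
Definition test (k : nat) (X A : C) : C :=
  Csum (fun j => weight j X * kernel (k - j) A)%C (S k).

Definition test' (k : nat) (X A : C) : C :=
  Csum (fun j => weight j X * kernel' (k - j) A)%C (S k).

Lemma test_S (k : nat) (X A : C) :
  test (S k) X A = ((1 - / X) * test k X A + / X * kernel (S k) A)%C.
Proof.
  unfold test. rewrite Csum_shift. unfold weight at 1. simpl Cpow.
  rewrite Cmult_1_r. rewrite <- Csum_scal, Cplus_comm.
  change (S k - 0)%nat with (S k). f_equal. apply Csum_ext. intros j _.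
  change (S k - S j)%nat with (k - j)%nat. unfold weight. simpl Cpow. ring.
Qed.

Lemma test'_S (k : nat) (X A : C) :
  test' (S k) X A = ((1 - / X) * test' k X A + / X * kernel' (S k) A)%C.
Proof.
  unfold test'. rewrite Csum_shift. unfold weight at 1. simpl Cpow.
  rewrite Cmult_1_r. rewrite <- Csum_scal, Cplus_comm.
  change (S k - 0)%nat with (S k). f_equal. apply Csum_ext. intros j _.
  change (S k - S j)%nat with (k - j)%nat. unfold weight. simpl Cpow. ring.
Qed.

Lemma test_ode (k : nat) (X A : C) : A <> 0 -> X <> 0 ->
  (mu * test k X A + (A - X) * test' k X A = kernel_up k A)%C.
Proof.
  intros HA HX. induction k as [|k IH].
  - transitivity (/ X * (mu * kernel 0 A + (A - X) * kernel' 0 A))%C.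
    + unfold test, test', weight. simpl. ring.
    + rewrite kernel_ode_0 by auto. field. auto.
  - rewrite test_S, test'_S.
    transitivity ((1 - / X) * (mu * test k X A + (A - X) * test' k X A)
       + / X * (mu * kernel (S k) A + (A - X) * kernel' (S k) A))%C; [ ring |].
    rewrite IH, kernel_ode_S by auto. field. auto.
Qed.

Section Disk.
Context (r : R) (Hr : 0 <= r < 1).

Lemma weight_bound (j : nat) (X : C) : inv_disk r X -> Cmod (weight j X) <= 2.
Proof.
  intros HX. unfold weight. rewrite Cmod_mult, Cmod_pow.
  assert (H0 := inv_disk_neq_0 r Hr X HX). assert (H1 := inv_disk_Cmod_ge r Hr X HX).
  assert (H2 := inv_disk_param r Hr X HX).
  rewrite Cmod_inv by auto.
  assert (H3 : / Cmod X <= 2) by (apply Rle_trans with (/ (1 / 2)); [ apply Rinv_le_contravar; lra | lra ]).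
  assert (H4 : Cmod (1 - / X) ^ j <= 1).
  { apply pow_le_1. split; [ apply Cmod_ge_0 | lra ]. }
  assert (H5 := pow_le _ j (Cmod_ge_0 (1 - / X))).
  assert (H6 : 0 < / Cmod X) by (apply Rinv_0_lt_compat; lra). nra.
Qed.

Lemma utaylor_kernel (k : nat) : utaylor r (fun _ A => kernel k A) (fun _ A => kernel' k A).
Proof.
  eapply utaylor_ext; [| | apply (utaylor_mult r Hr _ _ _ _
     (utaylor_param r (fun _ => RtoC (binom_coef mu k)) (Rabs (binom_coef mu k)) ltac:(intros; cbv beta; rewrite Cmod_R; apply Rle_refl))
     (utaylor_mult r Hr _ _ _ _ (utaylor_power r Hr mu (Rlt_le _ _ (proj1 Hmu))) (utaylor_one_minus_inv_pow r Hr k))) ].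
  - intros. reflexivity.
  - intros. unfold kernel'. cbv beta. ring.
Qed.

Lemma utaylor_test (k : nat) : utaylor r (test k) (test' k).
Proof.
  unfold test, test'.
  assert (H : forall n, utaylor r (fun X A => Csum (fun j => weight j X * kernel (k - j) A)%C n)
     (fun X A => Csum (fun j => weight j X * kernel' (k - j) A)%C n)); [| apply H ].
  induction n as [|n IH].
  - simpl. apply (utaylor_param r (fun _ => 0) 0). intros. cbv beta. rewrite Cmod_0. lra.
  - simpl. apply (utaylor_plus r (fun X A => Csum (fun j => weight j X * kernel (k - j) A)%C n)
      (fun X A => Csum (fun j => weight j X * kernel' (k - j) A)%C n)); auto.
    eapply utaylor_ext; [| | apply (utaylor_mult r Hr _ _ _ _
       (utaylor_param r (weight n) 2 (weight_bound n)) (utaylor_kernel (k - n))) ];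
    intros; cbv beta; ring.
Qed.

Definition pair_disk (s : C * C) : Prop := inv_disk r (fst s) /\ inv_disk r (snd s).

Context (M0 : (C -> C) -> C) (HM0 : is_mean (inv_disk r) M0).

(** An Euler step of the process whose stationary law in [A] is that of the mean of a
    Dirichlet process with base measure [mu] times [M0]: [A] moves towards [X]
    exponentially, at rate [1/mu] for jump rate one, and jumps renew [X].  The step of
    length [d] has [c = d/mu]. *)
Definition chain_step (c d : R) (g : C * C -> C) (s : C * C) : C :=
  (RtoC d * M0 (fun Y => g (fst s, Y)) +
   RtoC (1 - d) * g (fst s + RtoC c * (snd s - fst s), snd s))%C.

Lemma chain_step_mean (c d : R) (s : C * C) : 0 <= c <= 1 -> 0 <= d <= 1 -> pair_disk s ->
  is_mean pair_disk (fun g => chain_step c d g s).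
Proof.
  intros Hc Hd [H1 H2]. apply (mean_mix pair_disk (fun g => M0 (fun Y => g (fst s, Y)))
    (fun g => g ((fst s + RtoC c * (snd s - fst s))%C, snd s))); auto.
  - apply (mean_comp (inv_disk r) pair_disk M0 (fun Y g => g (fst s, Y))); auto.
    intros Y HY. apply mean_pt. split; auto.
  - apply mean_pt. split; auto. simpl. apply inv_disk_segment; auto.
Qed.

Fixpoint chain_law (c d : R) (s0 : C * C) (t : nat) (g : C * C -> C) : C :=
  match t with
  | O => g s0
  | S t' => chain_law c d s0 t' (chain_step c d g)
  end.

(** Running means of the laws at times [0, ..., t]. *)
Fixpoint chain_avg (c d : R) (s0 : C * C) (t : nat) (g : C * C -> C) : C :=
  match t with
  | O => g s0
  | S t' => (RtoC (INR t / INR (S t)) * chain_avg c d s0 t' g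
             + RtoC (1 - INR t / INR (S t)) * chain_law c d s0 t g)%C
  end.

Lemma chain_law_mean (c d : R) (s0 : C * C) (t : nat) : 0 <= c <= 1 -> 0 <= d <= 1 ->
  pair_disk s0 -> is_mean pair_disk (chain_law c d s0 t).
Proof.
  intros Hc Hd Hs. induction t as [|t IH]; simpl; [ apply mean_pt; auto |].
  apply (mean_comp pair_disk pair_disk (chain_law c d s0 t) (fun s g => chain_step c d g s)); auto.
  intros; apply chain_step_mean; auto.
Qed.

Lemma chain_avg_mean (c d : R) (s0 : C * C) (t : nat) : 0 <= c <= 1 -> 0 <= d <= 1 ->
  pair_disk s0 -> is_mean pair_disk (chain_avg c d s0 t).
Proof.
  intros Hc Hd Hs. induction t as [|t IH]; [ apply mean_pt; auto |].
  apply mean_mix; auto; [| apply chain_law_mean; auto ].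
  assert (H := pos_INR (S t)). assert (H1 := lt_0_INR (S (S t)) ltac:(lia)). rewrite (S_INR (S t)) in *.
  apply Rdiv_between_0_1; lra.
Qed.

Lemma chain_avg_telescope (c d : R) (s0 : C * C) (t : nat) (g : C * C -> C) :
  (RtoC (INR (S t)) * (chain_avg c d s0 t (chain_step c d g) - chain_avg c d s0 t g)
    = chain_law c d s0 (S t) g - g s0)%C.
Proof.
  induction t as [|t IH]; [ simpl; ring |].
  cbn [chain_avg]. set (N := INR (S t)) in *.
  assert (HN : 0 < N + 1) by (unfold N; assert (H := pos_INR (S t)); lra).
  rewrite (S_INR (S t)). fold N.
  replace (RtoC (N / (N + 1))) with (RtoC N / RtoC (N + 1))%C by (symmetry; apply RtoC_div; lra).
  replace (RtoC (1 - N / (N + 1))) with (1 / RtoC (N + 1))%C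
    by (rewrite <- RtoC_div by lra; f_equal; field; lra).
  assert (HN' : RtoC (N + 1) <> 0) by (apply RtoC_neq_0; lra).
  set (x := chain_avg c d s0 t (chain_step c d g)) in *. set (x' := chain_avg c d s0 t g) in *.
  set (y := chain_law c d s0 (S t) (chain_step c d g)). set (y' := chain_law c d s0 (S t) g) in *.
  transitivity (N * (x - x') + (y - y'))%C; [ field; auto |].
  rewrite IH. unfold y, y'. simpl. ring.
Qed.

(** Applying one more step to a running mean only changes its two end terms. *)
Lemma chain_avg_stationary (c d : R) (s0 : C * C) (t : nat) (g : C * C -> C) (B : R) :
  0 <= c <= 1 -> 0 <= d <= 1 -> pair_disk s0 -> (forall s, pair_disk s -> Cmod (g s) <= B) ->
  Cmod (chain_avg c d s0 t (chain_step c d g) - chain_avg c d s0 t g) <= 2 * B / INR (S t).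
Proof.
  intros Hc Hd Hs HB. assert (HN := lt_0_INR (S t) ltac:(lia)).
  apply Rmult_le_reg_l with (INR (S t)); auto.
  rewrite <- (Cmod_R_pos (INR (S t))) at 1 by lra.
  rewrite <- Cmod_mult, chain_avg_telescope.
  eapply Rle_trans; [ apply Cmod_sub_le |].
  assert (H1 := mean_bound _ _ (chain_law_mean c d s0 (S t) Hc Hd Hs) g B HB).
  assert (H2 := HB s0 Hs). replace (INR (S t) * (2 * B / INR (S t))) with (2 * B) by (field; lra). lra.
Qed.

Definition conv (u v : nat -> C) (k : nat) : C :=
  Csum (fun j => u j * v (k - j)%nat)%C (S k).

(** To first order in [d], the drift contributes a function of [A] alone by [test_ode],
    and the renewal of [X] contributes the convolution. *)
Lemma chain_drift (k : nat) : exists B, 0 <= B /\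
  (forall s, pair_disk s -> Cmod (test k (snd s) (fst s)) <= B) /\
  forall d, 0 < d -> d <= mu -> forall s, pair_disk s ->
  Cmod (chain_step (d / mu) d (fun s => test k (snd s) (fst s)) s - test k (snd s) (fst s)
    - RtoC d * (conv (fun j => M0 (weight j)) (fun j => kernel j (fst s)) k
                - / mu * kernel_up k (fst s))) <= B * d ^ 2.
Proof.
  destruct (utaylor_test k) as [M [HM HT]].
  set (D := 2 / (1 - r)). assert (HD : 0 < D) by (apply Rdiv_lt_0_compat; lra).
  exists (M + M * D ^ 2 / mu ^ 2 + M * D / mu).
  assert (HMD : 0 <= M * D ^ 2 / mu ^ 2).
  { apply Rmult_le_pos; [ apply Rmult_le_pos; nra | left; apply Rinv_0_lt_compat; nra ]. }
  assert (HMD2 : 0 <= M * D / mu).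
  { apply Rmult_le_pos; [ nra | left; apply Rinv_0_lt_compat; lra ]. }
  split; [ lra |]. split.
  { intros [A X] [HA HX]. simpl in *. destruct (HT X A A HX HA HA) as [H _]. lra. }
  intros d Hd Hdm [A X] [HA HX]. simpl fst in *. simpl snd in *.
  assert (HA0 := inv_disk_neq_0 r Hr A HA). assert (HX0 := inv_disk_neq_0 r Hr X HX).
  set (c := d / mu). assert (Hc : 0 <= c <= 1).
  { apply Rdiv_between_0_1; lra. }
  set (A' := (A + c * (X - A))%C).
  assert (HA' : inv_disk r A') by (apply inv_disk_segment; auto).
  destruct (HT X A A' HX HA HA') as [T1 [T2 T3]].
  unfold chain_step. simpl fst. simpl snd. fold A'.
  assert (EM : M0 (fun Y => test k Y A) = conv (fun j => M0 (weight j)) (fun j => kernel j A) k).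
  { unfold test, conv. rewrite (mean_Csum _ _ HM0 (fun j Y => weight j Y * kernel (k - j) A)%C).
    apply Csum_ext. intros j _. apply (mean_scal_r _ _ HM0). }
  rewrite EM. set (V := conv _ _ k).
  assert (Eode := test_ode k X A HA0 HX0).
  assert (Hmu0 : RtoC mu <> 0) by (apply RtoC_neq_0; lra).
  assert (Ec : RtoC c = (RtoC d / mu)%C) by (unfold c; apply RtoC_div; lra).
  assert (EA : (A' - A)%C = (c * (X - A))%C) by (unfold A'; ring).
  rewrite <- Eode.
  replace (d * V + RtoC (1 - d) * test k X A' - test k X A - d * (V - / mu * (mu * test k X A + (A - X) * test' k X A)))%C
    with (RtoC (1 - d) * (test k X A' - test k X A - (A' - A) * test' k X A)
      - d * ((A' - A) * test' k X A))%C.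
  2:{ rewrite EA, Ec, RtoC_minus. field. auto. }
  assert (HdA : Cmod (A' - A) <= c * D).
  { rewrite EA, Cmod_mult, Cmod_R_pos by lra. apply Rmult_le_compat_l; [ lra |].
    apply inv_disk_diam; auto. }
  assert (HdA0 := Cmod_ge_0 (A' - A)).
  eapply Rle_trans; [ apply Cmod_sub_le |]. rewrite !Cmod_mult, !Cmod_R_pos by lra.
  assert (Hcd : c * D = d * D / mu) by (unfold c; field; lra).
  assert (X1 : Cmod (A' - A) ^ 2 <= (c * D) ^ 2) by (apply pow_incr; auto).
  assert (X2 : M * Cmod (A' - A) ^ 2 <= M * (c * D) ^ 2) by (apply Rmult_le_compat_l; auto).
  assert (X3 : (1 - d) * Cmod (test k X A' - test k X A - (A' - A) * test' k X A) <= M * (c * D) ^ 2).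
  { assert (H := Cmod_ge_0 (test k X A' - test k X A - (A' - A) * test' k X A)). nra. }
  assert (X4 : Cmod (A' - A) * Cmod (test' k X A) <= c * D * M)
    by (apply Rmult_le_compat; auto using Cmod_ge_0).
  assert (X5 : d * (Cmod (A' - A) * Cmod (test' k X A)) <= d * (c * D * M)) by (apply Rmult_le_compat_l; lra).
  assert (E1 : M * (c * D) ^ 2 = M * D ^ 2 / mu ^ 2 * d ^ 2) by (rewrite Hcd; field; lra).
  assert (E2 : d * (c * D * M) = M * D / mu * d ^ 2) by (rewrite Hcd; field; lra).
  assert (H := pow2_ge_0 d). nra.
Qed.

(** The step is chosen first, to make the second order terms small, and the running
    time afterwards.  The starting point [(1, 1)] lies in every disk. *)
Lemma dirichlet_mean (N : nat) (eps : R) : 0 < eps ->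
  exists L : (C -> C) -> C, is_mean (inv_disk r) L /\
    forall k, (k < N)%nat ->
      Cmod (L (kernel_up k) - mu * conv (fun j => M0 (weight j)) (fun j => L (kernel j)) k) <= eps.
Proof.
  intros He.
  assert (HB : exists B, 0 <= B /\ forall k, (k < N)%nat ->
     (forall s, pair_disk s -> Cmod (test k (snd s) (fst s)) <= B) /\
     forall d, 0 < d -> d <= mu -> forall s, pair_disk s ->
     Cmod (chain_step (d / mu) d (fun s => test k (snd s) (fst s)) s - test k (snd s) (fst s)
    - RtoC d * (conv (fun j => M0 (weight j)) (fun j => kernel j (fst s)) k
                - / mu * kernel_up k (fst s))) <= B * d ^ 2).
  { clear eps He. induction N as [|n [B [HB IH]]].
    - exists 0. split; [ lra |]. intros; lia.
    - destruct (chain_drift n) as [B' [HB' [H1 H2]]]. exists (B + B'). split; [ lra |].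
      intros k Hk. destruct (Nat.eq_dec k n) as [->|Hne].
      + split.
        * intros s Hs. specialize (H1 s Hs). lra.
        * intros d Hd Hdm s Hs. specialize (H2 d Hd Hdm s Hs). assert (H := pow2_ge_0 d). nra.
      + destruct (IH k ltac:(lia)) as [H3 H4]. split.
        * intros s Hs. specialize (H3 s Hs). lra.
        * intros d Hd Hdm s Hs. specialize (H4 d Hd Hdm s Hs). assert (H := pow2_ge_0 d). nra. }
  destruct HB as [B [HB Hk]].
  set (d := Rmin mu (eps / (2 * (B + 1)))).
  assert (Hd : 0 < d) by (apply Rmin_glb_lt; [ lra | apply Rdiv_lt_0_compat; lra ]).
  assert (Hdm : d <= mu) by apply Rmin_l.
  assert (Hdb : B * d <= eps / 2).
  { apply Rle_trans with ((B + 1) * (eps / (2 * (B + 1)))).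
    - apply Rmult_le_compat; try lra. apply Rmin_r.
    - right; field; lra. }
  destruct (INR_unbounded (4 * B / (eps * d))) as [T HT].
  assert (Hed : 0 < eps * d) by nra.
  assert (HT' : 2 * B / INR (S T) <= eps / 2 * d).
  { assert (HS := lt_0_INR (S T) ltac:(lia)).
    apply Rmult_le_reg_r with (INR (S T)); auto. unfold Rdiv at 1. rewrite Rmult_assoc, Rinv_l, Rmult_1_r by lra.
    rewrite S_INR. assert (H : 4 * B / (eps * d) * (eps * d) = 4 * B) by (field; lra). nra. }
  set (one := (RtoC 1, RtoC 1)).
  assert (Hone : pair_disk one).
  { split; simpl; unfold inv_disk; replace (1 - 1)%C with (RtoC 0) by ring; rewrite Cmod_0, Cmod_1; lra. }
  assert (Hc : 0 <= d / mu <= 1).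
  { apply Rdiv_between_0_1; lra. }
  set (E := chain_avg (d / mu) d one T).
  assert (HE : is_mean pair_disk E) by (apply chain_avg_mean; auto; lra).
  assert (HL : is_mean (inv_disk r) (fun g => E (fun s => g (fst s)))).
  { apply (mean_comp pair_disk (inv_disk r) E (fun s g => g (fst s))); auto.
    intros s [Hs _]. apply mean_pt; auto. }
  exists (fun g => E (fun s => g (fst s))). split; auto.
  intros k Hkn. destruct (Hk k Hkn) as [H1 H2]. clear Hk.
  specialize (H2 d Hd Hdm).
  set (tst := fun s : C * C => test k (snd s) (fst s)) in *.
  assert (H3 := chain_avg_stationary (d / mu) d one T tst B Hc ltac:(lra) Hone H1). fold E in H3.
  set (W := fun s : C * C => (RtoC d * (conv (fun j => M0 (weight j)) (fun j => kernel j (fst s)) k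
                - / mu * kernel_up k (fst s)))%C).
  assert (H4 : Cmod (E (chain_step (d / mu) d tst) - E (fun s => tst s + W s)%C) <= B * d ^ 2).
  { apply (mean_dist _ _ HE). intros s Hs. replace (chain_step (d / mu) d tst s - (tst s + W s))%C
      with (chain_step (d / mu) d tst s - tst s - W s)%C by ring. apply H2; auto. }
  rewrite (mean_plus _ _ HE) in H4.
  assert (EW : E W = (RtoC d * (conv (fun j => M0 (weight j)) (fun j => E (fun s => kernel j (fst s))) k
       - / mu * E (fun s => kernel_up k (fst s))))%C).
  { unfold W. rewrite (mean_scal _ _ HE). f_equal.
    rewrite (mean_ext _ _ HE _ (fun s => conv (fun j => M0 (weight j)) (fun j => kernel j (fst s)) k
         + - / mu * kernel_up k (fst s))%C) by (intros; ring).
    rewrite (mean_plus _ _ HE (fun s => conv (fun j => M0 (weight j)) (fun j => kernel j (fst s)) k)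
       (fun s => - / mu * kernel_up k (fst s))%C).
    rewrite (mean_scal _ _ HE (- / mu)%C (fun s => kernel_up k (fst s))).
    unfold conv. rewrite (mean_Csum _ _ HE (fun j s => M0 (weight j) * kernel (k - j) (fst s))%C).
    rewrite (Csum_ext _ (fun j => M0 (weight j) * E (fun s => kernel (k - j) (fst s)))%C).
    - ring.
    - intros j _. apply (mean_scal _ _ HE). }
  set (Q := (conv (fun j => M0 (weight j)) (fun j => E (fun s => kernel j (fst s))) k
       - / mu * E (fun s => kernel_up k (fst s)))%C) in *.
  assert (HQ : Cmod (E W) <= eps / 2 * d + B * d ^ 2).
  { replace (E W) with ((E (chain_step (d / mu) d tst) - E tst) - (E (chain_step (d / mu) d tst) - (E tst + E W)))%C by ring.
    eapply Rle_trans; [ apply Cmod_sub_le |]. lra. }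
  rewrite EW, Cmod_mult, Cmod_R_pos in HQ by lra.
  assert (HQ2 : Cmod Q <= eps).
  { apply Rmult_le_reg_l with d; auto. nra. }
  assert (Hmu0 : RtoC mu <> 0) by (apply RtoC_neq_0; lra).
  replace (E (fun s => kernel_up k (fst s)) - mu * conv (fun j => M0 (weight j)) (fun j => E (fun s => kernel j (fst s))) k)%C
    with (- (mu * Q))%C by (unfold Q; field; auto).
  rewrite Cmod_opp, Cmod_mult, Cmod_R_pos by lra. assert (H := Cmod_ge_0 Q). nra.
Qed.

End Disk.
End Kernels.

(** * Complex power series in the unit disk *)

Definition Cser (u : nat -> C) (l : C) : Prop :=
  forall eps, 0 < eps -> exists N, forall n, (N <= n)%nat -> Cmod (Csum u n - l) <= eps.

Lemma Cser_unique (u : nat -> C) (l m : C) : Cser u l -> Cser u m -> l = m.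
Proof.
  intros Hl Hm. apply Ceq_minus, Cmod_eq_0. apply Rle_antisym; [| apply Cmod_ge_0 ].
  apply Rnot_lt_le. intros H.
  destruct (Hl (Cmod (l - m) / 4) ltac:(lra)) as [N1 H1].
  destruct (Hm (Cmod (l - m) / 4) ltac:(lra)) as [N2 H2].
  specialize (H1 (max N1 N2) ltac:(lia)). specialize (H2 (max N1 N2) ltac:(lia)).
  assert (H3 := Cmod_sub_le (Csum u (max N1 N2) - m) (Csum u (max N1 N2) - l)).
  replace (Csum u (max N1 N2) - m - (Csum u (max N1 N2) - l))%C with (l - m)%C in H3 by ring. lra.
Qed.

Lemma Csum_sum_n (u : nat -> C) (n : nat) :
  sum_n (G := C_AbelianMonoid) u n = Csum u (S n).
Proof.
  induction n as [|n IH].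
  - rewrite sum_O. simpl. ring.
  - rewrite sum_Sn, IH. reflexivity.
Qed.

Lemma is_series_Cser (u : nat -> C) (l : C) :
  is_series (K := C_AbsRing) (V := C_NormedModule) u l -> Cser u l.
Proof.
  intros H eps He.
  assert (He2 : 0 < eps / 2) by lra.
  destruct (H (ball l (mkposreal _ He2)) (locally_ball l (mkposreal _ He2))) as [N HN].
  exists (S N). intros n Hn. destruct n as [|n]; [ lia |].
  specialize (HN n ltac:(lia)).
  assert (Hs := C_NormedModule_mixin_compat2 l _ _ HN). simpl in Hs.
  change (Cmod (sum_n (G := C_AbelianMonoid) u n - l) < sqrt 2 * (eps / 2)) in Hs.
  rewrite Csum_sum_n in Hs.
  assert (Hq : sqrt 2 <= 2).
  { rewrite <- (sqrt_Rsqr 2) at 2 by lra. apply sqrt_le_1_alt. unfold Rsqr. lra. }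
  nra.
Qed.

Lemma Rsum_nonneg (v : nat -> R) (n : nat) : (forall k, 0 <= v k) -> 0 <= Rsum v n.
Proof. intros H. induction n; simpl; [ lra |]. specialize (H n). lra. Qed.

Lemma Rsum_scal (c : R) (u : nat -> R) (n : nat) : Rsum (fun k => c * u k) n = c * Rsum u n.
Proof. induction n as [|n IH]; simpl; [ ring | rewrite IH; ring ]. Qed.

Lemma Rsum_sum_n (u : nat -> R) (n : nat) : sum_n u n = Rsum u (S n).
Proof.
  induction n as [|n IH].
  - rewrite sum_O. simpl. ring.
  - rewrite sum_Sn, IH. reflexivity.
Qed.

Lemma Cser_dominated (u : nat -> C) (v : nat -> R) (B : R) :
  (forall k, Cmod (u k) <= v k) -> (forall n, Rsum v n <= B) -> exists l, Cser u l.
Proof.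
  intros Huv HB.
  assert (Hv : ex_series v).
  { assert (Hf : ex_finite_lim_seq (sum_n v)).
    { apply ex_finite_lim_seq_incr with B.
      - intros n. rewrite !Rsum_sum_n. change (Rsum v (S (S n))) with (Rsum v (S n) + v (S n)).
        assert (H := Huv (S n)). assert (H1 := Cmod_ge_0 (u (S n))). lra.
      - intros n. rewrite Rsum_sum_n. apply HB. }
    destruct Hf as [l Hl]. exists l. exact Hl. }
  destruct (ex_series_le (V := C_CompleteNormedModule) u v) as [l Hl]; auto.
  exists l. apply is_series_Cser. exact Hl.
Qed.

Lemma Cser_bound (u : nat -> C) (l : C) (B : R) : Cser u l ->
  (forall n, Cmod (Csum u n) <= B) -> Cmod l <= B.
Proof.
  intros H HB. apply Rnot_lt_le. intros Hlt.
  destruct (H ((Cmod l - B) / 2) ltac:(lra)) as [N HN].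
  specialize (HN N (le_n N)). specialize (HB N).
  assert (H1 := Cmod_triangle_sub l (l - Csum u N)).
  replace (l - (l - Csum u N))%C with (Csum u N) in H1 by ring.
  rewrite Cmod_sub_sym in HN. lra.
Qed.

Lemma Cser_plus (u v : nat -> C) (l m : C) : Cser u l -> Cser v m ->
  Cser (fun k => u k + v k)%C (l + m).
Proof.
  intros H1 H2 eps He.
  destruct (H1 (eps / 2) ltac:(lra)) as [N1 HN1]. destruct (H2 (eps / 2) ltac:(lra)) as [N2 HN2].
  exists (max N1 N2). intros n Hn. rewrite Csum_plus.
  replace (Csum u n + Csum v n - (l + m))%C with ((Csum u n - l) + (Csum v n - m))%C by ring.
  eapply Rle_trans; [ apply Cmod_triangle |].
  specialize (HN1 n ltac:(lia)). specialize (HN2 n ltac:(lia)). lra.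
Qed.

Lemma Cser_scal (c : C) (u : nat -> C) (l : C) : Cser u l -> Cser (fun k => c * u k)%C (c * l).
Proof.
  intros H eps He. assert (Hc := Cmod_ge_0 c).
  destruct (H (eps / (Cmod c + 1))) as [N HN]; [ apply Rdiv_lt_0_compat; lra |].
  exists N. intros n Hn. rewrite Csum_scal.
  replace (c * Csum u n - c * l)%C with (c * (Csum u n - l))%C by ring. rewrite Cmod_mult.
  specialize (HN n Hn).
  apply Rle_trans with ((Cmod c + 1) * (eps / (Cmod c + 1))).
  - apply Rmult_le_compat; try apply Cmod_ge_0; lra.
  - right; field; lra.
Qed.

Lemma Cser_ext (u v : nat -> C) (l : C) : (forall k, u k = v k) -> Cser u l -> Cser v l.
Proof.
  intros H Hu eps He. destruct (Hu eps He) as [N HN]. exists N. intros n Hn.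
  rewrite <- (Csum_ext u v); auto.
Qed.

Lemma Cser_shift1 (u : nat -> C) (l : C) : Cser (fun k => u (S k)) l -> Cser u (u O + l)%C.
Proof.
  intros H eps He. destruct (H eps He) as [N HN]. exists (S N). intros n Hn.
  destruct n as [|n]; [ lia |]. rewrite Csum_shift.
  replace (u O + Csum (fun k => u (S k)) n - (u O + l))%C with (Csum (fun k => u (S k)) n - l)%C by ring.
  apply HN. lia.
Qed.

Definition Cseries (u : nat -> C) : C :=
  (real (Lim_seq (fun n => Re (Csum u n))), real (Lim_seq (fun n => Im (Csum u n)))).

Lemma Cseries_eq (u : nat -> C) (l : C) : Cser u l -> Cseries u = l.
Proof.
  intros H. unfold Cseries. apply C_ext; simpl.
  - rewrite (is_lim_seq_unique _ (Finite (Re l))); auto.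
    apply is_lim_seq_Reals. intros eps He. destruct (H (eps / 2) ltac:(lra)) as [N HN].
    exists N. intros n Hn. specialize (HN n Hn). unfold Rdist.
    assert (H1 := re_le_Cmod (Csum u n - l)).
    replace (Re (Csum u n - l)) with (Re (Csum u n) - Re l) in H1 by (destruct (Csum u n), l; simpl; ring). lra.
  - rewrite (is_lim_seq_unique _ (Finite (Im l))); auto.
    apply is_lim_seq_Reals. intros eps He. destruct (H (eps / 2) ltac:(lra)) as [N HN].
    exists N. intros n Hn. specialize (HN n Hn). unfold Rdist.
    assert (H1 := im_le_Cmod (Csum u n - l)).
    replace (Im (Csum u n - l)) with (Im (Csum u n) - Im l) in H1 by (destruct (Csum u n), l; simpl; ring). lra.
Qed.

(** Coefficient sequences whose power series converges in the unit disk. *)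
Definition adm (a : nat -> C) : Prop :=
  forall s, 0 <= s < 1 -> exists B, forall k, Cmod (a k) * s ^ k <= B.

Definition Cps (a : nat -> C) (z : C) : C := Cseries (fun k => a k * z ^ k)%C.

Lemma Cser_terms_bounded (u : nat -> C) (l : C) : Cser u l -> exists B, forall k, Cmod (u k) <= B.
Proof.
  intros H. destruct (H 1 Rlt_0_1) as [N HN].
  assert (Hfin : forall n, exists B, forall k, (k < n)%nat -> Cmod (u k) <= B).
  { induction n as [|n [B HB]].
    - exists 0. intros; lia.
    - exists (Rmax B (Cmod (u n))). intros k Hk. destruct (Nat.eq_dec k n) as [->|Hne].
      + apply Rmax_r.
      + eapply Rle_trans; [ apply HB; lia | apply Rmax_l ]. }
  destruct (Hfin N) as [B HB]. exists (Rmax B 2). intros k.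
  destruct (Nat.lt_ge_cases k N) as [Hk|Hk].
  - eapply Rle_trans; [ apply HB; auto | apply Rmax_l ].
  - eapply Rle_trans; [| apply Rmax_r ].
    assert (H1 := HN k Hk). assert (H2 := HN (S k) ltac:(lia)).
    replace (u k) with ((Csum u (S k) - l) - (Csum u k - l))%C by (simpl; ring).
    eapply Rle_trans; [ apply Cmod_sub_le | lra ].
Qed.

Lemma adm_of_series (a : nat -> C) (f : C -> C) :
  (forall z, Cmod z < 1 -> Cser (fun k => a k * z ^ k)%C (f z)) -> adm a.
Proof.
  intros H s Hs. destruct (Cser_terms_bounded _ _ (H (RtoC s) ltac:(rewrite Cmod_R_pos; lra))) as [B HB].
  exists B. intros k. specialize (HB k).
  rewrite Cmod_mult, Cmod_pow, Cmod_R_pos in HB by lra. exact HB.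
Qed.

Section Geometric.
Context (q : R) (Hq : 0 <= q < 1).

Lemma Rsum_geom (n : nat) : Rsum (fun k => q ^ k) n <= / (1 - q).
Proof.
  assert (E : (1 - q) * Rsum (fun k => q ^ k) n = 1 - q ^ n).
  { induction n as [|n IH]; simpl; [ ring |]. rewrite Rmult_plus_distr_l, IH. ring. }
  assert (H := pow_le q n ltac:(lra)).
  apply Rmult_le_reg_l with (1 - q); [ lra |]. rewrite Rinv_r by lra. lra.
Qed.

Lemma Rsum_geom1 (n : nat) : Rsum (fun k => INR k * q ^ k) n <= / (1 - q) * / (1 - q).
Proof.
  assert (E : (1 - q) * Rsum (fun k => INR k * q ^ k) n = q * Rsum (fun k => q ^ k) n - INR n * q ^ n).
  { induction n as [|n IH]; [ simpl; ring |]. cbn [Rsum].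
    rewrite Rmult_plus_distr_l, IH, S_INR. simpl. ring. }
  assert (H := pow_le q n ltac:(lra)). assert (H1 := pos_INR n). assert (H2 := Rsum_geom n).
  assert (H3 : 0 < / (1 - q)) by (apply Rinv_0_lt_compat; lra).
  assert (H4 := Rsum_nonneg (fun k => q ^ k) n ltac:(intros; apply pow_le; lra)).
  apply Rmult_le_reg_l with (1 - q); [ lra |].
  rewrite <- Rmult_assoc, Rinv_r, Rmult_1_l by lra. nra.
Qed.

Lemma Rsum_geom2 (n : nat) : Rsum (fun k => INR k ^ 2 * q ^ k) n <= 3 * (/ (1 - q)) ^ 3.
Proof.
  assert (E : (1 - q) * Rsum (fun k => INR k ^ 2 * q ^ k) n
     = q * (2 * Rsum (fun k => INR k * q ^ k) n + Rsum (fun k => q ^ k) n) - INR n ^ 2 * q ^ n).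
  { induction n as [|n IH]; [ simpl; ring |]. cbn [Rsum].
    rewrite Rmult_plus_distr_l, IH, S_INR. simpl. ring. }
  assert (H := pow_le q n ltac:(lra)). assert (H1 := pow2_ge_0 (INR n)).
  assert (H2 := Rsum_geom n). assert (H3 := Rsum_geom1 n).
  assert (H4 : 1 <= / (1 - q)).
  { apply Rmult_le_reg_l with (1 - q); [ lra |]. rewrite Rinv_r; lra. }
  set (g := / (1 - q)) in *.
  assert (Hg : (1 - q) * g = 1) by (unfold g; field; lra).
  assert (H5 := Rsum_nonneg (fun k => q ^ k) n ltac:(intros; apply pow_le; lra)).
  assert (H6 := Rsum_nonneg (fun k => INR k * q ^ k) n
     ltac:(intros; apply Rmult_le_pos; [ apply pos_INR | apply pow_le; lra ])).
  assert (H7 : 2 * Rsum (fun k => INR k * q ^ k) n + Rsum (fun k => q ^ k) n <= 3 * g ^ 2) by nra.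
  apply Rmult_le_reg_l with (1 - q); [ lra |].
  replace ((1 - q) * (3 * g ^ 3)) with (((1 - q) * g) * (3 * g ^ 2)) by ring. rewrite Hg. nra.
Qed.

End Geometric.

(** Boundedness at a radius strictly between [r] and [1] gives geometric decay at [r]. *)
Lemma adm_majorant (a : nat -> C) (r : R) : adm a -> 0 < r < 1 ->
  exists B q, 0 <= B /\ 0 <= q < 1 /\ forall k, Cmod (a k) * r ^ k <= B * q ^ k.
Proof.
  intros Ha Hr. set (s := (1 + r) / 2). assert (Hs : r < s < 1) by (unfold s; lra).
  destruct (Ha s ltac:(lra)) as [B HB].
  assert (HB0 : 0 <= B).
  { specialize (HB O). simpl in HB. assert (H := Cmod_ge_0 (a O)). lra. }
  assert (Hq : 0 <= r / s < 1).
  { split; [ apply Rmult_le_pos; [ lra | left; apply Rinv_0_lt_compat; lra ] |].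
    apply Rmult_lt_reg_r with s; [ lra |]. unfold Rdiv. rewrite Rmult_assoc, Rinv_l; lra. }
  exists B, (r / s). repeat split; try apply Hq; auto. intros k.
  replace (Cmod (a k) * r ^ k) with (Cmod (a k) * s ^ k * (r / s) ^ k).
  - apply Rmult_le_compat_r; [ apply pow_le; lra | apply HB ].
  - unfold Rdiv. rewrite Rpow_mult_distr, pow_inv. field. apply pow_nonzero. lra.
Qed.

Lemma radius_between (z : C) : Cmod z < 1 -> exists r, 0 < r < 1 /\ Cmod z < r.
Proof.
  intros H. exists ((1 + Cmod z) / 2). assert (H0 := Cmod_ge_0 z). lra.
Qed.

Lemma Cps_correct (a : nat -> C) (z : C) : adm a -> Cmod z < 1 ->
  Cser (fun k => a k * z ^ k)%C (Cps a z).
Proof.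
  intros Ha Hz. destruct (radius_between z Hz) as [r [Hr Hzr]].
  destruct (adm_majorant a r Ha Hr) as [B [q [HB [Hq HM]]]].
  destruct (Cser_dominated (fun k => a k * z ^ k)%C (fun k => B * q ^ k) (B * / (1 - q))) as [l Hl].
  - intros k. rewrite Cmod_mult, Cmod_pow. eapply Rle_trans; [| apply HM ].
    apply Rmult_le_compat_l; [ apply Cmod_ge_0 |]. apply pow_incr.
    split; [ apply Cmod_ge_0 | lra ].
  - intros n. rewrite Rsum_scal. apply Rmult_le_compat_l; auto. apply Rsum_geom; auto.
  - unfold Cps. rewrite (Cseries_eq _ l Hl). exact Hl.
Qed.

Definition shift (n : nat) (a : nat -> C) (k : nat) : C := a (n + k)%nat.
Definition times_index (a : nat -> C) (k : nat) : C := (INR k * a k)%C.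

Lemma adm_shift1 (a : nat -> C) : adm a -> adm (shift 1 a).
Proof.
  intros Ha s Hs. destruct (Req_dec s 0) as [->|Hs0].
  - exists (Cmod (a 1%nat)). intros k. unfold shift. destruct k; simpl; [ lra |].
    rewrite Rmult_0_l, Rmult_0_r. apply Cmod_ge_0.
  - destruct (Ha s Hs) as [B HB]. exists (B / s). intros k. specialize (HB (S k)).
    unfold shift. change (1 + k)%nat with (S k). apply Rmult_le_reg_r with s; [ lra |].
    unfold Rdiv. rewrite (Rmult_assoc B), Rinv_l by lra. simpl in HB. lra.
Qed.

Lemma adm_shift (n : nat) (a : nat -> C) : adm a -> adm (shift n a).
Proof.
  intros Ha. induction n as [|n IH]; [ exact Ha |].
  intros s Hs. destruct (adm_shift1 _ IH s Hs) as [B HB]. exists B. intros k.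
  specialize (HB k). unfold shift in *. replace (S n + k)%nat with (n + (1 + k))%nat by lia. exact HB.
Qed.

Lemma adm_times_index (a : nat -> C) : adm a -> adm (times_index a).
Proof.
  intros Ha s Hs. destruct (Req_dec s 0) as [->|Hs0].
  - exists 0. intros k. unfold times_index. destruct k.
    + simpl. rewrite Cmult_0_l, Cmod_0. lra.
    + simpl. rewrite Rmult_0_l, Rmult_0_r. lra.
  - destruct (adm_majorant a s Ha ltac:(lra)) as [B [q [HB [Hq HM]]]].
    exists (B * (/ (1 - q) * / (1 - q))). intros k. unfold times_index.
    rewrite Cmod_mult, Cmod_R_pos, Rmult_assoc by apply pos_INR.
    apply Rle_trans with (B * (INR k * q ^ k)).
    + assert (H := Rmult_le_compat_l _ _ _ (pos_INR k) (HM k)). lra.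
    + apply Rmult_le_compat_l; auto.
      eapply Rle_trans; [| apply (Rsum_geom1 q Hq (S k)) ]. cbn [Rsum].
      assert (H := Rsum_nonneg (fun k => INR k * q ^ k) k
        ltac:(intros; apply Rmult_le_pos; [ apply pos_INR | apply pow_le; lra ])). lra.
Qed.

Lemma Cps_shift1 (a : nat -> C) (z : C) : adm a -> Cmod z < 1 ->
  Cps a z = (a O + z * Cps (shift 1 a) z)%C.
Proof.
  intros Ha Hz. apply (Cser_unique (fun k => a k * z ^ k)%C); [ apply Cps_correct; auto |].
  replace (a O) with (a O * z ^ 0)%C by (simpl; ring).
  apply (Cser_shift1 (fun k => a k * z ^ k)%C).
  eapply Cser_ext; [| apply (Cser_scal z), (Cps_correct _ z (adm_shift1 a Ha) Hz) ].
  intros k. unfold shift. simpl. ring.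
Qed.

Lemma Cps_shift (n : nat) (a : nat -> C) (z : C) : adm a -> Cmod z < 1 ->
  Cps a z = (Csum (fun k => a k * z ^ k) n + z ^ n * Cps (shift n a) z)%C.
Proof.
  intros Ha Hz. induction n as [|n IH].
  - simpl. change (shift 0 a) with a. ring.
  - rewrite IH, (Cps_shift1 (shift n a)) by (auto; apply adm_shift; auto).
    replace (Cps (shift 1 (shift n a)) z) with (Cps (shift (S n) a) z).
    + unfold shift at 1. rewrite Nat.add_0_r. simpl. ring.
    + unfold Cps at 1. apply Cseries_eq.
      eapply Cser_ext; [| apply (Cps_correct _ z (adm_shift1 _ (adm_shift n a Ha)) Hz) ].
      intros k. unfold shift. replace (S n + k)%nat with (n + (1 + k))%nat by lia. reflexivity.
Qed.

Lemma Cps_at_0 (a : nat -> C) : adm a -> Cps a 0 = a O.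
Proof. intros Ha. rewrite Cps_shift1 by (auto; rewrite Cmod_0; lra). ring. Qed.

Lemma pow_taylor (k : nat) (z w : C) (r : R) : 0 < r -> Cmod z <= r -> Cmod w <= r ->
  Cmod (w ^ k - z ^ k - INR k * z ^ pred k * (w - z)) * r ^ 2 <= INR k ^ 2 * r ^ k * Cmod (w - z) ^ 2.
Proof.
  intros Hr Hz Hw.
  assert (Hlip : forall k, Cmod (w ^ k - z ^ k) * r <= INR k * r ^ k * Cmod (w - z)).
  { induction k0 as [|n IH].
    - simpl. replace (1 - 1)%C with (RtoC 0) by ring. rewrite Cmod_0. lra.
    - replace (w ^ S n - z ^ S n)%C with (w * (w ^ n - z ^ n) + (w - z) * z ^ n)%C by (simpl; ring).
      assert (H1 := Cmod_triangle (w * (w ^ n - z ^ n)) ((w - z) * z ^ n)).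
      rewrite !Cmod_mult, Cmod_pow in H1.
      assert (H2 : Cmod z ^ n <= r ^ n) by (apply pow_incr; split; auto; apply Cmod_ge_0).
      rewrite S_INR. simpl.
      assert (H3 := Cmod_ge_0 (w ^ n - z ^ n)). assert (H4 := Cmod_ge_0 (w - z)).
      assert (H5 : Cmod w * (Cmod (w ^ n - z ^ n) * r) <= r * (INR n * r ^ n * Cmod (w - z))).
      { apply Rmult_le_compat; auto using Cmod_ge_0. nra. }
      assert (H6 : Cmod (w - z) * Cmod z ^ n * r <= Cmod (w - z) * r ^ n * r).
      { apply Rmult_le_compat_r; [ lra |]. apply Rmult_le_compat_l; auto. }
      nra. }
  induction k as [|n IH].
  - simpl. replace (1 - 1 - 0 * 1 * (w - z))%C with (RtoC 0) by ring. rewrite Cmod_0. lra.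
  - replace (w ^ S n - z ^ S n - INR (S n) * z ^ pred (S n) * (w - z))%C
      with (z * (w ^ n - z ^ n - INR n * z ^ pred n * (w - z)) + (w - z) * (w ^ n - z ^ n))%C.
    2:{ rewrite S_INR, RtoC_plus. destruct n; simpl; ring. }
    assert (H1 := Cmod_triangle (z * (w ^ n - z ^ n - INR n * z ^ pred n * (w - z))) ((w - z) * (w ^ n - z ^ n))).
    rewrite !Cmod_mult in H1.
    set (T := Cmod (w ^ n - z ^ n - INR n * z ^ pred n * (w - z))) in *.
    set (L := Cmod (w ^ n - z ^ n)) in *. specialize (Hlip n). fold L in Hlip.
    assert (HT : 0 <= T) by apply Cmod_ge_0. assert (HL : 0 <= L) by apply Cmod_ge_0.
    set (D := Cmod (w - z)) in *. assert (HD : 0 <= D) by apply Cmod_ge_0.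
    assert (H2 : Cmod z * (T * r ^ 2) <= r * (INR n ^ 2 * r ^ n * D ^ 2)).
    { apply Rmult_le_compat; auto using Cmod_ge_0. apply Rmult_le_pos; auto. apply pow2_ge_0. }
    assert (H3 : D * r * (L * r) <= D * r * (INR n * r ^ n * D)) by (apply Rmult_le_compat_l; nra).
    rewrite S_INR. simpl (r ^ S n).
    assert (H4 := pos_INR n). assert (H5 := pow_lt r n Hr).
    assert (H6 : 0 <= (INR n + 1) * (r * r ^ n * D ^ 2)).
    { apply Rmult_le_pos; [ lra |]. apply Rmult_le_pos; [ nra | apply pow2_ge_0 ]. }
    nra.
Qed.

Definition Cps' (a : nat -> C) (z : C) : C := Cps (shift 1 (times_index a)) z.

Lemma adm_derivative (a : nat -> C) : adm a -> adm (shift 1 (times_index a)).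
Proof. intros. apply adm_shift1, adm_times_index; auto. Qed.

Lemma times_index_Cps (a : nat -> C) (z : C) : adm a -> Cmod z < 1 ->
  Cps (times_index a) z = (z * Cps' a z)%C.
Proof.
  intros Ha Hz. rewrite Cps_shift1 by (auto; apply adm_times_index; auto).
  unfold times_index at 1. simpl. unfold Cps'. ring.
Qed.

(** The second order remainders of the monomials, weighted by the coefficients, are
    dominated by the series of [k^2 q^k]. *)
Lemma cderiv_Cps (a : nat -> C) (z : C) : adm a -> Cmod z < 1 -> cderiv (Cps a) z (Cps' a z).
Proof.
  intros Ha Hz. destruct (radius_between z Hz) as [r [Hr Hzr]].
  destruct (adm_majorant a r Ha Hr) as [B [q [HB [Hq HM]]]].
  apply cderiv_quad with (r - Cmod z) (B * (3 * (/ (1 - q)) ^ 3) / r ^ 2); [ lra |].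
  intros w Hw.
  assert (Hwr : Cmod w < r).
  { assert (H := Cmod_triangle (w - z) z). replace (w - z + z)%C with w in H by ring. lra. }
  assert (Hr2 : 0 < r ^ 2) by (apply pow_lt; lra).
  assert (Hd : Cser (fun k => a k * (INR k * z ^ pred k))%C (Cps' a z)).
  { replace (Cps' a z) with (a O * (INR 0 * z ^ pred 0) + Cps' a z)%C by (simpl; ring).
    apply (Cser_shift1 (fun k => a k * (INR k * z ^ pred k))%C).
    eapply Cser_ext; [| apply (Cps_correct _ z (adm_derivative a Ha) Hz) ].
    intros k. unfold shift, times_index. change (1 + k)%nat with (S k). simpl pred. ring. }
  assert (HS : Cser (fun k => a k * (w ^ k - z ^ k - INR k * z ^ pred k * (w - z)))%C
     (Cps a w - Cps a z - Cps' a z * (w - z))%C).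
  { replace (Cps a w - Cps a z - Cps' a z * (w - z))%C
      with (Cps a w + (- (1) * Cps a z + - (w - z) * Cps' a z))%C by ring.
    eapply Cser_ext; [| apply Cser_plus; [ apply (Cps_correct a w Ha ltac:(lra))
      | apply Cser_plus; [ apply (Cser_scal (- (1))%C _ _ (Cps_correct a z Ha Hz)) | apply (Cser_scal (- (w - z))%C _ _ Hd) ] ] ].
    intros k. cbv beta. ring. }
  apply (Cser_bound _ _ _ HS). intros n.
  eapply Rle_trans.
  - apply (Cmod_Csum_le _ (fun k => Cmod (w - z) ^ 2 / r ^ 2 * B * (INR k ^ 2 * q ^ k))).
    intros k _. rewrite Cmod_mult.
    assert (H := pow_taylor k z w r ltac:(lra) ltac:(lra) ltac:(lra)).
    apply Rmult_le_reg_r with (r ^ 2); auto.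
    apply Rle_trans with (Cmod (a k) * (INR k ^ 2 * r ^ k * Cmod (w - z) ^ 2)).
    + rewrite Rmult_assoc. apply Rmult_le_compat_l; [ apply Cmod_ge_0 | exact H ].
    + replace (Cmod (w - z) ^ 2 / r ^ 2 * B * (INR k ^ 2 * q ^ k) * r ^ 2)
        with ((INR k ^ 2 * Cmod (w - z) ^ 2) * (B * q ^ k)) by (field; lra).
      replace (Cmod (a k) * (INR k ^ 2 * r ^ k * Cmod (w - z) ^ 2))
        with ((INR k ^ 2 * Cmod (w - z) ^ 2) * (Cmod (a k) * r ^ k)) by ring.
      apply Rmult_le_compat_l; [| apply HM ]. apply Rmult_le_pos; apply pow2_ge_0.
  - rewrite Rsum_scal.
    replace (B * (3 * (/ (1 - q)) ^ 3) / r ^ 2 * Cmod (w - z) ^ 2)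
      with (Cmod (w - z) ^ 2 / r ^ 2 * B * (3 * (/ (1 - q)) ^ 3)) by (unfold Rdiv; ring).
    apply Rmult_le_compat_l; [| apply Rsum_geom2; auto ].
    apply Rmult_le_pos; auto. apply Rmult_le_pos; [ apply pow2_ge_0 |].
    left. apply Rinv_0_lt_compat; auto.
Qed.

(** * Circle means of analytic functions *)

Definition C1_disk (G : C -> C) : Prop :=
  exists G' : C -> C, forall z, Cmod z < 1 -> cderiv G z (G' z) /\ ccont G' z.

Lemma ccont_mult (f g : C -> C) (z : C) : ccont f z -> ccont g z -> ccont (fun w => f w * g w)%C z.
Proof.
  intros Hf Hg eps He.
  assert (H1 := Cmod_ge_0 (f z)). assert (H2 := Cmod_ge_0 (g z)).
  set (e := Rmin 1 (eps / (2 * (Cmod (f z) + Cmod (g z) + 2)))).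
  assert (He1 : 0 < e) by (apply Rmin_glb_lt; [ lra | apply Rdiv_lt_0_compat; lra ]).
  assert (He2 : e <= 1) by apply Rmin_l.
  assert (He3 : e * (Cmod (f z) + Cmod (g z) + 2) <= eps / 2).
  { apply Rle_trans with (eps / (2 * (Cmod (f z) + Cmod (g z) + 2)) * (Cmod (f z) + Cmod (g z) + 2)).
    - apply Rmult_le_compat_r; [ lra | apply Rmin_r ].
    - right; field; lra. }
  destruct (Hf e He1) as [d1 [Hd1 F]]. destruct (Hg e He1) as [d2 [Hd2 G]].
  exists (Rmin d1 d2). split; [ apply Rmin_glb_lt; auto |]. intros w Hw.
  specialize (F w (Rlt_le_trans _ _ _ Hw (Rmin_l _ _))).
  specialize (G w (Rlt_le_trans _ _ _ Hw (Rmin_r _ _))).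
  replace (f w * g w - f z * g z)%C with ((f w - f z) * (g w - g z) + (f w - f z) * g z + f z * (g w - g z))%C by ring.
  eapply Rle_lt_trans; [ apply Cmod_triangle |].
  eapply Rle_lt_trans; [ apply Rplus_le_compat_r, Cmod_triangle |]. rewrite !Cmod_mult.
  assert (F0 := Cmod_ge_0 (f w - f z)). assert (G0 := Cmod_ge_0 (g w - g z)).
  assert (X1 : Cmod (f w - f z) * Cmod (g w - g z) <= e * 1) by (apply Rmult_le_compat; lra).
  assert (X2 : Cmod (f w - f z) * Cmod (g z) <= e * Cmod (g z)) by (apply Rmult_le_compat_r; lra).
  assert (X3 : Cmod (f z) * Cmod (g w - g z) <= Cmod (f z) * e) by (apply Rmult_le_compat_l; lra).
  nra.
Qed.

Lemma ccont_plus (f g : C -> C) (z : C) : ccont f z -> ccont g z -> ccont (fun w => f w + g w)%C z.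
Proof.
  intros Hf Hg eps He.
  destruct (Hf (eps / 2) ltac:(lra)) as [d1 [Hd1 F]]. destruct (Hg (eps / 2) ltac:(lra)) as [d2 [Hd2 G]].
  exists (Rmin d1 d2). split; [ apply Rmin_glb_lt; auto |]. intros w Hw.
  specialize (F w (Rlt_le_trans _ _ _ Hw (Rmin_l _ _))).
  specialize (G w (Rlt_le_trans _ _ _ Hw (Rmin_r _ _))).
  replace (f w + g w - (f z + g z))%C with ((f w - f z) + (g w - g z))%C by ring.
  eapply Rle_lt_trans; [ apply Cmod_triangle | lra ].
Qed.

Lemma C1_cont (G : C -> C) (z : C) : C1_disk G -> Cmod z < 1 -> ccont G z.
Proof. intros [G' H] Hz. eapply cderiv_cont. apply H; auto. Qed.

Lemma ccont_const (c z : C) : ccont (fun _ => c) z.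
Proof. eapply cderiv_cont, cderiv_const. Qed.

Lemma C1_mult (f g : C -> C) : C1_disk f -> C1_disk g -> C1_disk (fun z => f z * g z)%C.
Proof.
  intros Hf Hg. assert (Cf := fun z => C1_cont f z Hf). assert (Cg := fun z => C1_cont g z Hg).
  destruct Hf as [f' Hf], Hg as [g' Hg].
  exists (fun z => f' z * g z + f z * g' z)%C. intros z Hz.
  destruct (Hf z Hz), (Hg z Hz). split; [ apply cderiv_mult; auto |].
  apply ccont_plus; apply ccont_mult; auto.
Qed.

Lemma C1_inv (g : C -> C) : C1_disk g -> (forall z, Cmod z < 1 -> g z <> 0) -> C1_disk (fun z => / g z)%C.
Proof.
  intros Hg Hn. assert (Cg := fun z => C1_cont g z Hg). destruct Hg as [g' Hg].
  exists (fun z => - (/ (g z * g z)) * g' z)%C. intros z Hz. destruct (Hg z Hz) as [H1 H2].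
  assert (Hi := cderiv_comp (fun u => / u)%C g _ _ _ H1 (cderiv_inv _ (Hn z Hz))).
  split; auto. apply ccont_mult; auto.
  apply cderiv_cont in Hi.
  assert (Hc : ccont (fun w => - (1) * (/ g w * / g w))%C z)
    by (apply ccont_mult; [ apply ccont_const | apply ccont_mult; auto ]).
  intros eps He. destruct (Hc eps He) as [d [Hd Hw]].
  exists (Rmin d (1 - Cmod z)). split; [ apply Rmin_glb_lt; lra |]. intros w Hwz.
  assert (Hw1 : Cmod w < 1).
  { assert (Ht := Cmod_triangle (w - z) z). replace (w - z + z)%C with w in Ht by ring.
    assert (H3 := Rlt_le_trans _ _ _ Hwz (Rmin_r _ _)). lra. }
  specialize (Hw w (Rlt_le_trans _ _ _ Hwz (Rmin_l _ _))).
  replace (- / (g w * g w) - - / (g z * g z))%C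
    with (- (1) * (/ g w * / g w) - - (1) * (/ g z * / g z))%C; auto.
  field. auto.
Qed.

Lemma C1_Cps (a : nat -> C) : adm a -> C1_disk (Cps a).
Proof.
  intros Ha. exists (Cps' a). intros z Hz. split; [ apply cderiv_Cps; auto |].
  eapply cderiv_cont, cderiv_Cps; auto. apply adm_derivative; auto.
Qed.

Lemma C1_const (c : C) : C1_disk (fun _ => c).
Proof. exists (fun _ => RtoC 0). intros z _. split; [ apply cderiv_const | apply ccont_const ]. Qed.

Lemma C1_id : C1_disk (fun z => z).
Proof. exists (fun _ => RtoC 1). intros z _. split; [ apply cderiv_id | apply ccont_const ]. Qed.

Lemma C1_pow (n : nat) : C1_disk (fun z => z ^ n)%C.
Proof.
  induction n as [|n IH]; [ exact (C1_const 1) |].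
  apply (C1_mult (fun z => z) (fun z => z ^ n)%C); auto. apply C1_id.
Qed.

Definition cis (t : R) : C := Cexp (RtoC t * Ci).

Lemma cis_eq (t : R) : cis t = (cos t, sin t).
Proof.
  unfold cis, Cexp. rewrite re_scal_l, im_scal_l. simpl Re. simpl Im.
  rewrite Rmult_0_r, Rmult_1_r, exp_0, !Rmult_1_l. reflexivity.
Qed.

Lemma Cmod_cis (t : R) : Cmod (cis t) = 1.
Proof. unfold cis. rewrite Cmod_Cexp, re_mult_Ci, im_RtoC, Ropp_0, exp_0. reflexivity. Qed.

Lemma cis_lip (s t : R) : Cmod (cis t - cis s) <= Rabs (t - s).
Proof.
  unfold cis.
  replace (RtoC t * Ci)%C with (RtoC s * Ci + RtoC (t - s) * Ci)%C by (rewrite RtoC_minus; ring).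
  replace (Rabs (t - s)) with (Rabs (t - s) * 1 - Rabs (t - s) * 0) by ring.
  apply (majorant_bound Cexp (RtoC s * Ci) (RtoC (t - s) * Ci) Cexp (fun x => Rabs (t - s) * x) (fun _ => Rabs (t - s))).
  - intros; apply cderiv_Cexp.
  - intros x Hx. auto_derive; auto. ring.
  - intros x Hx. rewrite !Cmod_mult, Cmod_Cexp, Cmod_Ci, Cmod_R.
    replace (Re (s * Ci + x * (RtoC (t - s) * Ci))) with 0 by (simpl; ring).
    rewrite exp_0. lra.
Qed.

Lemma circle_in_disk (rho t : R) : Rabs rho < 1 -> Cmod (RtoC rho * cis t) < 1.
Proof. intros H. rewrite Cmod_mult, Cmod_cis, Cmod_R. lra. Qed.

Definition contC (f : R -> C) : Prop :=
  forall t, continuous (fun s => Re (f s)) t /\ continuous (fun s => Im (f s)) t.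

Lemma contC_intro (f : R -> C) :
  (forall t eps, 0 < eps -> exists del, 0 < del /\ forall s, Rabs (s - t) < del -> Cmod (f s - f t) < eps) ->
  contC f.
Proof.
  intros H t. split; apply continuity_pt_filterlim; intros eps He;
  destruct (H t eps He) as [d [Hd Hs]]; exists d; split; auto; intros s [_ Hst];
  specialize (Hs s Hst); simpl; unfold Rdist.
  - assert (H1 := re_le_Cmod (f s - f t)).
    replace (Re (f s - f t)) with (Re (f s) - Re (f t)) in H1 by (destruct (f s), (f t); simpl; ring). lra.
  - assert (H1 := im_le_Cmod (f s - f t)).
    replace (Im (f s - f t)) with (Im (f s) - Im (f t)) in H1 by (destruct (f s), (f t); simpl; ring). lra.
Qed.

Lemma contC_circle (G : C -> C) (rho : R) : 0 <= rho ->
  (forall t, ccont G (RtoC rho * cis t)) -> contC (fun t => G (RtoC rho * cis t)%C).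
Proof.
  intros Hr H. apply contC_intro. intros t eps He. destruct (H t eps He) as [d [Hd Hw]].
  exists (d / (rho + 1)). split; [ apply Rdiv_lt_0_compat; lra |]. intros s Hs. apply Hw.
  replace (rho * cis s - rho * cis t)%C with (rho * (cis s - cis t))%C by ring.
  rewrite Cmod_mult, Cmod_R_pos by auto.
  assert (H1 := cis_lip t s). assert (H2 := Rabs_pos (s - t)).
  apply Rle_lt_trans with (rho * Rabs (s - t)); [ apply Rmult_le_compat_l; auto |].
  apply Rle_lt_trans with ((rho + 1) * Rabs (s - t)); [ nra |].
  apply Rlt_le_trans with ((rho + 1) * (d / (rho + 1))); [ apply Rmult_lt_compat_l; lra | right; field; lra ].
Qed.

Lemma contC_mult (f g : R -> C) : contC f -> contC g -> contC (fun t => f t * g t)%C.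
Proof.
  intros Hf Hg t. destruct (Hf t) as [F1 F2], (Hg t) as [G1 G2].
  split.
  - apply (continuous_ext (fun s => minus (mult (Re (f s)) (Re (g s))) (mult (Im (f s)) (Im (g s))))).
    { intros s. rewrite re_mult. reflexivity. }
    apply (continuous_minus (V := R_NormedModule)); apply (continuous_mult (K := R_AbsRing)); auto.
  - apply (continuous_ext (fun s => plus (mult (Re (f s)) (Im (g s))) (mult (Im (f s)) (Re (g s))))).
    { intros s. rewrite im_mult. reflexivity. }
    apply (continuous_plus (V := R_NormedModule)); apply (continuous_mult (K := R_AbsRing)); auto.
Qed.

Lemma contC_plus (f g : R -> C) : contC f -> contC g -> contC (fun t => f t + g t)%C.
Proof.
  intros Hf Hg t. destruct (Hf t) as [F1 F2], (Hg t) as [G1 G2].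
  split.
  - apply (continuous_ext (fun s => plus (Re (f s)) (Re (g s)))); [ reflexivity |].
    apply (continuous_plus (V := R_NormedModule)); auto.
  - apply (continuous_ext (fun s => plus (Im (f s)) (Im (g s)))); [ reflexivity |].
    apply (continuous_plus (V := R_NormedModule)); auto.
Qed.

Lemma contC_const (c : C) : contC (fun _ => c).
Proof. intros t. split; apply continuous_const. Qed.

Lemma contC_conj (f : R -> C) : contC f -> contC (fun t => Cconj (f t)).
Proof.
  intros Hf t. destruct (Hf t) as [F1 F2]. split; auto.
  apply (continuous_ext (fun s => opp (Im (f s)))); [ reflexivity |].
  apply (continuous_opp (V := R_NormedModule)); auto.
Qed.

Lemma contC_Csum (u : nat -> R -> C) (n : nat) : (forall k, contC (u k)) ->
  contC (fun t => Csum (fun k => u k t) n).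
Proof.
  intros H. induction n as [|n IH]; [ exact (contC_const 0) |]. apply (contC_plus (fun t => Csum (fun k => u k t) n) (u n)); auto.
Qed.

Lemma PI2_pos : 0 < 2 * PI.
Proof. assert (H := PI_RGT_0). lra. Qed.

Definition circ_mean (f : R -> C) : C :=
  (RInt (fun t => Re (f t)) 0 (2 * PI) / (2 * PI), RInt (fun t => Im (f t)) 0 (2 * PI) / (2 * PI)).

Lemma ex_RInt_cont (f : R -> R) : (forall t, continuous f t) -> ex_RInt f 0 (2 * PI).
Proof. intros H. apply (ex_RInt_continuous (V := R_CompleteNormedModule)). auto. Qed.

Lemma circ_mean_plus (f g : R -> C) : contC f -> contC g ->
  circ_mean (fun t => f t + g t)%C = (circ_mean f + circ_mean g)%C.
Proof.
  intros Hf Hg. assert (Hp := PI2_pos). unfold circ_mean. apply C_ext; simpl.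
  - rewrite (RInt_ext _ (fun t => plus (Re (f t)) (Re (g t)))) by reflexivity.
    rewrite (RInt_plus (V := R_CompleteNormedModule)) by (apply ex_RInt_cont; intros; apply Hf || apply Hg).
    unfold plus; simpl. field. lra.
  - rewrite (RInt_ext _ (fun t => plus (Im (f t)) (Im (g t)))) by reflexivity.
    rewrite (RInt_plus (V := R_CompleteNormedModule)) by (apply ex_RInt_cont; intros; apply Hf || apply Hg).
    unfold plus; simpl. field. lra.
Qed.

Lemma RInt_lin (f g : R -> R) (x y : R) : (forall t, continuous f t) -> (forall t, continuous g t) ->
  RInt (fun t => x * f t + y * g t) 0 (2 * PI) = x * RInt f 0 (2 * PI) + y * RInt g 0 (2 * PI).
Proof.
  intros Hf Hg.
  rewrite (RInt_ext _ (fun t => plus (scal x (f t)) (scal y (g t)))) by reflexivity.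
  rewrite (RInt_plus (V := R_CompleteNormedModule)).
  - rewrite !(RInt_scal (V := R_CompleteNormedModule)) by (apply ex_RInt_cont; auto). reflexivity.
  - apply (ex_RInt_scal (V := R_CompleteNormedModule)), ex_RInt_cont; auto.
  - apply (ex_RInt_scal (V := R_CompleteNormedModule)), ex_RInt_cont; auto.
Qed.

Lemma circ_mean_scal (c : C) (f : R -> C) : contC f ->
  circ_mean (fun t => c * f t)%C = (c * circ_mean f)%C.
Proof.
  intros Hf. assert (Hp := PI2_pos). unfold circ_mean. apply C_ext; simpl.
  - rewrite (RInt_ext _ (fun t => Re c * Re (f t) + - Im c * Im (f t)))
      by (intros; destruct c, (f x); simpl; ring).
    rewrite RInt_lin by (intros; apply Hf). destruct c; simpl. field. lra.
  - rewrite (RInt_ext _ (fun t => Re c * Im (f t) + Im c * Re (f t)))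
      by (intros; destruct c, (f x); simpl; ring).
    rewrite RInt_lin by (intros; apply Hf). destruct c; simpl. field. lra.
Qed.

Lemma circ_mean_conj (f : R -> C) : contC f ->
  circ_mean (fun t => Cconj (f t)) = Cconj (circ_mean f).
Proof.
  intros Hf. assert (Hp := PI2_pos). unfold circ_mean. apply C_ext; simpl.
  - reflexivity.
  - rewrite (RInt_ext _ (fun t => -1 * Im (f t) + 0 * Im (f t))) by (intros; simpl; unfold Im; ring).
    rewrite RInt_lin by (intros; apply Hf). field. lra.
Qed.

Lemma circ_mean_ext (f g : R -> C) : (forall t, f t = g t) -> circ_mean f = circ_mean g.
Proof.
  intros H. unfold circ_mean. f_equal; f_equal; apply RInt_ext; intros; rewrite H; reflexivity.
Qed.

Lemma circ_mean_const (c : C) : circ_mean (fun _ => c) = c.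
Proof.
  assert (Hp := PI2_pos). unfold circ_mean. rewrite !RInt_const. unfold scal; simpl. unfold mult; simpl.
  apply C_ext; simpl; field; lra.
Qed.

Lemma circ_mean_Csum (c : nat -> C) (u : nat -> R -> C) (n : nat) : (forall k, contC (u k)) ->
  circ_mean (fun t => Csum (fun k => c k * u k t)%C n) = Csum (fun k => c k * circ_mean (u k))%C n.
Proof.
  intros H. assert (H2 : forall k, contC (fun t => c k * u k t)%C)
    by (intros k; apply contC_mult; [ apply contC_const | auto ]).
  induction n as [|n IH]; [ exact (circ_mean_const 0) |]. cbn [Csum].
  rewrite (circ_mean_plus (fun t => Csum (fun k => c k * u k t)%C n) (fun t => c n * u n t)%C); auto.
  - rewrite IH, circ_mean_scal; auto.
  - apply (contC_Csum (fun k t => c k * u k t)%C); auto.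
Qed.

Lemma is_derive_radius (G G' : C -> C) (u : C) (t v : R) :
  (forall z, Cmod z < 1 -> cderiv G z (G' z)) -> Rabs t < 1 ->
  is_derive (fun s => Re (u * G (RtoC s * cis v)%C)) t (Re (u * (G' (RtoC t * cis v)%C * cis v))%C).
Proof.
  intros HG Ht.
  assert (H := cderiv_line G 0 (cis v) (G' (RtoC t * cis v)%C) t u).
  rewrite Cplus_0_l in H. specialize (H (HG _ (circle_in_disk t v Ht))).
  eapply is_derive_ext; [| exact H ]. intros s. cbv beta. rewrite Cplus_0_l. reflexivity.
Qed.

Lemma is_derive_angle (G G' : C -> C) (u : C) (t v : R) :
  (forall z, Cmod z < 1 -> cderiv G z (G' z)) -> Rabs t < 1 ->
  is_derive (fun s => Re (- Ci * u * G (RtoC t * cis s)%C)) v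
    (t * Re (u * (G' (RtoC t * cis v)%C * cis v))%C).
Proof.
  intros HG Ht.
  assert (Hc : cderiv (fun z => G (t * Cexp z)%C) (0 + RtoC v * Ci) (G' (t * Cexp (0 + v * Ci)) * (t * Cexp (0 + v * Ci)))%C).
  { apply (cderiv_comp G (fun z => t * Cexp z)%C).
    - apply cderiv_scal, cderiv_Cexp.
    - apply HG. rewrite Cplus_0_l. apply circle_in_disk; auto. }
  assert (H := cderiv_line (fun z => G (t * Cexp z)%C) 0 Ci _ v (- Ci * u)%C Hc).
  rewrite Cplus_0_l in H.
  eapply is_derive_ext.
  2:{ evar_last; [ exact H |]. fold (cis v).
      rewrite <- re_scal_l. f_equal. transitivity (- (Ci * Ci) * u * (G' (t * cis v)%C * (t * cis v)))%C; [ ring |].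
      replace (Ci * Ci)%C with (- (1))%C by (apply C_ext; simpl; ring). ring. }
  intros s. cbv beta. rewrite Cplus_0_l. reflexivity.
Qed.

Lemma radial_continuity (G' : C -> C) (u : C) (t v : R) :
  ccont G' (RtoC t * cis v)%C -> Rabs t < 1 ->
  continuity_2d_pt (fun a b => Re (u * (G' (RtoC a * cis b)%C * cis b))%C) t v.
Proof.
  intros HG Ht eps. assert (He := cond_pos eps). set (e := pos eps) in *.
  set (w := (t * cis v)%C) in *.
  assert (Hu := Cmod_ge_0 u). assert (Hw := Cmod_ge_0 (G' w)).
  destruct (HG (e / (2 * (Cmod u + 1)))) as [d [Hd Hcont]]; [ apply Rdiv_lt_0_compat; lra |].
  set (d2 := e / (2 * (Cmod u + 1) * (Cmod (G' w) + 1))).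
  assert (Hd2 : 0 < d2) by (apply Rdiv_lt_0_compat; [ lra | nra ]).
  assert (Hm : 0 < Rmin (d / 2) d2) by (apply Rmin_glb_lt; lra).
  exists (mkposreal _ Hm). intros a b Ha Hb. simpl in Ha, Hb.
  assert (Ha1 := Rlt_le_trans _ _ _ Ha (Rmin_l _ _)). assert (Hb1 := Rlt_le_trans _ _ _ Hb (Rmin_l _ _)).
  assert (Hb2 := Rlt_le_trans _ _ _ Hb (Rmin_r _ _)).
  assert (Hc := cis_lip v b).
  set (w' := (a * cis b)%C) in *.
  assert (Hww : Cmod (w' - w) < d).
  { unfold w', w. replace (a * cis b - t * cis v)%C with (RtoC (a - t) * cis b + t * (cis b - cis v))%C
      by (rewrite RtoC_minus; ring).
    eapply Rle_lt_trans; [ apply Cmod_triangle |]. rewrite !Cmod_mult, Cmod_cis, !Cmod_R.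
    assert (H := Cmod_ge_0 (cis b - cis v)). assert (H1 := Rabs_pos t).
    assert (Rabs t * Cmod (cis b - cis v) <= 1 * Rabs (b - v)) by (apply Rmult_le_compat; lra). lra. }
  specialize (Hcont w' Hww).
  change (Rabs (Re (u * (G' w' * cis b)) - Re (u * (G' w * cis v))) < e).
  replace (Re (u * (G' w' * cis b)) - Re (u * (G' w * cis v)))
    with (Re (u * ((G' w' - G' w) * cis b + G' w * (cis b - cis v))))
    by (destruct u, (G' w'), (G' w), (cis b), (cis v); simpl; ring).
  eapply Rle_lt_trans; [ apply re_le_Cmod |]. rewrite Cmod_mult.
  assert (X : Cmod ((G' w' - G' w) * cis b + G' w * (cis b - cis v)) <= e / (Cmod u + 1)).
  { eapply Rle_trans; [ apply Cmod_triangle |]. rewrite !Cmod_mult, Cmod_cis, Rmult_1_r.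
    assert (X1 : Cmod (G' w) * Cmod (cis b - cis v) <= (Cmod (G' w) + 1) * d2).
    { apply Rmult_le_compat; try apply Cmod_ge_0; lra. }
    assert (X2 : (Cmod (G' w) + 1) * d2 = e / (2 * (Cmod u + 1))) by (unfold d2; field; lra).
    replace (e / (Cmod u + 1)) with (e / (2 * (Cmod u + 1)) + e / (2 * (Cmod u + 1))) by (field; lra). lra. }
  apply Rle_lt_trans with (Cmod u * (e / (Cmod u + 1))); [ apply Rmult_le_compat_l; auto |].
  apply Rmult_lt_reg_r with (Cmod u + 1); [ lra |].
  replace (Cmod u * (e / (Cmod u + 1)) * (Cmod u + 1)) with (Cmod u * e) by (field; lra). nra.
Qed.

Lemma cis_2PI : cis (2 * PI) = cis 0.
Proof. rewrite !cis_eq, cos_2PI, sin_2PI, cos_0, sin_0. reflexivity. Qed.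

(** The radial derivative of the integral is, up to the factor [1/t], the integral of
    an angular derivative over a full turn. *)
Lemma circle_integral_const (G : C -> C) (u : C) (rho : R) : C1_disk G -> 0 <= rho < 1 ->
  RInt (fun v => Re (u * G (RtoC rho * cis v)%C)) 0 (2 * PI) = 2 * PI * Re (u * G 0).
Proof.
  intros [G' HG] Hrho.
  assert (HG1 : forall z, Cmod z < 1 -> cderiv G z (G' z)) by (intros; apply HG; auto).
  assert (HG2 : forall z, Cmod z < 1 -> ccont G' z) by (intros; apply HG; auto).
  set (phi := fun s v => Re (u * G (RtoC s * cis v)%C)).
  set (I := fun s => RInt (fun v => phi s v) 0 (2 * PI)).
  assert (Hcont : forall s, Rabs s < 1 -> forall v, continuous (fun v => phi s v) v).
  { intros s Hs v. apply (ex_derive_continuous (V := R_NormedModule)).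
    assert (H := is_derive_angle G G' (Ci * u) s v HG1 Hs). eexists.
    eapply is_derive_ext; [| exact H ]. intros x. unfold phi. f_equal.
    transitivity (- (Ci * Ci) * u * G (s * cis x)%C)%C; [ ring |].
    replace (Ci * Ci)%C with (- (1))%C by (apply C_ext; simpl; ring). ring. }
  assert (HD : forall s v, Rabs s < 1 -> Derive (fun z => phi z v) s = Re (u * (G' (RtoC s * cis v)%C * cis v))%C).
  { intros s v Hs. apply is_derive_unique. apply is_derive_radius; auto. }
  assert (HI : forall s, Rabs s < 1 ->
     is_derive I s (RInt (fun v => Derive (fun z => phi z v) s) 0 (2 * PI))).
  { intros s Hs.
    assert (Hloc : 0 < 1 - Rabs s) by lra.
    assert (Hnear : forall y : R, Rabs (y - s) < 1 - Rabs s -> Rabs y < 1).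
    { intros y Hy. assert (H := Rabs_triang (y - s) s). replace (y - s + s) with y in H by ring. lra. }
    apply is_derive_RInt_param.
    - exists (mkposreal _ Hloc). intros y Hy v _.
      eexists. apply (is_derive_radius G G'); [ exact HG1 | apply Hnear; exact Hy ].
    - intros v _.
      apply (continuity_2d_pt_ext_loc (fun a b => Re (u * (G' (RtoC a * cis b)%C * cis b))%C)).
      + exists (mkposreal _ Hloc). intros a b Ha _. symmetry. apply HD. apply Hnear. exact Ha.
      + apply radial_continuity; auto. apply HG2, circle_in_disk; auto.
    - exists (mkposreal _ Hloc). intros y Hy. apply ex_RInt_cont. apply Hcont. apply Hnear. exact Hy. }
  assert (HI0 : forall s, 0 < s < 1 -> is_derive I s 0).
  { intros s Hs. assert (Hsa : Rabs s < 1) by (rewrite Rabs_pos_eq; lra).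
    evar_last; [ apply HI; auto |].
    rewrite (RInt_ext _ (fun v => scal (/ s) (s * Re (u * (G' (RtoC s * cis v)%C * cis v))%C))).
    2:{ intros v _. rewrite HD by auto. unfold scal; simpl. unfold mult; simpl. field. lra. }
    assert (Hr : is_RInt (fun v => s * Re (u * (G' (RtoC s * cis v)%C * cis v))%C) 0 (2 * PI) 0).
    { evar_last.
      - apply (is_RInt_derive (V := R_CompleteNormedModule) (fun v => Re (- Ci * u * G (RtoC s * cis v)%C))).
        + intros v _. apply is_derive_angle; auto.
        + intros v _. apply (continuous_scal_r (V := R_NormedModule) s).
          assert (Hc1 : contC (fun v => u * (G' (RtoC s * cis v)%C * cis v))%C).
          { apply contC_mult; [ apply contC_const |].
            apply (contC_mult (fun v => G' (RtoC s * cis v)%C) cis).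
            - apply contC_circle; [ lra |]. intros x. apply HG2, circle_in_disk; auto.
            - apply contC_intro. intros x eps He. exists eps. split; auto. intros y Hy.
              eapply Rle_lt_trans; [ apply cis_lip | exact Hy ]. }
          exact (proj1 (Hc1 v)).
      - rewrite cis_2PI. unfold minus, plus, opp; simpl. ring. }
    rewrite (RInt_scal (V := R_CompleteNormedModule)); [| exists 0; exact Hr ].
    rewrite (is_RInt_unique _ _ _ _ Hr). unfold scal; simpl. unfold mult; simpl. ring. }
  assert (E0 : I 0 = 2 * PI * Re (u * G 0)).
  { unfold I, phi. rewrite (RInt_ext _ (fun _ => Re (u * G 0))).
    - rewrite RInt_const. unfold scal; simpl. unfold mult; simpl. ring.
    - intros v _. rewrite Cmult_0_l. reflexivity. }
  rewrite <- E0. change (I rho = I 0).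
  destruct (Req_dec rho 0) as [->|Hne]; auto.
  destruct (MVT_gen I 0 rho (fun _ => 0)) as [c [_ Hc]].
  - rewrite Rmin_left, Rmax_right by lra. intros x Hx. apply HI0. lra.
  - rewrite Rmin_left, Rmax_right by lra. intros x Hx. eapply is_derive_continuity_pt.
    apply HI. rewrite Rabs_pos_eq; lra.
  - lra.
Qed.

Lemma circle_mean_value (G : C -> C) (rho : R) : C1_disk G -> 0 <= rho < 1 ->
  circ_mean (fun v => G (RtoC rho * cis v)%C) = G 0.
Proof.
  intros HG Hr. assert (Hp := PI2_pos). unfold circ_mean. apply C_ext.
  - unfold Re at 1. unfold fst. rewrite (RInt_ext _ (fun v => Re (1 * G (RtoC rho * cis v)%C))).
    + rewrite circle_integral_const by auto. rewrite Cmult_1_l. field. lra.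
    + intros v _. rewrite Cmult_1_l. reflexivity.
  - unfold Im at 1. unfold snd. rewrite (RInt_ext _ (fun v => Re (- Ci * G (RtoC rho * cis v)%C))).
    + rewrite circle_integral_const by auto. destruct (G 0). simpl. field. lra.
    + intros v _. destruct (G (rho * cis v)%C). simpl. ring.
Qed.

(** * Positive measures from functions with positive real part *)

Section Herglotz.
Context (mu rho : R) (Hmu : 0 < mu) (Hrho : 0 < rho < 1).
Context (a : nat -> C) (Ha : adm a).
Context (Hh : forall z, Cmod z < 1 -> Cps a z <> 0).
Context (HP : forall z, Cmod z < 1 -> - (mu / 2) < Re (Cps (times_index a) z / Cps a z)).

Definition log_deriv (z : C) : C := (Cps (times_index a) z / Cps a z)%C.

Definition circ (v : R) : C := (RtoC rho * cis v)%C.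

(** The density of the Herglotz measure of [1 + 2/mu z h'/h] on the circle of radius
    [rho]; the measure is carried by the inverses of the points of that circle. *)
Definition positive_part (v : R) : R := 1 + 2 / mu * Re (log_deriv (circ v)).

Definition moment (k : nat) : C :=
  circ_mean (fun v => RtoC (positive_part v) * (/ circ v) ^ k)%C.

Lemma C1_log_deriv : C1_disk log_deriv.
Proof.
  apply (C1_mult (Cps (times_index a)) (fun z => / Cps a z)%C).
  - apply C1_Cps, adm_times_index; auto.
  - apply C1_inv; auto. apply C1_Cps; auto.
Qed.

Lemma log_deriv_0 : log_deriv 0 = 0.
Proof.
  unfold log_deriv. rewrite times_index_Cps by (auto; rewrite Cmod_0; lra).
  unfold Cdiv. rewrite !Cmult_0_l. reflexivity.
Qed.

Lemma circ_in_disk (v : R) : Cmod (circ v) < 1.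
Proof. apply circle_in_disk. rewrite Rabs_pos_eq; lra. Qed.

Lemma circ_neq_0 (v : R) : circ v <> 0.
Proof. apply Cmod_gt_0. unfold circ. rewrite Cmod_mult, Cmod_cis, Cmod_R_pos; lra. Qed.

Lemma circ_inv (v : R) : (/ circ v)%C = (/ RtoC (rho ^ 2) * Cconj (circ v))%C.
Proof.
  assert (H := circ_neq_0 v).
  assert (E : (circ v * Cconj (circ v))%C = RtoC (rho ^ 2)).
  { rewrite <- Cmod2_conj. unfold circ. rewrite Cmod_mult, Cmod_cis, Cmod_R_pos, Rmult_1_r by lra. reflexivity. }
  rewrite <- E. field. split; auto. intros E0. rewrite E0, Cmult_0_r in E. apply RtoC_inj in E. nra.
Qed.

Lemma positive_part_pos (v : R) : 0 < positive_part v.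
Proof.
  unfold positive_part. assert (H := HP _ (circ_in_disk v)). fold (log_deriv (circ v)) in H.
  apply Rmult_lt_reg_l with (mu / 2); [ lra |].
  replace (mu / 2 * (1 + 2 / mu * Re (log_deriv (circ v)))) with (mu / 2 + Re (log_deriv (circ v))) by (field; lra).
  lra.
Qed.

Lemma contC_C1 (G : C -> C) : C1_disk G -> contC (fun v => G (circ v)).
Proof.
  intros HG. apply contC_circle; [ lra |]. intros v. apply C1_cont; auto. apply circ_in_disk.
Qed.

Lemma contC_inv_pow (k : nat) : contC (fun v => (/ circ v) ^ k)%C.
Proof.
  assert (H1 : contC (fun v => / circ v)%C).
  { assert (H := contC_mult _ _ (contC_const (/ RtoC (rho ^ 2))%C) (contC_conj _ (contC_C1 _ C1_id))).
    intros t. destruct (H t) as [X1 X2]. split.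
    - eapply continuous_ext; [| exact X1 ]. intros s. cbv beta. rewrite circ_inv. reflexivity.
    - eapply continuous_ext; [| exact X2 ]. intros s. cbv beta. rewrite circ_inv. reflexivity. }
  induction k as [|k IH]; [ exact (contC_const 1) |]. apply (contC_mult (fun v => / circ v)%C); auto.
Qed.

Lemma circ_mean_value (G : C -> C) : C1_disk G -> circ_mean (fun v => G (circ v)) = G 0.
Proof. intros HG. apply circle_mean_value; auto. lra. Qed.

Lemma circ_mean_conj_pow (G : C -> C) (k : nat) : C1_disk G ->
  circ_mean (fun v => Cconj (G (circ v)) * (/ circ v) ^ k)%C
    = ((/ RtoC (rho ^ 2)) ^ k * Cconj (G 0 * 0 ^ k))%C.
Proof.
  intros HG.
  assert (HGk : C1_disk (fun z => G z * z ^ k)%C) by (apply C1_mult; auto; apply C1_pow).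
  rewrite (circ_mean_ext _ (fun v => (/ RtoC (rho ^ 2)) ^ k * Cconj (G (circ v) * circ v ^ k))%C).
  - rewrite (circ_mean_scal _ (fun v => Cconj (G (circ v) * circ v ^ k)%C)).
    + rewrite circ_mean_conj by apply (contC_C1 _ HGk).
      rewrite (circ_mean_value _ HGk). reflexivity.
    + apply contC_conj, (contC_C1 _ HGk).
  - intros v. rewrite circ_inv, Cpow_mult_l, Cmult_conj, Cpow_conj. ring.
Qed.

Lemma circ_mean_inv_pow (k : nat) : (0 < k)%nat -> circ_mean (fun v => (/ circ v) ^ k)%C = 0.
Proof.
  intros Hk. rewrite (circ_mean_ext _ (fun v => Cconj ((fun _ => RtoC 1) (circ v)) * (/ circ v) ^ k)%C).
  - etransitivity; [ apply (circ_mean_conj_pow (fun _ => RtoC 1)), C1_const |].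
    destruct k; [ lia |]. simpl. rewrite !Cmult_0_l, Cmult_0_r.
    replace (Cconj 0) with (RtoC 0) by (apply C_ext; simpl; ring). ring.
  - intros v. cbv beta. replace (Cconj 1) with (RtoC 1) by (apply C_ext; simpl; ring). ring.
Qed.

Definition log_coef (k : nat) : C := circ_mean (fun v => log_deriv (circ v) * (/ circ v) ^ k)%C.

(** The real part is half the sum of the function and its conjugate.  By the mean value
    property the conjugate term vanishes, and for [k > 0] only [log_coef] survives. *)
Lemma moment_split (k : nat) : moment k =
  (circ_mean (fun v => (/ circ v) ^ k) + / mu * log_coef k
    + / mu * circ_mean (fun v => Cconj (log_deriv (circ v)) * (/ circ v) ^ k))%C.
Proof.
  assert (Hmu0 : RtoC mu <> 0) by (apply RtoC_neq_0; lra).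
  assert (H1 : contC (fun v => log_deriv (circ v) * (/ circ v) ^ k)%C).
  { apply contC_mult; [ apply contC_C1, C1_log_deriv | apply contC_inv_pow ]. }
  assert (H2 : contC (fun v => Cconj (log_deriv (circ v)) * (/ circ v) ^ k)%C).
  { apply contC_mult; [ apply contC_conj, contC_C1, C1_log_deriv | apply contC_inv_pow ]. }
  unfold moment, log_coef.
  rewrite <- (circ_mean_scal (/ mu) _ H1), <- (circ_mean_scal (/ mu) _ H2).
  rewrite <- circ_mean_plus; [| apply contC_inv_pow | apply contC_mult; auto; apply contC_const ].
  rewrite <- circ_mean_plus.
  - apply circ_mean_ext. intros v. unfold positive_part.
    rewrite RtoC_plus, RtoC_mult, re_alt, RtoC_div by lra. field. auto.
  - apply contC_plus; [ apply contC_inv_pow | apply contC_mult; auto; apply contC_const ].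
  - apply contC_mult; auto; apply contC_const.
Qed.

Lemma log_coef_0 : log_coef 0 = 0.
Proof.
  unfold log_coef. rewrite (circ_mean_ext _ (fun v => log_deriv (circ v))) by (intros; simpl; ring).
  rewrite circ_mean_value by apply C1_log_deriv. apply log_deriv_0.
Qed.

Lemma moment_0 : moment 0 = 1.
Proof.
  rewrite moment_split, log_coef_0, (circ_mean_conj_pow log_deriv) by apply C1_log_deriv.
  rewrite log_deriv_0. simpl. rewrite circ_mean_const.
  replace (Cconj (0 * 1)) with (RtoC 0) by (apply C_ext; simpl; ring). ring.
Qed.

Lemma moment_pos (k : nat) : (0 < k)%nat -> moment k = (/ mu * log_coef k)%C.
Proof.
  intros Hk. rewrite moment_split, circ_mean_inv_pow by auto.
  rewrite (circ_mean_conj_pow log_deriv) by apply C1_log_deriv.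
  rewrite log_deriv_0, Cmult_0_l. replace (Cconj 0) with (RtoC 0) by (apply C_ext; simpl; ring). ring.
Qed.

(** Dividing [z h' = (z h'/h) h] by [z^k] and taking circle means, the tails of the two
    power series are analytic, vanish at [0], and drop out. *)
Lemma log_coef_recursion (k : nat) :
  (INR k * a k)%C = Csum (fun j => a j * log_coef (k - j))%C (S k).
Proof.
  assert (Hpw : forall j v, (j <= k)%nat -> (circ v ^ j * (/ circ v) ^ k = (/ circ v) ^ (k - j))%C).
  { intros j v Hj. replace k with (j + (k - j))%nat at 1 by lia.
    rewrite Cpow_add_r, Cmult_assoc, <- Cpow_mult_l, Cinv_r, Cpow_1_l by apply circ_neq_0. ring. }
  assert (HC0 : forall v, ((/ circ v) ^ k * circ v ^ k = 1)%C).
  { intros v. rewrite <- Cpow_mult_l, Cinv_l, Cpow_1_l by apply circ_neq_0. reflexivity. }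
  set (T := Cps (shift (S k) a)). set (D := Cps (shift (S k) (times_index a))).
  assert (HT : C1_disk T) by (apply C1_Cps, adm_shift; auto).
  assert (HDD : C1_disk D) by (apply C1_Cps, adm_shift, adm_times_index; auto).
  (* Both sides are the mean of [z h'(z) / z^k]. *)
  transitivity (circ_mean (fun v => Cps (times_index a) (circ v) * (/ circ v) ^ k)%C).
  - rewrite (circ_mean_ext _ (fun v => Csum (fun j => times_index a j * (/ circ v) ^ (k - j)) (S k)
        + (fun z => z * D z) (circ v))%C).
    + rewrite circ_mean_plus.
      * rewrite (circ_mean_value (fun z => z * D z)%C) by (apply C1_mult; auto; apply C1_id).
        rewrite (circ_mean_Csum _ (fun j v => (/ circ v) ^ (k - j))%C) by (intros; apply contC_inv_pow).
        cbn [Csum]. rewrite (Csum_ext _ (fun _ => 0 * 0)%C).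
        -- rewrite Csum_scal, Nat.sub_diag. simpl. rewrite circ_mean_const. unfold times_index. ring.
        -- intros j Hj. rewrite circ_mean_inv_pow by lia. ring.
      * apply (contC_Csum (fun j v => times_index a j * (/ circ v) ^ (k - j))%C).
        intros j. apply contC_mult; [ apply contC_const | apply contC_inv_pow ].
      * apply (contC_C1 (fun z => z * D z)%C). apply C1_mult; auto. apply C1_id.
    + intros v. rewrite (Cps_shift (S k)) by (try apply adm_times_index; auto; apply circ_in_disk).
      fold D. rewrite Cmult_plus_distr_r, (Cmult_comm (Csum _ _)), <- Csum_scal. f_equal.
      * apply Csum_ext. intros j Hj. rewrite <- (Hpw j v ltac:(lia)). ring.
      * cbv beta. transitivity (circ v * D (circ v) * ((/ circ v) ^ k * circ v ^ k))%C; [ simpl; ring |].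
        rewrite HC0. ring.
  - rewrite (circ_mean_ext _ (fun v => Csum (fun j => a j * (log_deriv (circ v) * (/ circ v) ^ (k - j))) (S k)
        + (fun z => z * (log_deriv z * T z)) (circ v))%C).
    + rewrite circ_mean_plus.
      * rewrite (circ_mean_value (fun z => z * (log_deriv z * T z))%C) by (apply C1_mult; [ apply C1_id | apply C1_mult; auto; apply C1_log_deriv ]).
        rewrite (circ_mean_Csum _ (fun j v => log_deriv (circ v) * (/ circ v) ^ (k - j))%C)
          by (intros; apply contC_mult; [ apply contC_C1, C1_log_deriv | apply contC_inv_pow ]).
        rewrite Cmult_0_l, Cplus_0_r. reflexivity.
      * apply (contC_Csum (fun j v => a j * (log_deriv (circ v) * (/ circ v) ^ (k - j)))%C).
        intros j. apply contC_mult; [ apply contC_const |].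
        apply contC_mult; [ apply contC_C1, C1_log_deriv | apply contC_inv_pow ].
      * apply (contC_C1 (fun z => z * (log_deriv z * T z))%C).
        apply C1_mult; [ apply C1_id | apply C1_mult; auto; apply C1_log_deriv ].
    + intros v. assert (Hn := Hh _ (circ_in_disk v)).
      transitivity (log_deriv (circ v) * (Cps a (circ v) * (/ circ v) ^ k))%C.
      { unfold log_deriv. set (X := ((/ circ v) ^ k)%C). field. auto. }
      rewrite (Cps_shift (S k) a) by (auto; apply circ_in_disk). fold T.
      rewrite Cmult_plus_distr_r, Cmult_plus_distr_l. f_equal.
      * rewrite (Cmult_comm (Csum _ _)), <- Csum_scal, <- Csum_scal.
        apply Csum_ext. intros j Hj. rewrite <- (Hpw j v ltac:(lia)). ring.
      * cbv beta. transitivity (circ v * (log_deriv (circ v) * T (circ v)) * ((/ circ v) ^ k * circ v ^ k))%C; [ simpl; ring |].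
        rewrite HC0. ring.
Qed.

Lemma moment_recursion (k : nat) :
  (INR k * a k)%C = (mu * Csum (fun j => a j * moment (k - j)) k)%C.
Proof.
  rewrite log_coef_recursion. cbn [Csum]. rewrite Nat.sub_diag, log_coef_0, Cmult_0_r, Cplus_0_r.
  rewrite <- Csum_scal. apply Csum_ext. intros j Hj. rewrite moment_pos by lia.
  assert (Hmu0 : RtoC mu <> 0) by (apply RtoC_neq_0; lra). field. auto.
Qed.

End Herglotz.

(** * Moments as limits of finite positive combinations *)

Lemma riemann_sum_lin (ptd : SF_seq) (k f g : R -> R) (x y : R) :
  (forall t, k t = x * f t + y * g t) ->
  Riemann_sum k ptd = x * Riemann_sum f ptd + y * Riemann_sum g ptd.
Proof.
  intros H. induction ptd as [x0 | [h0 h1] s IH] using SF_cons_ind.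
  - unfold Riemann_sum; simpl. unfold zero; simpl. ring.
  - rewrite !Riemann_sum_cons, IH. simpl. rewrite H. unfold plus, scal; simpl. unfold mult; simpl. ring.
Qed.

Section RiemannMean.
Context (wt : R -> R) (Hwt : forall t, 0 < wt t) (x : R -> C) (K : C -> Prop) (HK : forall t, K (x t)).

Definition rsum (ptd : SF_seq) (g : C -> C) : C :=
  (Riemann_sum (fun t => wt t * Re (g (x t))) ptd, Riemann_sum (fun t => wt t * Im (g (x t))) ptd).

(** Induction on the subdivision; cells of length zero force the degenerate case. *)
Lemma rsum_convex (Om : C -> Prop) (g : C -> C) : convex Om -> (forall s, K s -> Om (g s)) ->
  forall ptd, pointed_subdiv ptd ->
    (Riemann_sum wt ptd = 0 /\ rsum ptd g = 0) \/
    (0 < Riemann_sum wt ptd /\ Om (/ RtoC (Riemann_sum wt ptd) * rsum ptd g)%C).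
Proof.
  intros HO Hg ptd. induction ptd as [x0 | [h0 h1] s IH] using SF_cons_ind; intros Hp.
  - left. split; reflexivity.
  - assert (Hs := ptd_cons _ _ Hp). specialize (IH Hs).
    assert (H0 := Hp O (Nat.lt_0_succ _)). simpl in H0.
    unfold rsum. rewrite !Riemann_sum_cons. simpl fst. simpl snd.
    assert (Hlen : 0 <= SF_h s - h0) by lra.
    set (l := SF_h s - h0) in *. set (Z := Riemann_sum wt s) in *.
    unfold plus, scal; simpl. unfold mult; simpl.
    assert (HZ : 0 <= Z) by (destruct IH as [[H _]|[H _]]; lra).
    assert (E : (l * (wt h1 * Re (g (x h1))) + Riemann_sum (fun t => wt t * Re (g (x t))) s,
                 l * (wt h1 * Im (g (x h1))) + Riemann_sum (fun t => wt t * Im (g (x t))) s)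
       = (RtoC (l * wt h1) * g (x h1) + rsum s g)%C).
    { unfold rsum. apply C_ext; simpl; unfold Re, Im; simpl; ring. }
    rewrite E. specialize (Hwt h1). assert (Hlw : 0 <= l * wt h1) by nra.
    destruct (Req_dec (l * wt h1) 0) as [Hz|Hnz].
    + rewrite Hz. destruct IH as [[I1 I2]|[I1 I2]].
      * left. rewrite I1, I2. split; [ ring |]. ring.
      * right. rewrite Rplus_0_l. split; auto.
        replace (0 * g (x h1) + rsum s g)%C with (rsum s g) by ring. exact I2.
    + right. split; [ lra |].
      assert (Hpos : 0 < l * wt h1 + Z) by lra.
      assert (Hc : RtoC (l * wt h1 + Z) <> 0) by (apply RtoC_neq_0; lra).
      destruct IH as [[I1 I2]|[I1 I2]].
      * rewrite I1, I2 in *. rewrite Rplus_0_r in *. rewrite Cplus_0_r.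
        replace (/ RtoC (l * wt h1) * (RtoC (l * wt h1) * g (x h1)))%C with (g (x h1)) by (field; auto).
        apply Hg, HK.
      * assert (HZc : RtoC Z <> 0) by (apply RtoC_neq_0; lra).
        replace (/ RtoC (l * wt h1 + Z) * (RtoC (l * wt h1) * g (x h1) + rsum s g))%C
          with (RtoC (l * wt h1 / (l * wt h1 + Z)) * g (x h1)
            + RtoC (1 - l * wt h1 / (l * wt h1 + Z)) * (/ RtoC Z * rsum s g))%C.
        -- apply HO; auto. apply Rdiv_between_0_1; lra.
        -- replace (1 - l * wt h1 / (l * wt h1 + Z)) with (Z / (l * wt h1 + Z)) by (field; lra).
           rewrite !RtoC_div by lra. field. auto.
Qed.

Lemma rsum_mean (ptd : SF_seq) : pointed_subdiv ptd -> 0 < Riemann_sum wt ptd ->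
  is_mean K (fun g => / RtoC (Riemann_sum wt ptd) * rsum ptd g)%C.
Proof.
  intros Hp HZ. split.
  - intros g h. rewrite <- Cmult_plus_distr_l. f_equal. unfold rsum. apply C_ext.
    + change (@eq R (Riemann_sum (fun t => wt t * Re (g (x t) + h (x t))%C) ptd) (Riemann_sum (fun t => wt t * Re (g (x t))) ptd + Riemann_sum (fun t => wt t * Re (h (x t))) ptd)).
      rewrite (riemann_sum_lin _ _ (fun t => wt t * Re (g (x t))) (fun t => wt t * Re (h (x t))) 1 1).
      * ring.
      * intros t. rewrite re_plus. ring.
    + change (@eq R (Riemann_sum (fun t => wt t * Im (g (x t) + h (x t))%C) ptd) (Riemann_sum (fun t => wt t * Im (g (x t))) ptd + Riemann_sum (fun t => wt t * Im (h (x t))) ptd)).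
      rewrite (riemann_sum_lin _ _ (fun t => wt t * Im (g (x t))) (fun t => wt t * Im (h (x t))) 1 1).
      * ring.
      * intros t. rewrite im_plus. ring.
  - intros c g. rewrite (Cmult_comm c), <- Cmult_assoc. f_equal. rewrite Cmult_comm.
    unfold rsum. apply C_ext.
    + rewrite re_mult.
      change (@eq R (Riemann_sum (fun t => wt t * Re (c * g (x t))%C) ptd) (Re c * Riemann_sum (fun t => wt t * Re (g (x t))) ptd - Im c * Riemann_sum (fun t => wt t * Im (g (x t))) ptd)).
      rewrite (riemann_sum_lin _ _ (fun t => wt t * Re (g (x t))) (fun t => wt t * Im (g (x t))) (Re c) (- Im c)).
      * ring.
      * intros t. rewrite re_mult. ring.
    + rewrite im_mult.
      change (@eq R (Riemann_sum (fun t => wt t * Im (c * g (x t))%C) ptd) (Re c * Riemann_sum (fun t => wt t * Im (g (x t))) ptd + Im c * Riemann_sum (fun t => wt t * Re (g (x t))) ptd)).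
      rewrite (riemann_sum_lin _ _ (fun t => wt t * Im (g (x t))) (fun t => wt t * Re (g (x t))) (Re c) (Im c)).
      * ring.
      * intros t. rewrite im_mult. ring.
  - intros Om g HO Hg. destruct (rsum_convex Om g HO Hg ptd Hp) as [[H _]|[_ H]]; auto. lra.
Qed.

End RiemannMean.

Section HerglotzMean.
Context (mu rho : R) (Hmu : 0 < mu) (Hrho : 0 < rho < 1).
Context (a : nat -> C) (Ha : adm a).
Context (Hh : forall z, Cmod z < 1 -> Cps a z <> 0).
Context (HP : forall z, Cmod z < 1 -> - (mu / 2) < Re (Cps (times_index a) z / Cps a z)).

Let wt := positive_part mu rho a.
Let x := fun v => (/ circ rho v)%C.

Lemma rsum_converges (k : nat) (eps : R) : 0 < eps ->
  Riemann_fine 0 (2 * PI) (fun ptd =>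
    Cmod (rsum wt x ptd (fun y => y ^ k)%C - RtoC (2 * PI) * moment mu rho a k) <= eps).
Proof.
  intros He. assert (Hp := PI2_pos).
  assert (Hc1 : contC (fun v => RtoC (wt v))).
  { intros t. split; [| apply continuous_const ].
    apply (continuous_ext (fun v => plus 1 (scal (2 / mu) (Re (log_deriv a (circ rho v)))))).
    - intros v. reflexivity.
    - apply (continuous_plus (V := R_NormedModule)); [ apply continuous_const |].
      apply (continuous_scal_r (V := R_NormedModule)).
      exact (proj1 (contC_C1 rho Hrho _ (C1_log_deriv a Ha Hh) t)). }
  assert (Hc : contC (fun v => RtoC (wt v) * x v ^ k)%C).
  { apply contC_mult; auto. apply contC_inv_pow; auto. }
  assert (HR : forall f : R -> R, (forall t, continuous f t) ->
     Riemann_fine 0 (2 * PI) (fun ptd => Rabs (Riemann_sum f ptd - RInt f 0 (2 * PI)) <= eps / 2)).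
  { intros f Hf. assert (H := RInt_correct (V := R_CompleteNormedModule) f 0 (2 * PI) (ex_RInt_cont f Hf)).
    assert (He2 : 0 < eps / 2) by lra.
    specialize (H _ (locally_ball (RInt f 0 (2 * PI) : R_NormedModule) (mkposreal _ He2))).
    unfold filtermap in H. revert H. apply filter_imp. intros ptd H.
    rewrite Rminus_0_r, sign_eq_1 in H by auto.
    assert (H' : Rabs (1 * Riemann_sum f ptd - RInt f 0 (2 * PI)) < eps / 2) by exact H.
    rewrite Rmult_1_l in H'. lra. }
  assert (F1 := HR _ (fun t => proj1 (Hc t))). assert (F2 := HR _ (fun t => proj2 (Hc t))).
  assert (F := filter_and _ _ F1 F2). revert F. apply filter_imp. intros ptd [X1 X2].
  eapply Rle_trans; [ apply Cmod_le_abs |].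
  set (f := fun t => (RtoC (wt t) * x t ^ k)%C) in *.
  assert (EM : (RtoC (2 * PI) * moment mu rho a k)%C
     = (RInt (fun t => Re (f t)) 0 (2 * PI), RInt (fun t => Im (f t)) 0 (2 * PI))).
  { apply C_ext.
    - rewrite re_scal_l. change (2 * PI * (RInt (fun t => Re (f t)) 0 (2 * PI) / (2 * PI)) = RInt (fun t => Re (f t)) 0 (2 * PI)).
      field. lra.
    - rewrite im_scal_l. change (2 * PI * (RInt (fun t => Im (f t)) 0 (2 * PI) / (2 * PI)) = RInt (fun t => Im (f t)) 0 (2 * PI)).
      field. lra. }
  assert (ES : rsum wt x ptd (fun y => y ^ k)%C
     = (Riemann_sum (fun t => Re (f t)) ptd, Riemann_sum (fun t => Im (f t)) ptd)).
  { unfold rsum. apply C_ext.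
    - change (@eq R (Riemann_sum (fun t => wt t * Re (x t ^ k)%C) ptd) (Riemann_sum (fun t => Re (f t)) ptd)).
      rewrite (riemann_sum_lin ptd (fun t => wt t * Re (x t ^ k)%C) (fun t => Re (f t)) (fun t => Re (f t)) 1 0).
      + ring.
      + intros t. unfold f. rewrite re_scal_l. ring.
    - change (@eq R (Riemann_sum (fun t => wt t * Im (x t ^ k)%C) ptd) (Riemann_sum (fun t => Im (f t)) ptd)).
      rewrite (riemann_sum_lin ptd (fun t => wt t * Im (x t ^ k)%C) (fun t => Im (f t)) (fun t => Im (f t)) 1 0).
      + ring.
      + intros t. unfold f. rewrite im_scal_l. ring. }
  rewrite EM, ES.
  change (Rabs (Riemann_sum (fun t => Re (f t)) ptd - RInt (fun t => Re (f t)) 0 (2 * PI)) +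
    Rabs (Riemann_sum (fun t => Im (f t)) ptd - RInt (fun t => Im (f t)) 0 (2 * PI)) <= eps).
  apply Rle_trans with (eps / 2 + eps / 2); [ apply Rplus_le_compat; [ exact X1 | exact X2 ] | lra ].
Qed.

(** Riemann sums of the moment integrals, divided by their total weight.  Finite sums
    make the functional linear on all functions. *)
Lemma herglotz_mean (N : nat) (eps : R) : 0 < eps ->
  exists M : (C -> C) -> C, is_mean (fun y => Cmod y = / rho) M /\
    forall k, (k < N)%nat -> Cmod (M (fun y => y ^ k)%C - moment mu rho a k) <= eps.
Proof.
  intros He. assert (Hp := PI2_pos). assert (HPI := PI2_1).
  assert (HB : exists B, 0 <= B /\ forall k, (k < N)%nat -> Cmod (moment mu rho a k) <= B).
  { clear eps He. induction N as [|n [B [HB IH]]].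
    - exists 0. split; [ lra |]. intros; lia.
    - exists (Rmax B (Cmod (moment mu rho a n))). split; [ eapply Rle_trans; [ exact HB | apply Rmax_l ] |].
      intros k Hk. destruct (Nat.eq_dec k n) as [->|Hne]; [ apply Rmax_r |].
      eapply Rle_trans; [ apply IH; lia | apply Rmax_l ]. }
  destruct HB as [B [HB HBk]].
  set (eta := Rmin 1 (eps / (1 + B))).
  assert (Heta : 0 < eta) by (apply Rmin_glb_lt; [ lra | apply Rdiv_lt_0_compat; lra ]).
  assert (Heta1 : eta <= 1) by apply Rmin_l.
  assert (Heta2 : eta * (1 + B) <= eps).
  { apply Rle_trans with (eps / (1 + B) * (1 + B)); [ apply Rmult_le_compat_r; [ lra | apply Rmin_r ] |].
    right; field; lra. }
  assert (HF : Riemann_fine 0 (2 * PI) (fun ptd => forall k, (k < S N)%nat ->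
      Cmod (rsum wt x ptd (fun y => y ^ k)%C - RtoC (2 * PI) * moment mu rho a k) <= eta)).
  { induction (S N) as [|n IH].
    - apply filter_forall. intros; lia.
    - assert (F := filter_and _ _ IH (rsum_converges n eta Heta)). revert F. apply filter_imp.
      intros ptd [H1 H2] k Hk. destruct (Nat.eq_dec k n) as [->|Hne]; auto. apply H1. lia. }
  assert (HD : Riemann_fine 0 (2 * PI) pointed_subdiv).
  { exists (mkposreal 1 Rlt_0_1). intros ptd _ [H _]. exact H. }
  destruct (filter_ex _ (filter_and _ _ HD HF)) as [ptd [Hptd Hk]].
  set (Z := Riemann_sum wt ptd).
  assert (HZ : Cmod (RtoC Z - RtoC (2 * PI)) <= eta).
  { assert (H := Hk O ltac:(lia)). rewrite moment_0, Cmult_1_r in H by auto.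
    replace (rsum wt x ptd (fun y => y ^ 0)%C) with (RtoC Z) in H; auto.
    unfold rsum. apply C_ext.
    - symmetry. change (@eq R (Riemann_sum (fun t => wt t * 1) ptd) Z). unfold Z.
      rewrite (riemann_sum_lin ptd (fun t => wt t * 1) wt wt 1 0) by (intros; ring). ring.
    - symmetry. change (@eq R (Riemann_sum (fun t => wt t * 0) ptd) 0).
      rewrite (riemann_sum_lin ptd (fun t => wt t * 0) wt wt 0 0) by (intros; ring). ring. }
  rewrite <- RtoC_minus, Cmod_R in HZ. apply Rabs_le_between in HZ.
  assert (HZ1 : 1 < Z) by lra.
  exists (fun g => / RtoC Z * rsum wt x ptd g)%C. split.
  - apply rsum_mean; auto.
    + intros t. apply positive_part_pos; auto.
    + intros t. unfold x. rewrite Cmod_inv by (apply circ_neq_0; auto).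
      unfold circ. rewrite Cmod_mult, Cmod_cis, Cmod_R_pos, Rmult_1_r by lra. reflexivity.
    + fold Z. lra.
  - intros k Hkn. specialize (Hk k ltac:(lia)). specialize (HBk k Hkn).
    assert (HZc : RtoC Z <> 0) by (apply RtoC_neq_0; lra).
    set (m := moment mu rho a k) in *. set (r := rsum wt x ptd (fun y => y ^ k)%C) in *.
    replace (/ RtoC Z * r - m)%C with (/ RtoC Z * ((r - RtoC (2 * PI) * m) + RtoC (2 * PI - Z) * m))%C
      by (rewrite RtoC_minus; field; auto).
    rewrite Cmod_mult, Cmod_inv, Cmod_R_pos by (auto; lra).
    assert (Hb : Cmod (r - RtoC (2 * PI) * m + RtoC (2 * PI - Z) * m) <= eta * (1 + B)).
    { eapply Rle_trans; [ apply Cmod_triangle |]. rewrite (Cmod_mult (RtoC (2 * PI - Z))), Cmod_R.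
      assert (Ha1 : Rabs (2 * PI - Z) <= eta) by (apply Rabs_le; lra).
      assert (H2 : Rabs (2 * PI - Z) * Cmod m <= eta * B)
        by (apply Rmult_le_compat; auto; [ apply Rabs_pos | apply Cmod_ge_0 ]). lra. }
    assert (Hinv : 0 < / Z <= 1).
    { split; [ apply Rinv_0_lt_compat; lra |]. rewrite <- Rinv_1. apply Rinv_le_contravar; lra. }
    assert (H0 := Cmod_ge_0 (r - RtoC (2 * PI) * m + RtoC (2 * PI - Z) * m)). nra.
Qed.

End HerglotzMean.

Lemma Csum_rev (u : nat -> C) (n : nat) :
  Csum u (S n) = Csum (fun k => u (n - k)%nat) (S n).
Proof.
  induction n as [|n IH]; [ reflexivity |].
  change (Csum u (S (S n))) with (Csum u (S n) + u (S n))%C.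
  rewrite IH, (Csum_shift (fun k => u (S n - k)%nat)). rewrite Nat.sub_0_r, Cplus_comm.
  reflexivity.
Qed.

(** * Limits along approximations *)

(* [good d s] is read: [s] is an approximation of quality [d]. *)
Section Null.
Context {T : Type} (good : R -> T -> Prop)
  (good_mono : forall d1 d2 s, 0 < d1 -> d1 <= d2 -> good d1 s -> good d2 s).

Definition null (u : T -> C) : Prop :=
  forall eps, 0 < eps -> exists d, 0 < d /\ forall s, good d s -> Cmod (u s) <= eps.

Lemma null_plus (u v : T -> C) : null u -> null v -> null (fun s => u s + v s)%C.
Proof.
  intros Hu Hv eps He.
  destruct (Hu (eps / 2) ltac:(lra)) as [d1 [Hd1 H1]]. destruct (Hv (eps / 2) ltac:(lra)) as [d2 [Hd2 H2]].
  assert (Hm : 0 < Rmin d1 d2) by (apply Rmin_glb_lt; auto).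
  exists (Rmin d1 d2). split; auto. intros s Hs.
  eapply Rle_trans; [ apply Cmod_triangle |].
  specialize (H1 s (good_mono _ _ s Hm (Rmin_l _ _) Hs)).
  specialize (H2 s (good_mono _ _ s Hm (Rmin_r _ _) Hs)). lra.
Qed.

Lemma null_mult (u v : T -> C) (B : R) : null u ->
  (forall d s, 0 < d -> good d s -> Cmod (v s) <= B) -> null (fun s => v s * u s)%C.
Proof.
  intros Hu Hv eps He.
  destruct (Hu (eps / (Rabs B + 1))) as [d [Hd H]].
  { assert (H := Rabs_pos B). apply Rdiv_lt_0_compat; lra. }
  exists d. split; auto. intros s Hs. rewrite Cmod_mult.
  assert (HB := Rabs_pos B). assert (HB2 := Rle_abs B).
  apply Rle_trans with ((Rabs B + 1) * (eps / (Rabs B + 1))).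
  - apply Rmult_le_compat; auto using Cmod_ge_0. specialize (Hv d s Hd Hs). lra.
  - right; field; lra.
Qed.

Lemma null_scal (u : T -> C) (c : C) : null u -> null (fun s => c * u s)%C.
Proof. intros Hu. apply (null_mult u (fun _ => c) (Cmod c)); auto. intros; lra. Qed.

Lemma null_ext (u v : T -> C) : (forall s, u s = v s) -> null u -> null v.
Proof.
  intros H Hu eps He. destruct (Hu eps He) as [d [Hd Hs]]. exists d. split; auto.
  intros s Hg. rewrite <- H. auto.
Qed.

Lemma null_0 : null (fun _ => 0).
Proof. intros eps He. exists 1. split; [ lra |]. intros. rewrite Cmod_0. lra. Qed.

Lemma null_Csum (u : nat -> T -> C) (n : nat) : (forall k, (k < n)%nat -> null (u k)) ->
  null (fun s => Csum (fun k => u k s) n).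
Proof.
  induction n as [|n IH]; intros H; [ exact null_0 |].
  apply (null_plus (fun s => Csum (fun k => u k s) n) (u n)); auto.
Qed.

End Null.

(** * Identification of the limit *)

Lemma kernel_bound (mu r : R) (k : nat) (A : C) : 0 < mu <= 1 -> 0 <= r < 1 -> inv_disk r A ->
  Cmod (kernel mu k A) <= Rpower (1 / 2) (- mu).
Proof.
  intros Hmu Hr HA. unfold kernel. rewrite !Cmod_mult, Cmod_pow.
  assert (H1 := binom_coef_bound mu k Hmu). rewrite Cmod_R_pos by lra.
  assert (H2 := Cmod_power_bound r Hr A mu ltac:(lra) HA).
  assert (H3 := inv_disk_param r Hr A HA).
  assert (H4 : Cmod (1 - / A) ^ k <= 1).
  { apply pow_le_1. split; [ apply Cmod_ge_0 | lra ]. }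
  assert (H5 := pow_le _ k (Cmod_ge_0 (1 - / A))). assert (H6 := Cmod_ge_0 (Cpower A (- mu))).
  assert (H7 : Cmod (Cpower A (- mu)) * Cmod (1 - / A) ^ k <= Rpower (1 / 2) (- mu) * 1)
    by (apply Rmult_le_compat; auto).
  assert (H8 : 0 <= Cmod (Cpower A (- mu)) * Cmod (1 - / A) ^ k) by (apply Rmult_le_pos; auto).
  nra.
Qed.

Section Ratio.
Context (mu : R) (Hmu : 0 < mu <= 1).
Context (a : nat -> C) (Ha : adm a) (Ha0 : a O = 1).
Context (Hh : forall z, Cmod z < 1 -> Cps a z <> 0).
Context (HP : forall z, Cmod z < 1 -> - (mu / 2) < Re (Cps (times_index a) z / Cps a z)).
Context (z : C) (r : R) (Hz : Cmod z < r) (Hr : r < 1).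

Let rho := (Cmod z / r + 1) / 2.
Let nu := moment mu rho a.
Let psi := fun k => (a k * z ^ k)%C.
Let W := fun j => (z ^ j * nu j - z ^ S j * nu (S j))%C.

Lemma r_pos : 0 < r.
Proof. assert (H := Cmod_ge_0 z). lra. Qed.

Lemma z_ratio : 0 <= Cmod z / r < 1.
Proof.
  assert (H := Cmod_ge_0 z). assert (H1 := r_pos). split.
  - apply Rmult_le_pos; auto. left; apply Rinv_0_lt_compat; auto.
  - apply Rmult_lt_reg_r with r; auto. unfold Rdiv. rewrite Rmult_assoc, Rinv_l; lra.
Qed.

Lemma rho_bound : 0 < rho < 1.
Proof. assert (H := z_ratio). unfold rho. lra. Qed.

Lemma z_over_rho : Cmod z * / rho <= r.
Proof.
  assert (H := z_ratio). assert (H1 := rho_bound). assert (H2 := r_pos).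
  apply Rmult_le_reg_r with rho; [ lra |]. rewrite Rmult_assoc, Rinv_l, Rmult_1_r by lra.
  assert (E : Cmod z = Cmod z / r * r) by (field; lra).
  rewrite E. rewrite Rmult_comm. apply Rmult_le_compat_l; [ lra |]. unfold rho. lra.
Qed.

(** The recursion of the moments for [a_k] and [a_(k+1)], subtracted so as to bring in
    the coefficients [W] of [1/(X (1-y) + y)] averaged over the measure. *)
Lemma psi_recursion (k : nat) :
  (RtoC (INR k + mu) * psi k - RtoC (INR (S k)) * psi (S k) = mu * conv W psi k)%C.
Proof.
  assert (Hrec : forall k, (INR k * psi k = mu * Csum (fun j => psi j * (z ^ (k - j) * nu (k - j)%nat)) k)%C).
  { intros m. unfold psi at 1. rewrite Cmult_assoc.
    rewrite (moment_recursion mu rho (proj1 Hmu) rho_bound a Ha Hh m).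
    rewrite <- Cmult_assoc. f_equal. rewrite Cmult_comm, <- Csum_scal. apply Csum_ext.
    intros j Hj. unfold psi, nu. replace m with (j + (m - j))%nat at 1 by lia. rewrite Cpow_add_r. ring. }
  assert (Hconv : conv W psi k = Csum (fun j => psi j * W (k - j)%nat)%C (S k)).
  { unfold conv. rewrite Csum_rev. apply Csum_ext. intros j Hj. replace (k - (k - j))%nat with j by lia. ring. }
  rewrite Hconv, RtoC_plus, Cmult_plus_distr_r, !Hrec.
  assert (Hn0 : nu 0%nat = 1) by (apply moment_0; [ lra | apply rho_bound | auto | auto ]).
  assert (E1 : (Csum (fun j => psi j * (z ^ (k - j) * nu (k - j)%nat)) k + psi k
     = Csum (fun j => psi j * (z ^ (k - j) * nu (k - j)%nat)) (S k))%C).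
  { cbn [Csum]. rewrite Nat.sub_diag, Hn0. simpl. ring. }
  transitivity (mu * ((Csum (fun j => psi j * (z ^ (k - j) * nu (k - j)%nat)) k + psi k)
     - Csum (fun j => psi j * (z ^ (S k - j) * nu (S k - j)%nat)) (S k)))%C; [ ring |].
  rewrite E1. f_equal.
  transitivity (Csum (fun j => psi j * (z ^ (k - j) * nu (k - j)%nat)) (S k)
    + - (1) * Csum (fun j => psi j * (z ^ (S k - j) * nu (S k - j)%nat)) (S k))%C; [ ring |].
  rewrite <- Csum_scal, <- Csum_plus. apply Csum_ext. intros j Hj.
  unfold W. replace (S k - j)%nat with (S (k - j)) by lia. ring.
Qed.

Let state := (((C -> C) -> C) * ((C -> C) -> C))%type.

(** The index [d] bounds the errors and, through [INR k <= / d], says for how many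
    coefficients they are controlled.  The pair consists of the average of the chain
    and of the approximate Herglotz measure. *)
Let good (d : R) (s : state) : Prop :=
  is_mean (inv_disk r) (fst s) /\ is_mean (inv_disk r) (snd s) /\
  forall k, INR k <= / d ->
    Cmod (snd s (weight k) - W k) <= d /\
    Cmod (fst s (kernel_up mu k) - mu * conv (fun j => snd s (weight j)) (fun j => fst s (kernel mu j)) k) <= d.

Lemma good_mono (d1 d2 : R) (s : state) : 0 < d1 -> d1 <= d2 -> good d1 s -> good d2 s.
Proof.
  intros H1 H2 [G1 [G2 G3]]. split; [ exact G1 |]. split; [ exact G2 |].
  intros k Hk. destruct (G3 k) as [X1 X2].
  - apply Rle_trans with (/ d2); auto. apply Rinv_le_contravar; lra.
  - split; lra.
Qed.

Lemma good_exists (d : R) : 0 < d -> exists s, good d s.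
Proof.
  intros Hd. destruct (INR_unbounded (/ d)) as [N HN].
  destruct (herglotz_mean mu rho (proj1 Hmu) rho_bound a Ha Hh HP (S (S N)) (d / 2) ltac:(lra)) as [M [HM HMk]].
  set (atom := fun y => (/ (1 - z * y))%C).
  assert (Hzy : forall y, Cmod y = / rho -> Cmod (z * y) <= r).
  { intros y Hy. rewrite Cmod_mult, Hy. apply z_over_rho. }
  assert (Hr0 := r_pos).
  assert (HM2 : is_mean (inv_disk r) (fun g => M (fun y => g (atom y)))).
  { apply (mean_comp (fun y => Cmod y = / rho) (inv_disk r) M (fun y g => g (atom y))); auto.
    intros y Hy. apply mean_pt. unfold atom. apply inv_disk_inv; auto. lra. }
  destruct (dirichlet_mean mu Hmu r ltac:(lra) _ HM2 (S N) d Hd) as [L [HL HLk]].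
  exists (L, fun g => M (fun y => g (atom y))). split; auto. split; auto.
  intros k Hk. simpl fst. simpl snd.
  assert (HkN : (k < S N)%nat).
  { apply INR_lt. rewrite S_INR. lra. }
  split; [| apply HLk; auto ].
  assert (E : M (fun y => weight k (atom y)) = (z ^ k * M (fun y => y ^ k) - z ^ S k * M (fun y => y ^ S k))%C).
  { transitivity (M (fun y => (z ^ k * y ^ k + (- z ^ S k) * y ^ S k))%C).
    - apply (mean_ext _ _ HM). intros y Hy. unfold weight, atom.
      assert (Hn : (1 - z * y)%C <> 0).
      { apply Re_pos_neq_0, Re_1_minus_pos. specialize (Hzy y Hy). lra. }
      replace (/ / (1 - z * y))%C with (1 - z * y)%C by (field; auto).
      replace (1 - (1 - z * y))%C with (z * y)%C by ring. rewrite Cpow_mult_l. simpl. ring.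
    - rewrite (mean_plus _ _ HM (fun y => z ^ k * y ^ k)%C (fun y => - z ^ S k * y ^ S k)%C).
      rewrite (mean_scal _ _ HM (z ^ k)%C (fun y => y ^ k)%C), (mean_scal _ _ HM (- z ^ S k)%C (fun y => y ^ S k)%C). ring. }
  rewrite E. unfold W.
  replace (z ^ k * M (fun y => y ^ k) - z ^ S k * M (fun y => y ^ S k) - (z ^ k * nu k - z ^ S k * nu (S k)))%C
    with (z ^ k * (M (fun y => y ^ k)%C - nu k) - z ^ S k * (M (fun y => y ^ S k)%C - nu (S k)))%C by ring.
  eapply Rle_trans; [ apply Cmod_sub_le |]. rewrite !Cmod_mult, !Cmod_pow.
  assert (Hp1 : forall j, 0 <= Cmod z ^ j <= 1).
  { intros j. split; [ apply pow_le, Cmod_ge_0 |].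
    apply pow_le_1. split; [ apply Cmod_ge_0 | lra ]. }
  assert (M1 := HMk k ltac:(lia)). assert (M2 := HMk (S k) ltac:(lia)). fold nu in M1, M2.
  assert (P1 := Hp1 k). assert (P2 := Hp1 (S k)).
  assert (C1 := Cmod_ge_0 (M (fun y => y ^ k)%C - nu k)). assert (C2 := Cmod_ge_0 (M (fun y => y ^ S k)%C - nu (S k))).
  nra.
Qed.

Let c (k : nat) (s : state) : C := fst s (kernel mu k).

Lemma c_bound (k : nat) (d : R) (s : state) : 0 < d -> good d s ->
  Cmod (c k s) <= Rpower (1 / 2) (- mu).
Proof.
  intros _ [G1 _]. apply (mean_bound _ _ G1). intros A HA. assert (H := r_pos).
  apply (kernel_bound mu r); auto. lra.
Qed.

Lemma weight_defect_null (j : nat) : null good (fun s => snd s (weight j) - W j)%C.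
Proof.
  intros eps He. assert (Hj : 0 < INR j + 1) by (assert (H := pos_INR j); lra).
  exists (Rmin eps (/ (INR j + 1))). assert (Hi := Rinv_0_lt_compat _ Hj).
  assert (Hm : 0 < Rmin eps (/ (INR j + 1))) by (apply Rmin_glb_lt; auto).
  split; auto. intros s [_ [_ Hs]]. destruct (Hs j) as [H _].
  - apply Rle_trans with (/ / (INR j + 1)).
    + rewrite Rinv_inv. lra.
    + apply Rinv_le_contravar; auto. apply Rmin_r.
  - eapply Rle_trans; [ apply H | apply Rmin_l ].
Qed.

Lemma stationary_defect_null (k : nat) : null good (fun s => RtoC (INR k + mu) * c k s
  - RtoC (INR (S k)) * c (S k) s - mu * conv (fun j => snd s (weight j)) (fun j => c j s) k)%C.
Proof.
  intros eps He. assert (Hj : 0 < INR k + 1) by (assert (H := pos_INR k); lra).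
  exists (Rmin eps (/ (INR k + 1))). assert (Hi := Rinv_0_lt_compat _ Hj).
  assert (Hm : 0 < Rmin eps (/ (INR k + 1))) by (apply Rmin_glb_lt; auto).
  split; auto. intros s [G1 [_ Hs]]. destruct (Hs k) as [_ H].
  - apply Rle_trans with (/ / (INR k + 1)).
    + rewrite Rinv_inv. lra.
    + apply Rinv_le_contravar; auto. apply Rmin_r.
  - eapply Rle_trans; [| apply (Rmin_l eps (/ (INR k + 1))) ]. eapply Rle_trans; [| exact H ].
    right. f_equal. unfold c. f_equal.
    rewrite (mean_ext _ _ G1 (kernel_up mu k)
      (fun A => RtoC (INR k + mu) * kernel mu k A + - RtoC (INR (S k)) * kernel mu (S k) A)%C).
    + rewrite (mean_plus _ _ G1 (fun A => RtoC (INR k + mu) * kernel mu k A)%C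
        (fun A => - RtoC (INR (S k)) * kernel mu (S k) A)%C).
      rewrite (mean_scal _ _ G1 (RtoC (INR k + mu)) (kernel mu k)), (mean_scal _ _ G1 (- RtoC (INR (S k)))%C (kernel mu (S k))). ring.
    + intros A HA. assert (H0 := r_pos).
      rewrite kernel_up_diff by (apply (inv_disk_neq_0 r); auto; lra). ring.
Qed.

(** Both sequences obey the same first order recursion, which determines all terms
    from the first one. *)
Lemma c_proportional (k : nat) : null good (fun s => c k s - psi k * c 0 s)%C.
Proof.
  assert (Gm := good_mono).
  induction k as [k IH] using (well_founded_induction Wf_nat.lt_wf). destruct k as [|k].
  - eapply null_ext; [| apply null_0 ]. intros s. unfold psi. rewrite Ha0. simpl. ring.
  - assert (Hk : 0 < INR (S k)) by (apply lt_0_INR; lia).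
    assert (Hkc : RtoC (INR (S k)) <> 0) by (apply RtoC_neq_0; lra).
    assert (N1 := null_scal good _ (RtoC (INR k + mu)) (IH k ltac:(lia))).
    assert (N2 := null_scal good _ (- (1))%C (stationary_defect_null k)).
    assert (N3 : null good (fun s => Csum (fun j => c (k - j) s * (snd s (weight j) - W j)
          + W j * (c (k - j) s - psi (k - j)%nat * c 0 s))%C (S k))).
    { apply null_Csum; auto. intros j Hj. apply null_plus; auto.
      - apply (null_mult good (fun s => snd s (weight j) - W j)%C (c (k - j)) (Rpower (1 / 2) (- mu))).
        + apply weight_defect_null.
        + intros d s Hd Hs. eapply c_bound; eauto.
      - apply null_scal. apply IH. lia. }
    assert (N := null_scal good _ (/ RtoC (INR (S k)))%C
       (null_plus good Gm _ _ (null_plus good Gm _ _ N1 N2) (null_scal good _ (- RtoC mu)%C N3))).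
    eapply null_ext; [| exact N ]. intros s. cbv beta.
    assert (E : Csum (fun j => c (k - j) s * (snd s (weight j) - W j)
          + W j * (c (k - j) s - psi (k - j)%nat * c 0 s))%C (S k)
       = (conv (fun j => snd s (weight j)) (fun j => c j s) k - c 0 s * conv W psi k)%C).
    { unfold conv. unfold Cminus at 3.
      replace (- (c 0 s * Csum (fun j => W j * psi (k - j)%nat)%C (S k)))%C
        with (- c 0 s * Csum (fun j => W j * psi (k - j)%nat)%C (S k))%C by ring.
      rewrite <- Csum_scal, <- Csum_plus. apply Csum_ext. intros; ring. }
    rewrite E. assert (Hrec := psi_recursion k).
    transitivity (/ RtoC (INR (S k)) * (RtoC (INR (S k)) * c (S k) s - c 0 s *
       (RtoC (INR k + mu) * psi k - mu * conv W psi k)))%C; [ ring |].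
    rewrite <- Hrec. field. auto.
Qed.

Let h := Cps a z.

Lemma z_in_disk : Cmod z < 1.
Proof. lra. Qed.

(** The kernels sum to one, the terms [a_k z^k] sum to [h(z)]. *)
Lemma c_0_limit : null good (fun s => c 0 s * h - 1)%C.
Proof.
  assert (Gm := good_mono). assert (Hr0 := r_pos).
  intros eps He. set (B := Rpower (1 / 2) (- mu)). assert (HB : 0 < B) by apply Rpower_pos.
  destruct (Cps_correct a z Ha z_in_disk (eps / (3 * B))) as [N1 HN1]; [ apply Rdiv_lt_0_compat; lra |].
  assert (HN2 : exists N2, forall n, (N2 <= n)%nat -> INR (S n) * r ^ n / (1 - r) <= eps / 3).
  { assert (Hl : is_lim_seq (fun n => INR n * r ^ n) 0).
    { assert (Hs : ex_series (fun n => INR n * r ^ n)).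
      { assert (Hf : ex_finite_lim_seq (sum_n (fun n => INR n * r ^ n))).
        { apply ex_finite_lim_seq_incr with (/ (1 - r) * / (1 - r)).
          - intros n. rewrite sum_Sn. unfold plus; simpl.
            assert (0 <= INR (S n) * r ^ S n) by (apply Rmult_le_pos; [ apply pos_INR | apply pow_le; lra ]).
            simpl in H. lra.
          - intros n. rewrite Rsum_sum_n. apply Rsum_geom1. lra. }
        destruct Hf as [l Hl]. exists l. exact Hl. }
      apply ex_series_lim_0 in Hs. exact Hs. }
    assert (Hl2 : is_lim_seq (fun n => r ^ n) 0) by (apply is_lim_seq_geom; rewrite Rabs_pos_eq; lra).
    assert (Hl3 := is_lim_seq_plus' _ _ _ _ Hl Hl2). rewrite Rplus_0_l in Hl3.
    apply is_lim_seq_Reals in Hl3.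
    destruct (Hl3 (eps / 3 * (1 - r))) as [N2 HN2]; [ apply Rmult_lt_0_compat; lra |].
    exists N2. intros n Hn. specialize (HN2 n Hn). unfold Rdist in HN2. rewrite Rminus_0_r in HN2.
    assert (H := Rle_abs (INR n * r ^ n + r ^ n)). rewrite S_INR.
    apply Rmult_le_reg_r with (1 - r); [ lra |]. unfold Rdiv. rewrite (Rmult_assoc _ (/ (1 - r))), Rinv_l by lra. lra. }
  destruct HN2 as [N2 HN2]. set (N := max N1 N2).
  specialize (HN1 (S N) ltac:(unfold N; lia)). specialize (HN2 N ltac:(unfold N; lia)).
  destruct (null_Csum good Gm (fun k s => c k s - psi k * c 0 s)%C (S N)
     (fun k _ => c_proportional k) (eps / 3) ltac:(lra)) as [d [Hd Hs]].
  exists d. split; auto. intros s Hg. specialize (Hs s Hg). cbv beta in Hs.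
  assert (Hc0 := c_bound 0 d s Hd Hg). fold B in Hc0.
  destruct Hg as [G1 _].
  assert (Hone : Cmod (Csum (fun k => c k s) (S N) - 1) <= eps / 3).
  { unfold c. rewrite <- (mean_Csum _ _ G1 (fun k A => kernel mu k A)).
    apply (mean_near _ _ G1). intros A HA.
    assert (HRe := inv_disk_Re r ltac:(lra) A HA).
    rewrite (Csum_kernel mu) by lra. eapply Rle_trans; [| exact HN2 ].
    apply binom_ratio_near_1; auto. split; [ apply inv_disk_param; auto; lra | auto ]. }
  assert (Esum : Csum (fun k => c k s - psi k * c 0 s)%C (S N)
     = (Csum (fun k => c k s) (S N) - c 0 s * Csum psi (S N))%C).
  { rewrite (Csum_ext _ (fun k => c k s + - c 0 s * psi k)%C) by (intros; ring).
    rewrite Csum_plus, Csum_scal. ring. }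
  rewrite Esum in Hs.
  replace (c 0 s * h - 1)%C with (- (c 0 s * (Csum psi (S N) - h))
     + ((Csum (fun k => c k s) (S N) - 1) - (Csum (fun k => c k s) (S N) - c 0 s * Csum psi (S N))))%C by ring.
  eapply Rle_trans; [ apply Cmod_triangle |].
  assert (X1 : Cmod (- (c 0 s * (Csum psi (S N) - h))) <= eps / 3).
  { rewrite Cmod_opp, Cmod_mult. apply Rle_trans with (B * (eps / (3 * B))).
    - apply Rmult_le_compat; auto using Cmod_ge_0.
    - right; field; lra. }
  assert (X2 := Cmod_sub_le (Csum (fun k => c k s) (S N) - 1) (Csum (fun k => c k s) (S N) - c 0 s * Csum psi (S N))).
  lra.
Qed.

(** Proportionality and the normalisation [c_0 h -> 1] identify the limit, and every
    average stays in [Om] by convexity. *)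
Lemma ratio_approx (b : nat -> R) (n : nat) (Om : C -> Prop) (eps : R) : convex Om ->
  (forall A, inv_disk r A -> Om (Csum (fun k => RtoC (b k) * kernel mu k A)%C n)) -> 0 < eps ->
  exists w, Om w /\ Cmod (w - Csum (fun k => RtoC (b k) * psi k)%C n / h) <= eps.
Proof.
  intros HO Hk He. assert (Gm := good_mono). assert (Hn := Hh z z_in_disk). fold h in Hn.
  set (Sg := Csum (fun k => RtoC (b k) * psi k)%C n).
  assert (N : null good (fun s => Csum (fun k => RtoC (b k) * (c k s - psi k * c 0 s))%C n
       + Sg / h * (c 0 s * h - 1))%C).
  { apply null_plus; auto.
    - apply (null_Csum good Gm (fun k s => RtoC (b k) * (c k s - psi k * c 0 s))%C).
      intros k _. apply null_scal, c_proportional.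
    - apply null_scal, c_0_limit. }
  destruct (N eps He) as [d [Hd Hs]]. destruct (good_exists d Hd) as [s Hg]. specialize (Hs s Hg).
  destruct Hg as [G1 _].
  exists (fst s (fun A => Csum (fun k => RtoC (b k) * kernel mu k A)%C n)). split.
  - apply (mean_convex _ _ G1); auto.
  - rewrite (mean_Csum _ _ G1 (fun k A => RtoC (b k) * kernel mu k A)%C).
    eapply Rle_trans; [| exact Hs ]. right. f_equal.
    rewrite (Csum_ext _ (fun k => RtoC (b k) * c k s)%C) by (intros k _; apply (mean_scal _ _ G1)).
    rewrite (Csum_ext (fun k => RtoC (b k) * (c k s - psi k * c 0 s))%C
       (fun k => RtoC (b k) * c k s + - c 0 s * (RtoC (b k) * psi k))%C) by (intros; ring).
    rewrite Csum_plus, Csum_scal. fold Sg. field. auto.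
Qed.

End Ratio.

(** * Closedness of power disks *)

(** On the image of the disk the principal root undoes the power, and the real part
    stays away from [0]; both are needed to pass to the limit. *)
Lemma power_disk_root (mu r : R) (w : C) : 0 < mu <= 1 -> 0 <= r < 1 -> power_disk mu r w ->
  (1 - r) / 2 <= Re w /\ Cmod (1 - Cpower w (/ mu)) <= r /\
  - (PI / 2) < / mu * Carg w < PI / 2.
Proof.
  intros Hmu Hr [u [Hu Ew]].
  assert (HRe := disk_Re_pos u r ltac:(lra) Hu). assert (Hu0 := Re_pos_neq_0 u HRe).
  assert (Hb := Carg_pos u HRe). assert (Hp := PI_RGT_0).
  assert (Hlog : Clog w = (RtoC mu * Clog u)%C).
  { rewrite Ew. apply Clog_Cexp. rewrite im_scal_l. simpl. nra. }
  assert (Harg : Carg w = mu * Carg u).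
  { change (Carg w) with (Im (Clog w)). rewrite Hlog, im_scal_l. reflexivity. }
  assert (Hroot : Cpower w (/ mu) = u).
  { unfold Cpower. rewrite Hlog, Cmult_assoc, <- RtoC_mult, Rinv_l, Cmult_1_l by lra.
    apply Cexp_Clog; auto. }
  assert (Hm : 0 < Cmod u) by (apply Cmod_gt_0; auto).
  split; [| split].
  - rewrite Ew. unfold Cpower. rewrite Re_Cexp, re_scal_l, im_scal_l. simpl.
    change (exp (mu * ln (Cmod u))) with (Rpower (Cmod u) mu).
    assert (Hcos : cos (Carg u) <= cos (mu * Carg u)).
    { destruct (Rle_dec 0 (Carg u)).
      - apply cos_decr_1; nra.
      - rewrite <- (cos_neg (Carg u)), <- (cos_neg (mu * Carg u)). apply cos_decr_1; nra. }
    assert (Hpow : Rpower (Cmod u) mu = Rpower (Cmod u) (mu - 1) * Cmod u).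
    { rewrite <- (Rpower_1 (Cmod u)) at 3 by auto. rewrite <- Rpower_plus. f_equal. ring. }
    assert (Hm2 : Cmod u <= 2).
    { assert (H := Cmod_sub_le 1 (1 - u)). rewrite Cmod_1 in H.
      replace (1 - (1 - u))%C with u in H by ring. lra. }
    assert (Hhalf : 1 / 2 <= Rpower (Cmod u) (mu - 1)).
    { apply Rle_trans with (Rpower 2 (mu - 1)); [| apply Rpower_decr; lra ].
      replace (1 / 2) with (Rpower 2 (- (1))) by (rewrite Rpower_Ropp, Rpower_1; lra).
      apply Rle_Rpower; lra. }
    assert (HR : 1 - r <= Re u).
    { assert (H := re_le_Cmod (1 - u)). apply Rabs_le_between in H.
      replace (Re (1 - u)) with (1 - Re u) in H by (destruct u; simpl; ring). lra. }
    assert (HRu := cos_Carg u Hu0).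
    assert (Hpp := Rpower_pos (Cmod u) mu).
    apply Rle_trans with (Rpower (Cmod u) mu * cos (Carg u)); [| apply Rmult_le_compat_l; lra ].
    rewrite Hpow, Rmult_assoc, HRu. nra.
  - rewrite Hroot. exact Hu.
  - rewrite Harg, <- Rmult_assoc, Rinv_l, Rmult_1_l by lra. exact Hb.
Qed.

Lemma power_disk_limit (mu r : R) (F : C) : 0 < mu <= 1 -> 0 <= r < 1 ->
  (forall eps, 0 < eps -> exists w, power_disk mu r w /\ Cmod (w - F) <= eps) ->
  0 < Re F /\ Cmod (1 - Cpower F (/ mu)) <= r /\ Cpower (Cpower F (/ mu)) mu = F.
Proof.
  intros Hmu Hr Happ. assert (Hp := PI_RGT_0).
  assert (HRe : 0 < Re F).
  { destruct (Happ ((1 - r) / 4) ltac:(lra)) as [w [Hw1 Hw2]].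
    destruct (power_disk_root mu r w Hmu Hr Hw1) as [H _].
    assert (H1 := re_le_Cmod (w - F)). apply Rabs_le_between in H1.
    replace (Re (w - F)) with (Re w - Re F) in H1 by (destruct w, F; simpl; ring). lra. }
  assert (Hmi : 0 < / mu) by (apply Rinv_0_lt_compat; lra).
  split; auto. split.
  - apply Rnot_lt_le. intros Hlt.
    set (e := (Cmod (1 - Cpower F (/ mu)) - r) / 2).
    assert (Hc := cderiv_cont _ _ _ (cderiv_Cpower F (/ mu) HRe)).
    destruct (Hc e ltac:(unfold e; lra)) as [d [Hd Hw]].
    destruct (Happ (d / 2) ltac:(lra)) as [w [Hw1 Hw2]].
    destruct (power_disk_root mu r w Hmu Hr Hw1) as [_ [H _]].
    specialize (Hw w ltac:(lra)).
    assert (Ht := Cmod_triangle (1 - Cpower w (/ mu)) (Cpower w (/ mu) - Cpower F (/ mu))).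
    replace (1 - Cpower w (/ mu) + (Cpower w (/ mu) - Cpower F (/ mu)))%C with (1 - Cpower F (/ mu))%C in Ht by ring.
    unfold e in Hw. lra.
  - unfold Cpower at 1. unfold Cpower. rewrite Clog_Cexp.
    + rewrite Cmult_assoc, <- RtoC_mult, Rinv_r, Cmult_1_l by lra. apply Cexp_Clog, Re_pos_neq_0, HRe.
    + rewrite im_scal_l. change (Im (Clog F)) with (Carg F).
      assert (Hc := cderiv_cont _ _ _ (cderiv_Clog F HRe)).
      destruct (Hc (PI / 4 * mu)) as [d [Hd Hw]]; [ nra |].
      destruct (Happ (d / 2) ltac:(lra)) as [w [Hw1 Hw2]].
      destruct (power_disk_root mu r w Hmu Hr Hw1) as [_ [_ H]].
      specialize (Hw w ltac:(lra)).
      assert (H1 := im_le_Cmod (Clog w - Clog F)).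
      replace (Im (Clog w - Clog F)) with (Carg w - Carg F) in H1 by (simpl; ring).
      assert (H2 : Rabs (Carg w - Carg F) <= PI / 4 * mu) by lra.
      apply Rabs_le_between in H2.
      assert (H3 : / mu * (Carg w - Carg F) <= PI / 4).
      { apply Rle_trans with (/ mu * (PI / 4 * mu)); [ apply Rmult_le_compat_l; lra | right; field; lra ]. }
      assert (H4 : - (PI / 4) <= / mu * (Carg w - Carg F)).
      { apply Rle_trans with (/ mu * - (PI / 4 * mu)); [ right; field; lra | apply Rmult_le_compat_l; lra ]. }
      lra.
Qed.

(** * Cesaro weights and the subordination *)

(** Summation by parts writes the mean as a convex combination of partial sums. *)
Lemma weighted_sum_convex (Om : C -> Prop) (q : nat -> C) (b : nat -> R) (n : nat) :
  convex Om -> (forall k, 0 < b k) -> (forall k, b k <= b (S k)) ->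
  (forall k, (k <= n)%nat -> Om (Csum q (S k))) ->
  Om (Csum (fun k => RtoC (/ b n * b (n - k)%nat) * q k)%C (S n)).
Proof.
  intros HO Hb Hmono Hq.
  assert (Hbc : forall k, RtoC (b k) <> 0) by (intros k E; apply RtoC_inj in E; specialize (Hb k); lra).
  assert (H : forall m, (m <= n)%nat ->
    Om (/ RtoC (b m) * (Csum (fun i => RtoC (b i) * q (n - i)%nat) (S m) + RtoC (b m) * Csum q (n - m)))%C).
  { induction m as [|m IH]; intros Hm.
    - replace (/ RtoC (b O) * (Csum (fun i => RtoC (b i) * q (n - i)%nat) 1 + RtoC (b O) * Csum q (n - 0)))%C
        with (Csum q (S n)).
      + apply Hq. lia.
      + simpl. rewrite Nat.sub_0_r. field. auto.
    - specialize (IH ltac:(lia)). set (X := (/ RtoC (b m) * _)%C) in IH.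
      replace (/ RtoC (b (S m)) * (Csum (fun i => RtoC (b i) * q (n - i)%nat) (S (S m)) + RtoC (b (S m)) * Csum q (n - S m)))%C
        with (RtoC (b m / b (S m)) * X + RtoC (1 - b m / b (S m)) * Csum q (S (n - S m)))%C.
      + apply HO; auto.
        * apply Hq. lia.
        * assert (H1 := Hb m). assert (H2 := Hb (S m)). assert (H3 := Hmono m).
          apply Rdiv_between_0_1; lra.
      + unfold X. assert (H2 := Hb (S m)).
        rewrite RtoC_minus, RtoC_div by lra.
        change (Csum (fun i => RtoC (b i) * q (n - i)%nat)%C (S (S m)))
          with (Csum (fun i => RtoC (b i) * q (n - i)%nat)%C (S m) + RtoC (b (S m)) * q (n - S m)%nat)%C.
        replace (n - m)%nat with (S (n - S m)) by lia.
        set (Y := Csum (fun i => RtoC (b i) * q (n - i)%nat)%C (S m)).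
        simpl Csum. field. auto. }
  specialize (H n (le_n n)). rewrite Nat.sub_diag in H.
  replace (Csum (fun k => RtoC (/ b n * b (n - k)%nat) * q k)%C (S n))
    with (/ RtoC (b n) * (Csum (fun i => RtoC (b i) * q (n - i)%nat) (S n) + RtoC (b n) * Csum q 0))%C; auto.
  rewrite Csum_rev. simpl (Csum q 0). rewrite Cmult_0_r, Cplus_0_r, <- Csum_scal.
  apply Csum_ext. intros k Hk. specialize (Hb n).
  replace (n - (n - k))%nat with k by lia. rewrite RtoC_mult, RtoC_inv by lra. ring.
Qed.

Lemma poch_pos (x : R) (k : nat) : 0 < x -> 0 < poch x k.
Proof.
  intros Hx. induction k as [|k IH]; simpl; [ lra |].
  apply Rmult_lt_0_compat; auto. assert (H := pos_INR k). lra.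
Qed.

Section Weights.
Context (b c : R) (hc : 0 < Rmax c (2 * c - 1)) (hb : Rmax c (2 * c - 1) <= b).

Lemma c_pos : 0 < c.
Proof. unfold Rmax in hc. destruct (Rle_dec c (2 * c - 1)); lra. Qed.

Lemma c_le_b : c <= b.
Proof. eapply Rle_trans; [ apply Rmax_l | exact hb ]. Qed.

Lemma B_pos (k : nat) : 0 < B b c k.
Proof.
  assert (H1 := c_pos). assert (H2 := c_le_b). destruct k as [|k]; [ simpl; lra |].
  unfold B. apply Rmult_lt_0_compat; apply Rdiv_lt_0_compat; try apply poch_pos; lra.
Qed.

(** Apart from the first one, the quotients of consecutive weights are
    [(b+k)/(c+k)], and [b >= c] suffices; the first one is [(1+b-c)/c], which is
    where [b >= 2c - 1] enters. *)
Lemma B_mono (k : nat) : B b c k <= B b c (S k).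
Proof.
  assert (H1 := c_pos). assert (H2 := c_le_b).
  assert (H3 : 2 * c - 1 <= b) by (eapply Rle_trans; [ apply Rmax_r | exact hb ]).
  destruct k as [|k].
  - simpl. apply Rmult_le_reg_r with c; auto.
    replace (1 * (b + 0) / (1 * (c + 0)) * ((1 + b - c) / b) * c) with (1 + b - c) by (field; lra). lra.
  - assert (HB := B_pos (S k)).
    assert (HP := poch_pos c (S k) H1). assert (Hk := pos_INR (S k)).
    replace (B b c (S (S k))) with (B b c (S k) * ((b + INR (S k)) / (c + INR (S k)))).
    + rewrite <- (Rmult_1_r (B b c (S k))) at 1. apply Rmult_le_compat_l; [ lra |].
      apply Rmult_le_reg_r with (c + INR (S k)); [ lra |]. unfold Rdiv. rewrite Rmult_assoc, Rinv_l; lra.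
    + unfold B. change (poch b (S (S k))) with (poch b (S k) * (b + INR (S k))).
      change (poch c (S (S k))) with (poch c (S k) * (c + INR (S k))). field. repeat split; lra.
Qed.

End Weights.

Lemma extend0_neq (g : C -> C) (z : C) : z <> 0 -> extend0 g z = g z.
Proof. intros H. unfold extend0. destruct (Ceq_dec z 0); auto. contradiction. Qed.

Lemma extend0_removable (g G : C -> C) (z : C) :
  (forall w : C, w <> 0 -> Cmod w < 1 -> g w = G w) -> ccont G 0 -> Cmod z < 1 -> extend0 g z = G z.
Proof.
  intros Hg HG Hz. unfold extend0. destruct (Ceq_dec z 0) as [->|Hne]; auto.
  apply (C_lim_cont g G 0 1); auto; [ lra |]. intros w Hw Hw1. apply Hg; auto.
  replace (w - 0)%C with w in Hw1 by ring. auto.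
Qed.

Lemma power_series_Cser (a : nat -> C) (h : C -> C) : power_series_on_disk a h ->
  forall z, Cmod z < 1 -> Cser (fun k => a k * z ^ k)%C (h z).
Proof.
  intros H z Hz. apply is_series_Cser. eapply is_series_ext; [| apply (H z Hz) ].
  intros k. cbv beta.
  assert (E : pow_n (K := C_Ring) z k = (z ^ k)%C).
  { induction k as [|k IH]; [ reflexivity |]. simpl. rewrite <- IH. reflexivity. }
  change (mult (K := C_Ring) (pow_n (K := C_Ring) z k) (a k) = (a k * z ^ k)%C). rewrite E.
  change ((z ^ k * a k)%C = (a k * z ^ k)%C). ring.
Qed.

Theorem theorem2p2 (b c lambda : R) (n : nat) (f : C -> C) (a : nat -> C)
  (hc : 0 < Rmax c (2 * c - 1))
  (hb : Rmax c (2 * c - 1) <= b)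
  (hlambda : 1 / 2 <= lambda < 1)
  (hf : starlike_of_order lambda f)
  (ha : power_series_on_disk a (extend0 (fun z : C => (f z / z)%C))) :
  subordinate
    (extend0 (fun z : C => (z * cesaro b c n a z / f z)%C))
    (fun z : C => Cpower (RtoC 1 - z)%C (2 - 2 * lambda)).
Proof.
  destruct hf as [_ [Hf0 [Hf1 [Hfn Hfre]]]]. unfold in_disk in *.
  set (mu := 2 - 2 * lambda). assert (Hmu : 0 < mu <= 1) by (unfold mu; lra).
  assert (Hser := power_series_Cser a _ ha).
  assert (Ha : adm a) by (apply adm_of_series with (1 := Hser)).
  assert (Hh : forall z, Cmod z < 1 -> extend0 (fun z => (f z / z)%C) z = Cps a z).
  { intros z Hz. apply (Cser_unique _ _ _ (Hser z Hz)). apply Cps_correct; auto. }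
  assert (Hfz : forall z, Cmod z < 1 -> f z = (z * Cps a z)%C).
  { intros z Hz. destruct (Ceq_dec z 0) as [->|Hne]; [ rewrite Hf0; ring |].
    rewrite <- Hh, extend0_neq by auto. field. auto. }
  assert (Hloc : forall z, Cmod z < 1 -> forall w, Cmod (w - z) < 1 - Cmod z -> Cmod w < 1).
  { intros z Hz w Hw. assert (H := Cmod_triangle (w - z) z).
    replace (w - z + z)%C with w in H by ring. lra. }
  assert (Hdf : forall z, Cmod z < 1 -> C_derive f z = (Cps a z + z * Cps' a z)%C).
  { intros z Hz. apply cderiv_C_derive.
    apply (cderiv_ext_loc (fun w => w * Cps a w)%C _ _ _ (1 - Cmod z)); [ lra | |].
    - intros w Hw. symmetry. apply Hfz. apply (Hloc z Hz w Hw).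
    - eapply cderiv_eq; [| apply cderiv_mult; [ apply cderiv_id | apply cderiv_Cps; auto ] ]. cbv beta. ring. }
  assert (H00 : Cmod 0 < 1) by (rewrite Cmod_0; lra).
  assert (Ha0 : a O = 1).
  { rewrite <- Hf1, Hdf by auto. rewrite Cps_at_0 by auto. ring. }
  assert (Hn : forall z, Cmod z < 1 -> Cps a z <> 0).
  { intros z Hz E. destruct (Ceq_dec z 0) as [->|Hne].
    - rewrite Cps_at_0, Ha0 in E by auto. apply RtoC_inj in E. lra.
    - apply (Hfn z Hz Hne). rewrite Hfz, E by auto. ring. }
  assert (HP : forall z, Cmod z < 1 -> - (mu / 2) < Re (Cps (times_index a) z / Cps a z)).
  { intros z Hz. rewrite times_index_Cps by auto. destruct (Ceq_dec z 0) as [->|Hne].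
    - replace (0 * Cps' a 0 / Cps a 0)%C with (RtoC 0) by (field; auto). simpl. lra.
    - assert (H := Hfre z Hz). rewrite extend0_neq, Hdf, Hfz in H by auto.
      replace (z * (Cps a z + z * Cps' a z) / (z * Cps a z))%C
        with (1 + z * Cps' a z / Cps a z)%C in H by (field; auto).
      rewrite re_plus in H. simpl (Re 1) in H. unfold mu. lra. }
  set (sg := fun z => Csum (fun k => RtoC (/ B b c n * B b c (n - k)) * (a k * z ^ k))%C (S n)).
  assert (Hces : forall z, cesaro b c n a z = sg z).
  { intros z. unfold cesaro, sg. rewrite Csum_sum_n, <- Csum_scal. apply Csum_ext.
    intros k _. rewrite RtoC_mult. ring. }
  assert (Hsg : forall z, exists l, cderiv sg z l).
  { intros z. eexists. apply (cderiv_Csum (fun k z => RtoC (/ B b c n * B b c (n - k)) * (a k * z ^ k))%C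
      (fun k z => RtoC (/ B b c n * B b c (n - k)) * (a k * (INR k * z ^ pred k)))%C).
    intros k. apply cderiv_scal, cderiv_scal, cderiv_pow. }
  set (F := extend0 (fun z => (z * cesaro b c n a z / f z)%C)).
  set (F0 := fun z => (sg z / Cps a z)%C).
  assert (HF0 : forall z, Cmod z < 1 -> exists l, cderiv F0 z l).
  { intros z Hz. destruct (Hsg z) as [l Hl]. eexists. apply cderiv_div; [ apply Hn; auto | exact Hl | apply cderiv_Cps; auto ]. }
  assert (HF : forall z, Cmod z < 1 -> F z = F0 z).
  { intros z Hz. apply extend0_removable; auto.
    - intros w Hw Hw1. rewrite Hces, Hfz by auto. unfold F0. field. auto.
    - destruct (HF0 0 H00) as [l Hl]. eapply cderiv_cont, Hl. }
  assert (HFd : forall z, Cmod z < 1 -> exists l, cderiv F z l).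
  { intros z Hz. destruct (HF0 z Hz) as [l Hl]. exists l.
    apply (cderiv_ext_loc F0 _ _ _ (1 - Cmod z)); [ lra | | exact Hl ].
    intros w Hw. symmetry. apply HF. apply (Hloc z Hz w Hw). }
  assert (Hkey : forall z r, Cmod z < r -> r < 1 ->
    0 < Re (F z) /\ Cmod (1 - Cpower (F z) (/ mu)) <= r /\ Cpower (Cpower (F z) (/ mu)) mu = F z).
  { intros z r Hz Hr. assert (Hz0 := Cmod_ge_0 z).
    assert (Hr0 : 0 <= r < 1) by lra.
    apply power_disk_limit; auto. intros eps He.
    rewrite HF by lra. unfold F0, sg.
    apply (ratio_approx mu Hmu a Ha Ha0 Hn HP z r Hz Hr (fun k => / B b c n * B b c (n - k)) (S n) (power_disk mu r) eps); auto.
    - apply power_disk_convex; auto.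
    - intros A HA. apply (weighted_sum_convex _ (fun k => kernel mu k A) (B b c) n).
      + apply power_disk_convex; auto.
      + intros k. apply B_pos; auto.
      + intros k. apply B_mono; auto.
      + intros k _. assert (HRe := inv_disk_Re r Hr0 A HA).
        rewrite (Csum_kernel mu) by lra. apply binom_ratio_in_power_disk; auto.
        split; [ apply inv_disk_param; auto | lra ]. }
  assert (Hpos : forall z, Cmod z < 1 -> 0 < Re (F z)).
  { intros z Hz. apply (Hkey z ((1 + Cmod z) / 2)); lra. }
  set (omega := fun z => (1 - Cpower (F z) (/ mu))%C).
  assert (Hom : forall z, Cmod z < 1 -> Cmod (omega z) <= Cmod z).
  { intros z Hz. apply Rnot_lt_le. intros Hlt.
    set (r := Rmin ((Cmod (omega z) + Cmod z) / 2) ((1 + Cmod z) / 2)).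
    assert (H1 : r <= (Cmod (omega z) + Cmod z) / 2) by apply Rmin_l.
    assert (H2 : r <= (1 + Cmod z) / 2) by apply Rmin_r.
    assert (H3 : Cmod z < r) by (apply Rmin_glb_lt; lra).
    destruct (Hkey z r H3 ltac:(lra)) as [_ [H _]]. fold (omega z) in H. lra. }
  split; [| split ].
  - intros z Hz. destruct (HFd z Hz) as [l Hl]. exists l. apply cderiv_is_derive, Hl.
  - intros z Hz. eexists. apply cderiv_is_derive, cderiv_power_1_minus. exact Hz.
  - exists omega. split; [| split; [| split ]].
    + intros z Hz. destruct (HFd z Hz) as [l Hl]. eexists. apply cderiv_is_derive.
      apply cderiv_minus; [ apply cderiv_const |].
      apply (cderiv_comp (fun u => Cpower u (/ mu)) F); [ exact Hl | apply cderiv_Cpower, Hpos, Hz ].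
    + intros z Hz. unfold in_disk in *. specialize (Hom z Hz). lra.
    + exact Hom.
    + intros z Hz. unfold omega. replace (1 - (1 - Cpower (F z) (/ mu)))%C with (Cpower (F z) (/ mu)) by ring.
      symmetry. apply (Hkey z ((1 + Cmod z) / 2)); unfold in_disk in Hz; lra.
Qed.
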